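(* Let $G$ be a connected graph of order $n$ with girth $g\ge 4$, and let $k$ be an integer with $1\le k\le \min\{g-1,\,n-g\}$. Then \[ m_G[n-g-k+4,\,n]\le n-g . \] Moreover, for $k=1$ equality holds if and only if $g=n-1$ (i.e., $G\cong K_{2,3}$ or $G\cong U_n$), and for $k=2$ equality holds if and only if \[ G\cong \begin{cases} K_{2,4} \text{ or } K_{2,3}^* & \text{if } n=6,\\ K_{2,3}^{**} \text{ or } Y_{7,3} & \text{if } n=7,\\ K_{2,3}^{***} \text{ or } Y_{8,4} & \text{if } n=8,\\ Y_{n,i} \text{ for some } i\in\{3,\dots,\lceil\tfrac{n-1}{2}\rceil\} & \text{if } n\ge 9. \end{cases} \]
   Context: All graphs are finite and simple. The Laplacian matrix of $G$ is $L(G)=D(G)-A(G)$ (degree diagonal matrix minus adjacency matrix); its eigenvalues are the Laplacian eigenvalues of $G$, all lying in $[0,n]$. For an interval $I\subseteq[0,n]$, $m_G I$ denotes the number of Laplacian eigenvalues of $G$, counted with multiplicity, lying in $I$. The girth of $G$ is the length of a shortest cycle. $K_{p,q}$ is the complete bipartite graph with parts of sizes $p,q$; $C_m$ is the cycle on $m$ vertices. $U_n$ is the graph obtained from $C_{n-1}$ by adding a new vertex and an edge joining it to one vertex of $C_{n-1}$. Let $K_{2,3}$ have parts $\{a,b\}$ and $\{x,y,z\}$. $K_{2,3}^*$ is obtained from $K_{2,3}$ by subdividing the edge $bz$ once (inserting one new vertex); $K_{2,3}^{**}$ is obtained from $K_{2,3}$ by subdividing each of the edges $bz$ and $bx$ once;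 $K_{2,3}^{***}$ is obtained by subdividing each of $bx,by,bz$ once (equivalently, two vertices joined by three internally disjoint paths of length $3$). For $n\ge 6$, let $C_{n-2}=u_1u_2\cdots u_{n-2}u_1$, and for $1\le i\le\lceil\frac{n-1}{2}\rceil$ let $Y_{n,i}$ be the graph obtained from $C_{n-2}$ and two new vertices $w,z$ by adding the edges $u_1w$ and $u_iz$. *)

(* Defs.v *)
From mathcomp Require Import all_boot all_order all_algebra.
From mathcomp Require Import polyrcf.

Set Implicit Arguments.
Unset Strict Implicit.
Unset Printing Implicit Defensive.

Import Order.TTheory GRing.Theory Num.Theory.
Local Open Scope ring_scope.

Record sgraph := SGraph {
  vertex :> finType;
  adj : rel vertex;
  adj_sym : symmetric adj;
  adj_irrefl : irreflexive adj }.

Arguments adj {s} : rename.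

Definition isomorphic (G H : sgraph) : Prop :=
  exists2 f : G -> H, bijective f & {mono f : x y / adj x y}.

Definition connected_graph (G : sgraph) : Prop :=
  (0 < #|G|)%N /\ forall x y : G, connect adj x y.

Definition graph_cycle (G : sgraph) (c : seq G) : Prop :=
  (2 < size c)%N /\ ucycle adj c.

(* A forest has no girth in this sense. *)
Definition has_girth (G : sgraph) (g : nat) : Prop :=
  (exists2 c : seq G, graph_cycle c & size c = g) /\
  (forall c : seq G, graph_cycle c -> (g <= size c)%N).

Section Laplacian.
Variables (R : rcfType) (G : sgraph).

Definition deg (x : G) : nat := #|[set y | adj x y]|.

(* Rows and columns are indexed by the canonical enumeration of the vertices. *)
Definition degree_mx : 'M[R]_#|G| := diag_mx (\row_i (deg (enum_val i))%:R).

Definition adjacency_mx : 'M[R]_#|G| :=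
  \matrix_(i, j) (adj (enum_val i) (enum_val j))%:R.

Definition laplacian : 'M[R]_#|G| := degree_mx - adjacency_mx.

(* [rootsR p] lists each root of [p] in R exactly once; the Laplacian is
   symmetric, so its eigenvalues all lie in R. *)
Definition laplacian_count (a b : R) : nat :=
  let p := char_poly laplacian in
  (\sum_(x <- rootsR p | (a <= x <= b)%R) mup x p)%N.

End Laplacian.

(* The loopless symmetric closure of [r]. *)
Section GraphOfRel.
Variables (T : finType) (r : rel T).

Definition rel_adj : rel T := fun x y => (x != y) && (r x y || r y x).

Lemma rel_adj_sym : symmetric rel_adj.
Proof. by move=> x y; rewrite /rel_adj eq_sym orbC. Qed.

Lemma rel_adj_irrefl : irreflexive rel_adj.
Proof. by move=> x; rewrite /rel_adj eqxx. Qed.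

Definition graph_of_rel : sgraph := SGraph rel_adj_sym rel_adj_irrefl.

End GraphOfRel.

Definition complete_bipartite (p q : nat) : sgraph :=
  @graph_of_rel ('I_p + 'I_q)%type
    (fun u v => match u, v with inl _, inr _ => true | _, _ => false end).

Definition cycle_graph (m : nat) : sgraph :=
  @graph_of_rel 'I_m (fun i j => (j : nat) == i.+1 %% m)%N.

(* [None] is a new vertex, joined to the vertices of [G] satisfying [P]. *)
Definition add_vertex (G : sgraph) (P : pred G) : sgraph :=
  @graph_of_rel (option G)
    (fun u v => match u, v with
                | Some x, Some y => adj x y
                | None, Some y => P y
                | _, _ => false
                end).

(* [None] is the vertex inserted in the edge xy. *)
Definition subdivide (G : sgraph) (x y : G) : sgraph :=
  @graph_of_rel (option G)
    (fun u v => match u, v with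
                | Some s, Some t =>
                    adj s t && ~~ ((s == x) && (t == y) || (s == y) && (t == x))
                | None, Some t => (t == x) || (t == y)
                | _, _ => false
                end).

Definition U_graph (n : nat) : sgraph :=
  @add_vertex (cycle_graph (n - 1)) (fun v : 'I_(n - 1) => val v == 0%N).

(* The cycle vertex u_j is the ordinal of value j - 1; the inner and outer new
   vertices are w and z. *)
Definition Y_graph (n i : nat) : sgraph :=
  @add_vertex (@add_vertex (cycle_graph (n - 2))
                 (fun v : 'I_(n - 2) => val v == 0%N))
    (fun v : option 'I_(n - 2) =>
       if v is Some u then val u == (i - 1)%N else false).

Definition K23 : sgraph := complete_bipartite 2 3.
Definition K23_b : K23 := inl (Ordinal (isT : 1 < 2)%N).
Definition K23_x : K23 := inr (Ordinal (isT : 0 < 3)%N).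
Definition K23_y : K23 := inr (Ordinal (isT : 1 < 3)%N).
Definition K23_z : K23 := inr (Ordinal (isT : 2 < 3)%N).

Definition K23s : sgraph := @subdivide K23 K23_b K23_z.
Definition K23ss : sgraph := @subdivide K23s (Some K23_b) (Some K23_x).
Definition K23sss : sgraph :=
  @subdivide K23ss (Some (Some K23_b)) (Some (Some K23_y)).

(* Main.v *)
From Stdlib Require Import ZArith.
Require Import Defs.
From mathcomp Require Import all_boot all_order all_algebra.
From mathcomp Require Import spectral polyrcf complex zify ssrZ ring lra.

Set Implicit Arguments.
Unset Strict Implicit.
Unset Printing Implicit Defensive.

Import Order.TTheory GRing.Theory Num.Theory.
Local Open Scope ring_scope.

(* Fix a shortest cycle and let K be the set of the s = n - g other vertices. There
   are at most s eigenvalues >= t as soon as the quadratic form q of the Laplacian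
   satisfies q(x) < t |x|^2 on the nonzero vectors of a subspace of codimension s.
   Deleting a vertex lowers q by at most |x|^2 on the hyperplane where x vanishes
   there, so it is enough to treat k = |K| < g with t = 4, and for the strict
   inequalities |K| = 2 or 3 with t = 5. If g >= 5, then K induces a forest and each
   of its vertices has at most one neighbour (its foot) on the cycle; where x vanishes
   at the feet, or takes equal values at the ends of a few edges, q is bounded by a
   weighted Gershgorin estimate for degrees at most two. If g = 4, then |K| <= 3 and
   q is diagonalized for all the graphs in question. For |K| = 2 the bound improves to
   one eigenvalue >= 4 except for the graphs of the theorem, where explicit planes on
   which q >= 4 |x|^2 show that there are two. *)

(** The interval is closed below, so every upper bound has to be strict, while for degrees at most
    two the bound 4 |x|^2 is attained, for instance by the alternating vector on an even cycle. Each
    component must therefore contain a point where x vanishes or a vertex of degree at most one.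
    This is why an edge between K and the cycle is kept through all reductions. The hypothesis k < g
    is used as |K| < g: a cycle inside K would be shorter than g. Write s = n - g. Deleting s - k
    vertices turns the level 4 into s - k + 4, which is the threshold of the theorem. For the
    equality cases the levels are chosen to land on the same threshold with one condition less: a
    pair at level 5 with one condition gives 5 + (s - 2) = s + 3 with s - 1 conditions, the
    threshold for k = 1; a triple at level 5 with two conditions gives 5 + (s - 3) = s + 2, again
    with s - 1 conditions, the threshold for k = 2. So equality forces s = k, and only the graphs
    with one or two vertices off the cycle, at threshold 4, have to be classified. *)

Lemma nonzero_kernel (F : fieldType) m p (M : 'M[F]_(m, p)) :
  (p < m)%N -> exists2 v : 'rV[F]_m, v != 0 & v *m M = 0.
Proof.
move=> pm; have : kermx M != 0.
  rewrite kermx_eq0 /row_free neq_ltn; apply/orP; left.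
  exact: leq_ltn_trans (rank_leq_col M) pm.
move=> /rowV0Pn[v /sub_kermxP vM v0]; by exists v.
Qed.

(** * Eigenvalue counts of a real symmetric matrix from its quadratic form *)

Section SymmetricCount.
Variable R : rcfType.
Local Open Scope sesquilinear_scope.
Local Notation C := (R[i])%C.
Local Notation toC := (real_complex R).

Section Diagonalization.
Variables (n : nat) (A : 'M[R]_n).
Hypothesis A_sym : A^T = A.

(** The eigenvalues are real, but the eigenvectors stay complex because the matrix is diagonalized
    as a Hermitian one over [R[i]]. The counting below therefore evaluates the form on pairs of real
    vectors, the two parts of a complex one. *)
Lemma real_spectral : exists (P : 'M[C]_n) (d : 'I_n -> R),
  [/\ P *m P ^t* = 1%:M, P ^t* *m P = 1%:M,
      map_mx toC A = P ^t* *m diag_mx (\row_i toC (d i)) *m P &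
      char_poly A = \prod_(i < n) ('X - (d i)%:P)].
Proof.
pose AC := map_mx toC A.
have realAC : AC \is a realmx.
  by apply/mxOverP=> i j; rewrite mxE; apply/complex_realP; exists (A i j).
have symAC : AC \is symmetricmx.
  apply/is_hermitianmxP; rewrite expr0 scale1r map_mx_id // /AC.
  by apply/matrixP=> i j; rewrite !mxE -{1}A_sym mxE.
have hermAC := realsym_hermsym symAC realAC.
have /mxOverP dreal := hermitian_spectral_diag_real hermAC.
have /orthomx_spectralP AE := hermitian_normalmx hermAC.
have PU := spectral_unitarymx AC.
pose d i := complex.Re (spectral_diag AC 0 i).
have dE : spectral_diag AC = \row_i toC (d i).
  apply/rowP=> i; rewrite mxE /d; have /complex_realP[k ->] := dreal 0 i.
  by [].
have PP : spectralmx AC *m (spectralmx AC) ^t* = 1%:M by apply/unitarymxP.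
have PP' : (spectralmx AC) ^t* *m spectralmx AC = 1%:M by apply: mulmx1C.
exists (spectralmx AC), d; split => //.
  by rewrite -dE -[LHS]/AC {1}AE invmx_unitary.
apply: (map_poly_inj toC); rewrite map_char_poly -/AC.
rewrite rmorph_prod /=.
under eq_bigr do rewrite map_polyXsubC.
set D := diag_mx (spectral_diag AC).
have -> : char_poly AC = char_poly D.
  rewrite /char_poly; set P := spectralmx AC in AE PU PP PP' *.
  have -> : char_poly_mx AC =
    map_mx polyC (P ^t*) *m char_poly_mx D *m map_mx polyC P.
    rewrite {1}AE invmx_unitary // /char_poly_mx mulmxBr mulmxBl !map_mxM /=.
    congr (_ - _); rewrite mul_mx_scalar -scalemxAl -map_mxM PP' map_mx1.
    by rewrite scalemx1.
  rewrite !det_mulmx mulrC mulrA -det_mulmx -map_mxM PP map_mx1 det1.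
  by rewrite mul1r.
rewrite char_poly_trig; last by rewrite diag_mx_is_trig.
by apply: eq_bigr => i _; rewrite /D !mxE eqxx mulr1n dE mxE.
Qed.

End Diagonalization.

Definition mxform n (A : 'M[R]_n) (x : 'rV[R]_n) : R := (x *m A *m x^T) 0 0.

Lemma mxform1 n (x : 'rV[R]_n) : mxform 1%:M x = \sum_i x 0 i ^+ 2.
Proof.
by rewrite /mxform mulmx1 mxE; apply: eq_bigr => i _; rewrite mxE expr2.
Qed.

Lemma sum_sqr_ge0 (I : finType) (x : I -> R) : 0 <= \sum_i x i ^+ 2.
Proof. by apply: sumr_ge0 => i _; apply: sqr_ge0. Qed.

Lemma sum_sqr_eq0 n (x : 'rV[R]_n) : \sum_i x 0 i ^+ 2 = 0 -> x = 0.
Proof.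
move=> s0; apply/rowP=> i; rewrite mxE; apply/eqP; rewrite -sqrf_eq0.
by apply/eqP/(psumr_eq0P _ s0) => // j _; apply: sqr_ge0.
Qed.

(** A double count: the multiplicity of a root is the number of indices [i] at which [d] takes that
    value. *)
Lemma count_rootsR_prod n (d : 'I_n -> R) (a : pred R) :
  let p := \prod_(i < n) ('X - (d i)%:P) in
  (\sum_(x <- rootsR p | a x) mup x p)%N = #|[set i | a (d i)]|.
Proof.
move=> p; have p0 : p != 0.
  by apply/monic_neq0/monic_prod => i _; apply: monicXsubC.
have pE : p = \prod_(y <- [seq d i | i <- enum 'I_n]) ('X - y%:P).
  by rewrite big_map big_enum.
have mupE x : mup x p = #|[set i | d i == x]|.
  rewrite pE mu_prod_XsubC count_map -sum1_count big_enum_cond /= -sum1_card.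
  by apply: eq_bigl => i; rewrite !inE.
have rootE i : d i \in rootsR p.
  have /(_ (d i)) := roots_on_rootsR p0; rewrite in_itv /= => <-.
  rewrite -dvdp_XsubCl XsubC_dvd // mupE card_gt0.
  by apply/set0Pn; exists i; rewrite inE.
have uR : uniq (rootsR p) by exact: uniq_roots.
rewrite (eq_bigr (fun x => \sum_(i : 'I_n | d i == x) 1)%N); last first.
  by move=> x _; rewrite mupE -sum1_card; apply: eq_bigl => i; rewrite inE.
rewrite (exchange_big_dep predT) //=.
rewrite -sum1_card big_mkcond /= [RHS]big_mkcond /=.
apply: eq_bigr => i _; rewrite inE.
rewrite -big_filter.
case: ifP => adi.
  rewrite (bigD1_seq (d i)) ?filter_uniq //=; last first.
    by rewrite mem_filter adi eqxx rootE.
  rewrite big1_seq ?addn0 // => x /andP[xd].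
  by rewrite mem_filter => /andP[/andP[_ /eqP E]]; rewrite E eqxx in xd.
rewrite big1_seq // => x /andP[_].
by rewrite mem_filter => /andP[/andP[ax /eqP E]]; rewrite E ax in adi.
Qed.

Lemma complex_norm_sum n (w : 'I_n -> C) (d : 'I_n -> R) (t : R) (z : R)
   (q : R) :
  (toC q = \sum_i toC (d i) * (w i * (w i)^*)) ->
  (toC z = \sum_i (w i * (w i)^*)) ->
  (q - t * z = \sum_i (d i - t) * (complex.Re (w i)^+2 + complex.Im (w i)^+2)).
Proof.
move=> qE zE; apply: (@complexI R).
rewrite rmorphB rmorphM /= qE zE mulr_sumr -sumrB rmorph_sum /=.
apply: eq_bigr => i _; rewrite -mulrBl -rmorphB rmorphM /=; congr (_ * _).
by case: (w i) => a b; apply/eqP; rewrite eq_complex /=; apply/andP; split; apply/eqP; ring.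
Qed.

Section Count.
Variables (n : nat) (A : 'M[R]_n).
Hypothesis A_sym : A^T = A.

(** The mixed terms a B b^T and b B a^T agree by symmetry and come with opposite imaginary
    factors. *)
Lemma hermitian_split (B : 'M[R]_n) (a b : 'rV[R]_n) : B^T = B ->
  let z := map_mx toC a + 'i *: map_mx toC b in
  (z *m map_mx toC B *m z ^t*) 0 0 = toC (mxform B a + mxform B b).
Proof.
move=> B_sym z; rewrite /z.
have tc (c : 'rV[R]_n) : (map_mx toC c) ^t* = map_mx toC c^T.
  apply/matrixP=> i j; rewrite !mxE; apply/CrealP/complex_realP.
  by exists (c j i).
rewrite linearD /= linearZ /= map_mxD /= map_mxZ /= !tc conjCi.
rewrite mulmxDl mulmxDr !mulmxDl -!scalemxAl -!scalemxAr -!map_mxM /=.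
have -> : a *m B *m b^T = b *m B *m a^T.
  have -> : a *m B *m b^T = (a *m B *m b^T)^T.
    by apply/matrixP=> i j; rewrite [RHS]mxE !ord1.
  by rewrite !trmx_mul trmxK B_sym mulmxA.
rewrite rmorphD /= /mxform.
set p := b *m B *m a^T; set u := a *m B *m a^T; set v := b *m B *m b^T.
rewrite !mxE mulrA mulrN -expr2 sqrCi opprK mul1r.
by rewrite mulNr addrA addrK.
Qed.

(** Here [w a b i] is the squared modulus of the [i]-th spectral coordinate of a + i b, and [L i] is
    the column that computes this coordinate. The two counting lemmas use the diagonalization only
    through these four facts. *)
Lemma count_dichotomy : exists (d : 'I_n -> R) (w : 'rV[R]_n -> 'rV[R]_n -> 'I_n -> R)
   (L : 'I_n -> 'cV[C]_n),
  [/\ char_poly A = \prod_(i < n) ('X - (d i)%:P),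
      (forall a b i, 0 <= w a b i),
      (forall a b t, mxform A a + mxform A b
         - t * (mxform 1%:M a + mxform 1%:M b) = \sum_i (d i - t) * w a b i) &
      (forall a b i, ((map_mx toC a + 'i *: map_mx toC b) *m L i = 0) ->
         w a b i = 0)].
Proof.
have [P [d [PP PP' AE chE]]] := real_spectral A_sym.
pose z (a b : 'rV[R]_n) := map_mx toC a + 'i *: map_mx toC b.
pose W a b i := (z a b *m P ^t*) 0 i.
pose w a b i := complex.Re (W a b i) ^+2 + complex.Im (W a b i) ^+ 2.
exists d, w, (fun i => col i (P ^t*)); split => //.
- by move=> a b i; rewrite addr_ge0 ?sqr_ge0.
- move=> a b t; apply: complex_norm_sum.
    rewrite -hermitian_split //= -/(z a b) AE.
    have -> : z a b *m (P ^t* *m diag_mx (\row_i0 toC (d i0)) *m P) *m z a b ^t*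
      = (z a b *m P ^t*) *m diag_mx (\row_i0 toC (d i0)) *m (z a b *m P ^t*) ^t*.
      by rewrite [in RHS]trmx_mul map_mxM /= trmxCK !mulmxA.
    rewrite /W; move: (z a b *m P ^t*) => y.
    rewrite mxE; apply: eq_bigr => i _.
    by rewrite mul_mx_diag !mxE mulrAC mulrC.
  rewrite -hermitian_split ?trmx1 //= -/(z a b) map_mx1 mulmx1.
  have -> : z a b *m z a b ^t* = (z a b *m P ^t*) *m (z a b *m P ^t*) ^t*.
    by rewrite [in RHS]trmx_mul map_mxM /= trmxCK mulmxA -(mulmxA (z a b)) PP' mulmx1.
  rewrite /W; move: (z a b *m P ^t*) => y.
  by rewrite mxE; apply: eq_bigr => i _; rewrite !mxE.
- move=> a b i; rewrite -/(z a b) => h0.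
  have : W a b i = 0.
    move/matrixP: h0 => /(_ 0 0); rewrite [LHS]mxE [RHS]mxE => h0.
    rewrite /W mxE; apply: etrans h0; apply: eq_bigr => j _.
    by congr (_ * _); rewrite [in RHS]mxE.
  by rewrite /w => -> /=; rewrite !expr0n addr0.
Qed.

Local Notation zero_count a :=
  (\sum_(x <- rootsR (char_poly A) | a x) mup x (char_poly A))%N.

(** Dimension count: if more than [s] indices lay in [I], the conditions [F] and the vanishing of
    the spectral coordinates outside [I] would be fewer than [n] in number, so a nonzero complex
    vector would satisfy all of them. Its form would be at least t |v|^2 by its coordinates and
    smaller by [neg]. *)
Lemma count_le_of_constraints (t : R) (a : pred R) s (F : 'M[R]_(n, s)) :
    (forall x, a x -> t <= x) ->
    (forall x : 'rV_n, x != 0 -> x *m F = 0 -> mxform A x < t * mxform 1%:M x) ->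
  (zero_count a <= s)%N.
Proof.
move=> a_ge neg; have [d [w [L [-> w0 wE Lw]]]] := count_dichotomy.
rewrite count_rootsR_prod; set I := [set i | a (d i)].
rewrite leqNgt; apply/negP => sI.
pose E : 'M[C]_(n, #|~: I|) := \matrix_(i, j) L (enum_val j) i 0.
pose M := row_mx (map_mx toC F) E.
have [v v0 vM] : exists2 v : 'rV[C]_n, v != 0 & v *m M = 0.
  apply: nonzero_kernel; rewrite -[X in (_ < X)%N](card_ord n) -(cardsC I).
  by rewrite ltn_add2r.
move: vM; rewrite mul_mx_row => /eqP; rewrite row_mx_eq0 => /andP[/eqP vF /eqP vE].
pose x := map_mx (@complex.Re R) v; pose y := map_mx (@complex.Im R) v.
have vxy : v = map_mx toC x + 'i *: map_mx toC y.
  apply/rowP=> i; rewrite !mxE; exact: complexE.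
(* The conditions [F] are real, so the real and the imaginary part of [v] satisfy them
   separately. *)
have kerF (f : C -> R) : {morph f : u v / u + v} -> f 0 = 0 ->
    (forall u (r : R), f (u * toC r) = f u * r) -> map_mx f v *m F = 0.
  move=> fD f0 fZ; apply/rowP=> j; rewrite !mxE.
  have /matrixP/(_ 0 j) := vF; rewrite !mxE => /(congr1 f).
  rewrite f0 (big_morph f fD f0) => h; apply: etrans h.
  by apply: eq_bigr => i _; rewrite !mxE fZ.
have xF : x *m F = 0.
  by apply: kerF => // [[? ?] [? ?] | [p q] r] //=; rewrite mulr0 subr0.
have yF : y *m F = 0.
  by apply: kerF => // [[? ?] [? ?] | [p q] r] //=; rewrite mulr0 add0r.
have nonpos z : z *m F = 0 -> mxform A z <= t * mxform 1%:M z.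
  have [->|z0 zF] := eqVneq z 0; last exact/ltW/neg.
  by rewrite /mxform !mul0mx !mxE mulr0.
have : mxform A x + mxform A y - t * (mxform 1%:M x + mxform 1%:M y) < 0.
  rewrite mulrDr subr_lt0.
  have [x0|x0] := eqVneq x 0; last exact: ltr_leD (neg _ x0 xF) (nonpos _ yF).
  apply: ler_ltD (nonpos _ xF) (neg _ _ yF).
  by apply: contraNneq v0 => y0; rewrite vxy x0 y0 !map_mx0 scaler0 addr0.
rewrite wE ltNge => /negP; apply; apply: sumr_ge0 => i _.
case: (boolP (i \in I)) => [|iI].
  by rewrite inE => /a_ge ti; rewrite mulr_ge0 // subr_ge0.
rewrite Lw ?mulr0 // -vxy; apply/matrixP=> k l; rewrite !ord1 !mxE.
have iI' : i \in ~: I by rewrite inE.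
have /matrixP/(_ 0 (enum_rank_in iI' i)) := vE; rewrite !mxE => h; apply: etrans h.
by apply: eq_bigr => j _; rewrite mxE enum_rankK_in.
Qed.

(** The dual count: with fewer than [r] indices in [I], some nonzero complex combination of the rows
    of [B] has no spectral coordinate in [I]. The first hypothesis concerns roots only, so that the
    upper end of an interval can be settled by a bound on the spectrum. *)
Lemma count_ge_of_subspace (t : R) (a : pred R) r (B : 'M[R]_(r, n)) :
    (forall x, root (char_poly A) x -> t <= x -> a x) ->
    row_free B ->
    (forall y : 'rV_r, t * mxform 1%:M (y *m B) <= mxform A (y *m B)) ->
  (r <= zero_count a)%N.
Proof.
move=> a_ge Bfree pos; have [d [w [L [pE w0 wE Lw]]]] := count_dichotomy.
have {}a_ge i : t <= d i -> a (d i).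
  move=> td; apply: a_ge => //; rewrite pE rootE horner_prod.
  by rewrite (bigD1 i) //= !hornerE subrr mul0r.
rewrite pE count_rootsR_prod; set I := [set i | a (d i)].
rewrite leqNgt; apply/negP => rI.
pose E : 'M[C]_(n, #|I|) := \matrix_(i, j) L (enum_val j) i 0.
have [v v0 vM] := nonzero_kernel (map_mx toC B *m E) rI.
pose x := map_mx (@complex.Re R) v; pose y := map_mx (@complex.Im R) v.
have vxy : v = map_mx toC x + 'i *: map_mx toC y.
  apply/rowP=> i; rewrite !mxE; exact: complexE.
pose z := map_mx toC (x *m B) + 'i *: map_mx toC (y *m B).
have zE : z = v *m map_mx toC B.
  by rewrite vxy mulmxDl -scalemxAl /z !map_mxM.
have z0 : z != 0 by rewrite zE mulmx_free_eq0 // row_free_map.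
have wI i : i \in I -> w (x *m B) (y *m B) i = 0.
  move=> iI; apply: Lw; rewrite -/z zE; apply/matrixP=> k l; rewrite !ord1.
  rewrite -mulmxA.
  have /matrixP/(_ 0 (enum_rank_in iI i)) := vM; rewrite [LHS]mxE [RHS]mxE => h.
  rewrite [LHS]mxE [RHS]mxE; apply: etrans h; apply: eq_bigr => j _; congr (_ * _).
  by rewrite !mxE; apply: eq_bigr => l' _; rewrite !mxE enum_rankK_in.
have := pos x; have := pos y; set p := mxform A _; set q := t * _ => qp.
set p' := mxform A _; set q' := t * _ => qp'.
have : 0 <= p' + p - (q' + q) by rewrite subr_ge0 lerD.
rewrite /q /q' -mulrDr wE => ge0.
have lti i : i \notin I -> d i < t.
  by move=> iI; rewrite ltNge; apply: contraNN iI => /a_ge; rewrite inE.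
have wz i : w (x *m B) (y *m B) i = 0.
  case: (boolP (i \in I)) => [/wI //|iI].
  have term j : (d j - t) * w (x *m B) (y *m B) j <= 0.
    case: (boolP (j \in I)) => [/wI ->|jI]; first by rewrite mulr0.
    by rewrite mulr_le0_ge0 // subr_le0 ltW // lti.
  have s0 : \sum_j - ((d j - t) * w (x *m B) (y *m B) j) = 0.
    by rewrite sumrN; apply/eqP; rewrite oppr_eq0; apply/eqP/le_anti; rewrite ge0 sumr_le0.
  have /(_ i isT)/eqP := psumr_eq0P (fun j _ => etrans (oppr_ge0 _) (term j)) s0.
  by rewrite oppr_eq0 mulf_eq0 subr_eq0 lt_eqF ?lti //= => /eqP.
have {}wE u : p' + p - u * (mxform 1%:M (x *m B) + mxform 1%:M (y *m B)) = 0.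
  by rewrite wE big1 // => i _; rewrite wz mulr0.
(* All [w] vanish, so the identity holds with right side 0 at every level; the difference of two
   levels isolates the norm. *)
move: (wE t) (wE (t - 1)); set N := mxform 1%:M _ + _.
move=> e1 e2; have N0 : N = 0.
  have -> : N = (p' + p - (t - 1) * N) - (p' + p - t * N) by ring.
  by rewrite e1 e2 subrr.
move: N0; rewrite /N !mxform1 => /eqP; rewrite paddr_eq0 ?sum_sqr_ge0 //.
move=> /andP[/eqP/sum_sqr_eq0 xB /eqP/sum_sqr_eq0 yB].
by move/eqP: z0; apply; rewrite /z xB yB !map_mx0 scaler0 addr0.
Qed.

End Count.
End SymmetricCount.

(** * Bounds for the form of a graph on a subspace of given codimension *)

Section Energy.
Variables (R : rcfType) (V : finType).
Implicit Types (e : rel V) (x : V -> R) (t : R) (s : nat).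

(** The sum runs over ordered pairs, so this is twice the form of the Laplacian; hence the factor 2
    in front of [t] below. *)
Definition energy e x : R := \sum_u \sum_v (e u v)%:R * (x u - x v) ^+ 2.

(** The subspace is given by a list of functionals, so that combining reductions is concatenation of
    lists. Any relation on the full vertex set is allowed for [e], so deleting vertices or edges
    does not change the type. *)
Definition index_le e t s : Prop :=
  exists2 fs : seq {ffun V -> R}, (size fs <= s)%N &
    forall x, (exists v, x v != 0) ->
      (forall f, f \in fs -> \sum_v f v * x v = 0) ->
      energy e x < 2 * t * \sum_v x v ^+ 2.

Lemma energy_le e e' x : subrel e e' -> energy e x <= energy e' x.
Proof.
move=> ee'; apply: ler_sum => u _; apply: ler_sum => v _.
apply: ler_wpM2r; first exact: sqr_ge0.
rewrite ler_nat.
by case euv: (e u v) => //; rewrite (ee' _ _ euv).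
Qed.

Lemma sum_sqr_gt0 x : (exists v, x v != 0) -> 0 < \sum_v x v ^+ 2.
Proof.
move=> [v xv]; rewrite (bigD1 v) //= ltr_pwDl ?exprn_even_gt0 //.
by apply: sumr_ge0 => w _; apply: sqr_ge0.
Qed.

Lemma index_le_mono e e' t t' s s' :
  subrel e e' -> t <= t' -> (s <= s')%N -> index_le e' t s -> index_le e t' s'.
Proof.
move=> ee' tt' ss' [fs sz neg]; exists fs; first exact: leq_trans ss'.
move=> x x0 xf; apply: le_lt_trans (energy_le _ ee') _.
apply: lt_le_trans (neg x x0 xf) _.
by rewrite ler_wpM2r ?ler_wpM2l //; apply/ltW/sum_sqr_gt0.
Qed.

Definition delta (v : V) : {ffun V -> R} := [ffun u => (u == v)%:R].

Lemma sum_delta v x : \sum_u delta v u * x u = x v.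
Proof.
rewrite (bigD1 v) //= ffunE eqxx mul1r big1 ?addr0 // => u uv.
by rewrite ffunE (negPf uv) mul0r.
Qed.

Definition delete_vertices e (D : {set V}) : rel V :=
  fun u v => [&& e u v, u \notin D & v \notin D].

(** Where [x] vanishes on [D], an edge from [v] into [D] contributes [x v ^+ 2], and [v] has at most
    [#|D|] such edges. *)
Lemma index_le_delete_vertices e (D : {set V}) t s :
  index_le (delete_vertices e D) t s -> index_le e (t + #|D|%:R) (s + #|D|).
Proof.
move=> [fs sz neg]; exists (fs ++ [seq delta v | v <- enum D]).
  by rewrite size_cat size_map -cardE leq_add2r.
move=> x x0 xf.
have xD v : v \in D -> x v = 0.
  move=> vD; rewrite -(sum_delta v) xf // mem_cat map_f ?orbT //.
  by rewrite mem_enum.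
have {}neg : energy (delete_vertices e D) x < 2 * t * \sum_v x v ^+ 2.
  by apply: neg => // f ff; apply: xf; rewrite mem_cat ff.
rewrite mulrDr mulrDl.
have term u v : (e u v)%:R * (x u - x v) ^+ 2 <=
    (delete_vertices e D u v)%:R * (x u - x v) ^+ 2
    + ((v \in D)%:R * x u ^+ 2 + (u \in D)%:R * x v ^+ 2).
  rewrite /delete_vertices; case uD: (u \in D); case vD: (v \in D);
  case: (e u v) => /=; rewrite ?(xD _ uD) ?(xD _ vD);
  rewrite ?mul0r ?mul1r ?addr0 ?add0r ?subr0 ?sub0r ?sqrrN ?expr0n //=;
  by rewrite ?addr_ge0 ?sqr_ge0.
apply: (@le_lt_trans _ _ (energy (delete_vertices e D) x + 2 * #|D|%:R * \sum_v x v ^+ 2));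
  last by rewrite ltrD2r.
apply: (@le_trans _ _ (\sum_u \sum_v ((delete_vertices e D u v)%:R * (x u - x v) ^+ 2
    + ((v \in D)%:R * x u ^+ 2 + (u \in D)%:R * x v ^+ 2)))).
  by apply: ler_sum => u _; apply: ler_sum => v _.
under eq_bigr do rewrite big_split /=.
rewrite big_split /= lerD2l.
under eq_bigr do rewrite big_split /= -mulr_suml -mulr_sumr.
have cD : \sum_(v : V) (v \in D)%:R = #|D|%:R :> R.
  by rewrite -natr_sum -sum1_card [in RHS]big_mkcond /=; congr (_%:R);
     apply: eq_bigr => v _; case: (v \in D).
rewrite big_split /= -mulr_sumr -mulr_suml cD.
by rewrite -mulrA [leRHS]mulr_natl mulr2n.
Qed.

Definition delete_edges e (E : seq (V * V)) : rel V :=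
  fun u v => [&& e u v, (u, v) \notin E & (v, u) \notin E].

(** An edge contributes nothing where [x] is equal at its ends. Unlike the deletion of a vertex,
    this costs a condition but does not raise the level. *)
Lemma index_le_delete_edges e (E : seq (V * V)) t s :
  index_le (delete_edges e E) t s -> index_le e t (s + size E).
Proof.
move=> [fs sz neg]; exists (fs ++ [seq [ffun v => delta p.1 v - delta p.2 v] | p <- E]).
  by rewrite size_cat size_map leq_add2r.
move=> x x0 xf.
have xE p : p \in E -> x p.1 = x p.2.
  move=> pE; apply/eqP; rewrite -subr_eq0 -(sum_delta p.1) -(sum_delta p.2) -sumrB.
  rewrite -[X in _ == X](xf [ffun v => delta p.1 v - delta p.2 v]).
    by apply/eqP; apply: eq_bigr => v _; rewrite [in RHS]ffunE mulrBl.
  rewrite mem_cat; apply/orP; right; apply/mapP; by exists p.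
suff -> : energy e x = energy (delete_edges e E) x.
  by apply: neg => // f ff; apply: xf; rewrite mem_cat ff.
apply: eq_bigr => u _; apply: eq_bigr => v _; rewrite /delete_edges.
case: (e u v) => //=.
case: (boolP ((u, v) \in E)) => [/xE /= ->|_]; first by rewrite subrr expr0n !mulr0.
by case: (boolP ((v, u) \in E)) => [/xE /= ->|_] //; rewrite subrr expr0n !mulr0.
Qed.

(* With x = w y, the identity
   (w u y u - w v y v)^2 + w u w v (y u + y v)^2
     = w u (w u + w v) (y u)^2 + w v (w u + w v) (y v)^2
   summed over the edges bounds the energy as in a weighted Gershgorin disc;
   equality would force |y| to be constant along the edges. *)
Lemma index_le_weights e (S : {set V}) (w : V -> R) t :
    symmetric e -> (forall v, 0 < w v) ->
    (forall v, v \notin S -> \sum_u (e v u)%:R * (w v + w u) <= t * w v) ->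
    (forall v, exists2 z, connect e v z &
       (z \in S) || (\sum_u (e z u)%:R * (w z + w u) < t * w z)) ->
  index_le e t #|S|.
Proof.
move=> e_sym w0 wt strict; exists [seq delta v | v <- enum S].
  by rewrite size_map -cardE.
move=> x x0 xf.
have xS v : v \in S -> x v = 0.
  by move=> vS; rewrite -(sum_delta v) xf // map_f // mem_enum.
pose y v := x v / w v.
have xE v : x v = w v * y v by rewrite /y mulrCA divff ?mulr1 // gt_eqF.
pose slack v := 2 * w v * y v ^+ 2 * (t * w v - \sum_u (e v u)%:R * (w v + w u)).
pose edge u v := (e u v)%:R * (w u * w v * (y u + y v) ^+ 2).
have id : 2 * t * \sum_v x v ^+ 2 = energy e x + \sum_v slack v + \sum_u \sum_v edge u v.
  have E1 : energy e x + \sum_u \sum_v edge u v =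
     \sum_u \sum_v ((e u v)%:R * (w u * (w u + w v) * y u ^+ 2)
       + (e v u)%:R * (w v * (w v + w u) * y v ^+ 2)).
    rewrite -big_split; apply: eq_bigr => u _; rewrite -big_split.
    by apply: eq_bigr => v _ /=; rewrite /edge !xE [e v u]e_sym; ring.
  rewrite addrAC E1.
  under [X in _ = X + _]eq_bigr do rewrite big_split /=.
  rewrite big_split /= [X in _ = _ + X + _]exchange_big /=.
  rewrite -mulr2n mulr_sumr -sumrMnl -big_split /=; apply: eq_bigr => u _.
  rewrite /slack xE.
  have -> : \sum_i (e u i)%:R * (w u * (w u + w i) * y u ^+ 2) =
      w u * y u ^+ 2 * \sum_i (e u i)%:R * (w u + w i).
    by rewrite mulr_sumr; apply: eq_bigr => i _; ring.
  ring.
have slack0 v : 0 <= slack v.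
  case: (boolP (v \in S)) => [vS|vS].
    by rewrite /slack /y (xS _ vS) mul0r expr0n /= mulr0 mul0r lexx.
  apply: mulr_ge0; last by rewrite subr_ge0 wt.
  by apply: mulr_ge0 (sqr_ge0 _); apply: mulr_ge0 => //; apply: ltW.
have edge0 u v : 0 <= edge u v.
  apply: mulr_ge0; first exact: ler0n.
  by apply: mulr_ge0 (sqr_ge0 _); apply: mulr_ge0; apply: ltW.
have sedge0 : 0 <= \sum_u \sum_v edge u v.
  by apply: sumr_ge0 => u _; apply: sumr_ge0.
have sslack0 : 0 <= \sum_v slack v by apply: sumr_ge0.
rewrite id -addrA ltrDl lt_neqAle addr_ge0 // andbT eq_sym paddr_eq0 //.
apply/negP => /andP[/eqP s0 /eqP g0].
have {}s0 v : slack v = 0 by apply: (psumr_eq0P _ s0).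
have {}g0 u v : edge u v = 0.
  have h : \sum_v edge u v = 0 by apply: (psumr_eq0P _ g0) => // i _; apply: sumr_ge0.
  exact: (psumr_eq0P _ h).
have y_step u v : e u v -> y u ^+ 2 = y v ^+ 2.
  move=> euv; suff : y u + y v == 0 by rewrite addr_eq0 => /eqP ->; rewrite sqrrN.
  apply: contra_eqT (g0 u v) => yuv; rewrite /edge euv mul1r.
  by apply: mulf_neq0; rewrite ?sqrf_eq0 // mulf_neq0 // gt_eqF.
have y_conn u v : connect e u v -> y u ^+ 2 = y v ^+ 2.
  move=> /connectP[p]; elim: p u => [|a p IH] u /= => [_ ->//|/andP[eua pa] vE].
  by rewrite (y_step _ _ eua); apply: IH.
have [v xv] := x0; have [z vz zS] := strict v.
have yz : y z != 0.
  rewrite -sqrf_eq0 -(y_conn _ _ vz) sqrf_eq0.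
  by apply: contraNneq xv => yv; rewrite xE yv mulr0.
case/orP: zS => [/xS xz|lt]; first by rewrite /y xz mul0r eqxx in yz.
have : slack z != 0; last by rewrite s0 eqxx.
apply: mulf_neq0; last by rewrite subr_eq0 gt_eqF.
by apply: mulf_neq0; [rewrite mulf_neq0 ?pnatr_eq0 ?gt_eqF | rewrite sqrf_eq0].
Qed.

Definition degree e v := #|[set u | e v u]|.

Lemma degreeE e v : (degree e v)%:R = \sum_u (e v u)%:R :> R.
Proof.
rewrite -natr_sum /degree -sum1_card; congr (_%:R); rewrite big_mkcond /=.
by apply: eq_bigr => u _; rewrite inE; case: (e v u).
Qed.

(** With all weights 1 the disc bound is 2 deg, hence at most 4. The last hypothesis supplies the
    strictness in every component. *)
Lemma index_le_degree_two e (S : {set V}) :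
    symmetric e -> (forall v, v \notin S -> degree e v <= 2)%N ->
    (forall v, exists2 z, connect e v z & (z \in S) || (degree e z <= 1)%N) ->
  index_le e 4 #|S|.
Proof.
move=> e_sym deg2 conn.
have wE v : \sum_u (e v u)%:R * (1 + 1) = 2 * (degree e v)%:R :> R.
  by rewrite -mulr_suml degreeE mulrC.
apply: (@index_le_weights e S (fun=> 1)) => // [v /deg2 dv|v].
  rewrite wE mulr1; have : (degree e v)%:R <= 2%:R :> R by rewrite ler_nat.
  by lra.
have [z vz zS] := conn v; exists z => //; case/orP: zS => [-> //|dz].
apply/orP; right; rewrite wE mulr1.
have : (degree e z)%:R <= 1%:R :> R by rewrite ler_nat.
by lra.
Qed.

Lemma index_le_degree_three e (S : {set V}) z :
    symmetric e -> (forall v, v \notin S -> v != z -> degree e v <= 2)%N ->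
    (z \notin S -> degree e z <= 3)%N -> ~~ e z z ->
  index_le e 5 #|S|.
Proof.
move=> e_sym deg2 deg3 ezz.
(* With weight c at [z] and 2 elsewhere, degree three at [z] needs 3 (c + 2) < 5 c and a neighbour
   of [z] needs (2 + c) + 4 < 10, so 3 < c < 4. *)
pose w v : R := if v == z then 7 / 2 else 2.
have w0 v : 0 < w v by rewrite /w; case: ifP => _; lra.
have strict v : v \notin S -> \sum_u (e v u)%:R * (w v + w u) < 5 * w v.
  move=> vS.
  have -> : \sum_u (e v u)%:R * (w v + w u) =
      (w v + 2) * (degree e v)%:R + 3 / 2 * (e v z)%:R.
    rewrite degreeE mulr_sumr [in RHS](bigD1 z) //= (bigD1 z) //= {2}/w eqxx.
    rewrite [RHS]addrAC; congr (_ + _); last first.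
      by apply: eq_bigr => u /negPf uz; rewrite {2}/w uz mulrC.
    by field.
  have evz : (e v z)%:R <= 1 :> R by case: (e v z); rewrite ?ler01.
  rewrite /w; case: eqVneq => [vz|vz].
    subst v; rewrite (negPf ezz) mulr0 addr0.
    have : (degree e z)%:R <= 3%:R :> R by rewrite ler_nat deg3.
    lra.
  have : (degree e v)%:R <= 2%:R :> R by rewrite ler_nat deg2.
  lra.
apply: (index_le_weights e_sym w0) => [v /strict/ltW //|v].
by exists v => //; case: (boolP (v \in S)) => //= /strict.
Qed.

End Energy.

(** * From bounds on the energy to counts of Laplacian eigenvalues *)

Section LaplacianCount.
Variables (R : rcfType) (G : sgraph).
Local Notation N := #|G|.
Local Notation rowof x := (\row_(i < N) x (enum_val i)).

Lemma laplacian_sym : (laplacian R G)^T = laplacian R G.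
Proof.
rewrite /laplacian linearB /= tr_diag_mx; congr (_ - _).
by apply/matrixP=> i j; rewrite !mxE adj_sym.
Qed.

Lemma sum_rowof (x : G -> R) : mxform 1%:M (rowof x) = \sum_v x v ^+ 2.
Proof.
rewrite mxform1 [RHS]big_enum_val; apply: eq_bigr => i _; by rewrite mxE.
Qed.

Lemma energy_laplacian (x : G -> R) :
  energy (@adj G) x = 2 * mxform (laplacian R G) (rowof x).
Proof.
have degE (u : G) : (deg u)%:R = \sum_v (adj u v)%:R :> R by exact: degreeE.
have -> : mxform (laplacian R G) (rowof x) =
    \sum_u (deg u)%:R * x u ^+ 2 - \sum_u \sum_v (adj u v)%:R * (x u * x v).
  rewrite /mxform /laplacian mulmxBr mulmxBl [LHS]mxE; congr (_ + _).
    rewrite mxE [RHS]big_enum_val; apply: eq_bigr => i _.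
    by rewrite mul_mx_diag !mxE expr2; ring.
  rewrite [LHS]mxE; congr (- _); rewrite mxE exchange_big /= [RHS]big_enum_val.
  apply: eq_bigr => j _; rewrite mxE mulr_suml [RHS]big_enum_val.
  by apply: eq_bigr => i _; rewrite !mxE; ring.
have -> : energy (@adj G) x =
   \sum_u \sum_v (((adj u v)%:R * x u ^+ 2 + (adj u v)%:R * x v ^+ 2)
     - 2 * ((adj u v)%:R * (x u * x v))).
  by apply: eq_bigr => u _; apply: eq_bigr => v _; ring.
under eq_bigr do rewrite sumrB big_split /= -mulr_sumr.
rewrite sumrB big_split /= -mulr_sumr mulrBr; congr (_ - _).
rewrite [X in _ + X]exchange_big /=.
under [X in _ + X]eq_bigr do under eq_bigr do rewrite adj_sym.
rewrite -mulr2n mulr_natl; congr (_ *+ _).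
by apply: eq_bigr => u _; rewrite degE mulr_suml.
Qed.

Lemma rowof_unrow (x : 'rV[R]_N) : rowof (fun v => x 0 (enum_rank v)) = x.
Proof. by apply/rowP=> i; rewrite mxE enum_valK. Qed.

Lemma laplacian_count_le (t a b : R) s :
  index_le (@adj G) t s -> t <= a -> (laplacian_count G a b <= s)%N.
Proof.
move=> [fs sz neg] ta; apply: leq_trans sz.
pose F : 'M[R]_(N, size fs) := \matrix_(i, j) (nth 0 fs j) (enum_val i).
apply: (count_le_of_constraints laplacian_sym (t := t) (F := F)) => [x /andP[ax _]|x x0 xF].
  exact: le_trans ax.
pose y v := x 0 (enum_rank v).
have [i xi] : exists i, x 0 i != 0.
  by apply/existsP; apply: contraNT x0 => /existsPn h; apply/eqP/rowP=> i;
     rewrite mxE; apply/eqP; rewrite -[_ == _]negbK h.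
have := neg y; rewrite energy_laplacian -sum_rowof rowof_unrow -mulrA.
rewrite ltr_pM2l ?ltr0n //; apply.
  by exists (enum_val i); rewrite /y enum_valK.
move=> f /(nthP 0)[j js <-].
have /rowP/(_ (Ordinal js)) := xF; rewrite !mxE => h; apply: etrans h.
rewrite big_enum_val; apply: eq_bigr => k _.
by rewrite mxE /y enum_valK mulrC.
Qed.

(** The form is at most that of the complete graph, N |y|^2 - (sum of y)^2. This makes the upper end
    of the interval harmless in lower bounds for the count. *)
Lemma laplacian_root_le (x : R) :
  root (char_poly (laplacian R G)) x -> x <= N%:R.
Proof.
rewrite -eigenvalue_root_char => /eigenvalueP[v vL v0].
pose y u := v 0 (enum_rank u).
have vy : rowof y = v by rewrite rowof_unrow.
have E : energy (@adj G) y = 2 * (x * \sum_u y u ^+ 2).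
  rewrite energy_laplacian vy -sum_rowof vy /mxform vL mulmx1 -scalemxAl.
  by rewrite [in LHS]mxE.
have s0 : 0 < \sum_u y u ^+ 2.
  apply: sum_sqr_gt0; apply/existsP; apply: contraNT v0 => /existsPn h.
  apply/eqP/rowP=> i; rewrite mxE; apply/eqP; rewrite -[_ == _]negbK.
  by have := h (enum_val i); rewrite /y enum_valK.
have : energy (@adj G) y <= \sum_u \sum_w (y u - y w) ^+ 2.
  apply: ler_sum => u _; apply: ler_sum => w _.
  by case: (adj u w); rewrite ?mul1r ?mul0r ?sqr_ge0.
have -> : \sum_u \sum_w (y u - y w) ^+ 2 =
    2 * N%:R * (\sum_u y u ^+ 2) - 2 * (\sum_u y u) ^+ 2.
  have inner u : \sum_w (y u - y w) ^+ 2 =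
      N%:R * y u ^+ 2 + \sum_w y w ^+ 2 - 2 * (\sum_w y w) * y u.
    transitivity (\sum_w (y u ^+ 2 + y w ^+ 2 - 2 * y u * y w)).
      by apply: eq_bigr => w _; ring.
    by rewrite sumrB big_split /= sumr_const -mulr_sumr -[_ *+ #|_|]mulr_natl; ring.
  under eq_bigr do rewrite inner.
  rewrite sumrB big_split /= sumr_const -!mulr_sumr -[_ *+ #|_|]mulr_natl.
  by ring.
rewrite E => h; have := sqr_ge0 (\sum_u y u); move: h s0.
set a := \sum_u y u ^+ 2; set b := _ ^+ 2; set n := N%:R => h a0 b0.
rewrite -(ler_pM2r a0); lra.
Qed.

(** The points [p j], at which the test vectors take the values of an identity matrix, certify their
    independence. *)
Lemma laplacian_count_ge (t b : R) r (f : 'I_r -> G -> R) (p : 'I_r -> G) :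
    N%:R <= b -> (forall i j, f i (p j) = (i == j)%:R) ->
    (forall y : 'I_r -> R,
       let x v := \sum_i y i * f i v in
       2 * t * \sum_v x v ^+ 2 <= energy (@adj G) x) ->
  (r <= laplacian_count G t b)%N.
Proof.
move=> Nb fp pos.
pose B : 'M[R]_(r, N) := \matrix_(i, j) f i (enum_val j).
apply: (count_ge_of_subspace laplacian_sym (t := t) (B := B)).
- by move=> x /laplacian_root_le xN ->; rewrite (le_trans xN).
- apply/row_freeP; exists (\matrix_(i, j) (i == enum_rank (p j))%:R).
  apply/matrixP=> i j; rewrite !mxE (bigD1 (enum_rank (p j))) //= !mxE.
  rewrite enum_rankK fp eqxx mulr1 big1 ?addr0 // => k /negPf kp.
  by rewrite !mxE kp mulr0.
- move=> y; have := pos (y 0); set x := fun v => _ => /=.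
  have -> : y *m B = rowof x.
    by apply/rowP=> i; rewrite !mxE; apply: eq_bigr => j _; rewrite mxE.
  by rewrite energy_laplacian sum_rowof -mulrA ler_pM2l ?ltr0n.
Qed.

End LaplacianCount.

(* A triangular list of rows [a_ii, a_i(i+1), ...] encodes a symmetric matrix. *)
Definition row_comb (a : Z) (r : seq Z) (b : Z) (s : seq Z) : seq Z :=
  [seq Z.add (Z.mul a p.1) (Z.mul b p.2) | p <- zip r s].
Definition tri_comb a (A : seq (seq Z)) b (B : seq (seq Z)) :=
  [seq row_comb a p.1 b p.2 | p <- zip A B].
Fixpoint tri_square (m : seq Z) : seq (seq Z) :=
  if m is a :: m' then [seq Z.mul a b | b <- m] :: tri_square m' else [::].

(* Symmetric Gaussian elimination without divisions: up to a positive factor, the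
   Schur complement of a pivot p with row m is p M - m m^T; a zero pivot is removed
   with its row. *)
Fixpoint nonpos_pivots (k : nat) (M : seq (seq Z)) : nat :=
  if k is k'.+1 then
    if M is (p :: m) :: M' then
      if Z.ltb Z0 p then nonpos_pivots k' (tri_comb p M' (Zneg 1) (tri_square m))
      else if Z.ltb p Z0 then
        (nonpos_pivots k' (tri_comb (Z.opp p) M' (Zpos 1) (tri_square m))).+1
      else (nonpos_pivots k' M').+1
    else 0%N
  else 0%N.

Fixpoint triangular (M : seq (seq Z)) : bool :=
  if M is r :: M' then (size r == (size M').+1) && triangular M' else true.

Fixpoint sub_diag (d : seq Z) (M : seq (seq Z)) : seq (seq Z) :=
  match d, M with
  | a :: d', (p :: m) :: M' => (Z.sub p a :: m) :: sub_diag d' M'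
  | _, _ => M
  end.

Definition bz (d : positive) (b : bool) : Z := if b then Zpos d else Z0.

(* The matrix of (d t - 1) |x|^2 - d q(x), where q is the form of the Laplacian of
   the graph with adjacency table tb: the slack 1 / d keeps eigenvalues of q just
   below t from producing zero pivots. *)
Fixpoint tri_form (d : positive) (t : Z) (tb : seq bitseq) : seq (seq Z) :=
  if tb is r :: tb' then
    (Z.sub (Z.sub (Z.mul t (Zpos d)) (Zpos 1)) (foldr Z.add Z0 (map (bz d) r)) :: map (bz d) r)
      :: sub_diag (map (bz d) r) (tri_form d t tb')
  else [::].

Definition table_index (d : positive) (t : Z) (tb : seq bitseq) : nat :=
  nonpos_pivots (size tb) (tri_form d t tb).

(** * Soundness of the integer elimination *)

Section Elimination.
Variable R : rcfType.
Implicit Types (M : seq (seq Z)) (m r : seq Z) (x : seq R).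

Definition zr (z : Z) : R := (int_of_Z z)%:~R.

Lemma zrD a b : zr (Z.add a b) = zr a + zr b.
Proof. by rewrite /zr -[Z.add a b]/(a + b : Z) !rmorphD. Qed.

Lemma zrM a b : zr (Z.mul a b) = zr a * zr b.
Proof. by rewrite /zr -[Z.mul a b]/(a * b : Z) !rmorphM. Qed.

Lemma zrN a : zr (Z.opp a) = - zr a.
Proof. by rewrite /zr -[Z.opp a]/(- a : Z) !rmorphN. Qed.

Lemma zrB a b : zr (Z.sub a b) = zr a - zr b.
Proof. by rewrite -zrN -zrD. Qed.

Lemma zrN1 : zr (Zneg 1) = -1. Proof. by []. Qed.

Lemma zr0 : zr Z0 = 0. Proof. by []. Qed.
Lemma zr1 : zr (Zpos 1) = 1. Proof. by []. Qed.

Lemma zr_gt0 p : Z.ltb Z0 p -> 0 < zr p.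
Proof. by move=> /Z.ltb_lt h; rewrite /zr ltr0z; lia. Qed.

Fixpoint dotz r x : R :=
  match r, x with a :: r', b :: x' => zr a * b + dotz r' x' | _, _ => 0 end.

Fixpoint tri_eval M x : R :=
  match M, x with
  | (p :: m) :: M', a :: x' =>
      zr p * a ^+ 2 + 2 * a * dotz m x' + tri_eval M' x'
  | _, _ => 0
  end.

Definition dotr (f x : seq R) : R := \sum_(p <- zip f x) p.1 * p.2.

Lemma dotr_cons a f b x : dotr (a :: f) (b :: x) = a * b + dotr f x.
Proof. by rewrite /dotr /= big_cons. Qed.

Lemma dotz_dotr m x : dotr (map zr m) x = dotz m x.
Proof.
elim: m x => [|a m IH] [|b x] /=; rewrite ?dotr_cons ?IH //; by rewrite /dotr /= big_nil.
Qed.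

Lemma size_row_comb a r b s : size r = size s -> size (row_comb a r b s) = size r.
Proof. by move=> rs; rewrite size_map size_zip rs minnn. Qed.

Lemma dotz_row_comb a r b s x : size r = size s ->
  dotz (row_comb a r b s) x = zr a * dotz r x + zr b * dotz s x.
Proof.
elim: r s x => [|p r IH] [|q s] [|c x] //=; rewrite ?mulr0 ?addr0 // => -[rs].
by rewrite -/(row_comb a r b s) IH // zrD !zrM; ring.
Qed.

Lemma size_tri_square m : size (tri_square m) = size m.
Proof. by elim: m => //= a m ->. Qed.

Lemma triangular_square m : triangular (tri_square m).
Proof. by elim: m => //= a m ->; rewrite size_map size_tri_square eqxx. Qed.

Lemma dotz_scale a m x : dotz (map (Z.mul a) m) x = zr a * dotz m x.
Proof.
by elim: m x => [|b m IH] [|c x] /=; rewrite ?mulr0 // IH zrM mulrDr mulrA.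
Qed.

Lemma tri_eval_square m x : tri_eval (tri_square m) x = dotz m x ^+ 2.
Proof.
elim: m x => [|a m IH] [|c x] /=; rewrite ?expr0n //.
by rewrite IH dotz_scale zrM; ring.
Qed.

Lemma size_tri_comb a A b B : size A = size B -> size (tri_comb a A b B) = size A.
Proof. by move=> AB; rewrite size_map size_zip AB minnn. Qed.

Lemma triangular_comb a A b B : size A = size B -> triangular A ->
  triangular B -> triangular (tri_comb a A b B).
Proof.
elim: A B => [|r A IH] [|s B] //= [AB] /andP[/eqP rA tA] /andP[/eqP sB tB].
rewrite size_tri_comb // size_row_comb ?rA ?eqxx ?sB ?AB //=.
exact: IH.
Qed.

Lemma tri_eval_comb a A b B x : size A = size B -> triangular A -> triangular B ->
  tri_eval (tri_comb a A b B) x = zr a * tri_eval A x + zr b * tri_eval B x.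
Proof.
elim: A B x => [|r A IH] [|s B] x //=; first by rewrite !mulr0 addr0.
case: r => [|p r] //; case: s => [|q s] //.
move=> [AB] /andP[/eqP[rA] tA] /andP[/eqP[sB] tB].
case: x => [|c x] /=; first by rewrite !mulr0 addr0.
rewrite -/(tri_comb a A b B) IH // -/(row_comb a r b s) dotz_row_comb; last by rewrite rA sB AB.
by rewrite zrD !zrM; ring.
Qed.

Lemma dotz_zero m x : all (fun a => a == 0) x -> dotz m x = 0.
Proof.
elim: m x => [|a m IH] [|c x] //= /andP[/eqP -> /IH ->].
by rewrite mulr0 addr0.
Qed.

Lemma tri_eval_zero M x : all (fun a => a == 0) x -> tri_eval M x = 0.
Proof.
elim: M x => [|[|p m] M IH] [|c x] //= /andP[/eqP -> x0].
by rewrite (dotz_zero _ x0) IH // expr0n /= !mulr0 !addr0.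
Qed.

(** A positive pivot is absorbed by completing the square. Every other pivot costs one linear
    condition: the pivot row if p < 0, the vanishing of the leading variable if p = 0. The number
    [k] is fuel for the recursion. *)
Lemma nonpos_pivotsP k M : (size M <= k)%N -> triangular M ->
  exists2 fs : seq (seq R), (size fs <= nonpos_pivots k M)%N &
    forall x, size x = size M -> has (fun a => a != 0) x ->
      (forall f, f \in fs -> dotr f x = 0) -> 0 < tri_eval M x.
Proof.
elim: k M => [|k IH] [|[|p m] M] //=.
- by move=> _ _; exists [::] => // -[].
- by move=> _ _; exists [::] => // -[].
rewrite ltnS => Mk /andP[/eqP[mM] tM].
have dot0 (f : seq R) a x : dotr (0 :: f) (a :: x) = dotr f x.
  by rewrite dotr_cons mul0r add0r.
have sq_eval b : size (tri_comb b M (Zneg 1) (tri_square m)) = size M.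
  by rewrite size_tri_comb // size_tri_square.
have eqsz : size M = size (tri_square m) by rewrite size_tri_square.
have tsq := triangular_square m.
case: ifP => [p_gt0|/negbT p_le0].
  have [||fs sz pos] := IH (tri_comb p M (Zneg 1) (tri_square m)).
  - by rewrite size_tri_comb.
  - exact: triangular_comb.
  exists [seq 0 :: f | f <- fs]; first by rewrite size_map.
  case=> [|a x] //= [xM] nz ker.
  have {}p_gt0 := zr_gt0 p_gt0; rewrite -(pmulr_rgt0 _ p_gt0).
  have -> : zr p * (zr p * a ^+ 2 + 2 * a * dotz m x + tri_eval M x) =
     (zr p * a + dotz m x) ^+ 2 + tri_eval (tri_comb p M (Zneg 1) (tri_square m)) x.
    by rewrite tri_eval_comb // tri_eval_square ?zrN ?zrN1 ?zr1; ring.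
  case: (boolP (has (fun a => a != 0) x)) => [x0|].
    apply: ltr_wpDl; first exact: sqr_ge0.
    apply: pos => // [|f ff]; first by rewrite size_tri_comb.
    by rewrite -(dot0 f a) ker // map_f.
  rewrite has_predC negbK => x0; rewrite (tri_eval_zero _ x0) (dotz_zero _ x0).
  rewrite !addr0 exprn_even_gt0 //=; apply: mulf_neq0; first by rewrite gt_eqF.
  by move: nz; rewrite has_predC x0 /= orbF.
(* The added condition forces [a] to vanish together with the tail, so the tail of a nonzero
   solution is again nonzero and the induction applies to it. *)
have tail_nz (a : R) (x : seq R) : (a != 0) || has (fun a => a != 0) x ->
    (all (fun a => a == 0) x -> a = 0) -> has (fun a => a != 0) x.
  move=> /orP[a0 h|//]; rewrite has_predC; apply: contraNN a0 => /h ->.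
  by rewrite eqxx.
case: ifP => [p_lt0|/negbT p_ge0].
  have [||fs sz pos] := IH (tri_comb (Z.opp p) M (Zpos 1) (tri_square m)).
  - by rewrite size_tri_comb.
  - exact: triangular_comb.
  exists (map zr (p :: m) :: [seq 0 :: f | f <- fs]).
    by rewrite /= size_map.
  case=> [|a x] //= [xM] nz ker.
  have {}p_lt0 : 0 < zr (Z.opp p) by apply: zr_gt0; lia.
  rewrite -(pmulr_rgt0 _ p_lt0).
  have k0 : zr p * a + dotz m x = 0.
    by rewrite -dotz_dotr -dotr_cons; apply: ker; rewrite mem_head.
  have -> : zr (Z.opp p) * (zr p * a ^+ 2 + 2 * a * dotz m x + tri_eval M x) =
     tri_eval (tri_comb (Z.opp p) M (Zpos 1) (tri_square m)) x - (zr p * a + dotz m x) ^+ 2.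
    by rewrite tri_eval_comb // tri_eval_square ?zrN ?zrN1 ?zr1; ring.
  rewrite k0 expr0n subr0; apply: pos => [||f ff]; first by rewrite size_tri_comb.
    apply: (tail_nz a) => // x0; move: k0; rewrite (dotz_zero _ x0) addr0.
    move=> /eqP; rewrite mulf_eq0 => /orP[/eqP p0|/eqP //].
    by move: p_lt0; rewrite zrN p0 oppr0 ltxx.
  by rewrite -(dot0 f a) ker // inE map_f ?orbT.
have p0 : p = Z0 by lia.
have [//|//|fs sz pos] := IH M.
exists ((1 :: nseq (size M) 0) :: [seq 0 :: f | f <- fs]); first by rewrite /= size_map.
case=> [|a x] //= [xM] nz ker.
have a0 : a = 0.
  have := ker (1 :: nseq (size M) 0); rewrite mem_head dotr_cons mul1r => /(_ isT).
  suff -> : dotr (nseq (size M) 0) x = 0 by rewrite addr0.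
  by elim: x (size M) {nz ker xM} => [|b x IHx] [|k']; rewrite /dotr ?big_nil //=
    -/(nseq _ _) -[LHS]/(dotr (0 :: nseq k' 0) (b :: x)) dot0.
rewrite a0 p0 zr0 mul0r mulr0 mul0r !add0r; apply: pos => // [|f ff].
  by apply: (tail_nz a).
by rewrite -(dot0 f a) ker // inE map_f ?orbT.
Qed.

(** Each edge is counted once, from its earlier end, in step with the recursion of [tri_form]. *)
Fixpoint pair_energy (V : finType) (e : rel V) (x : V -> R) (vs : seq V) : R :=
  if vs is v :: vs' then
    \sum_(w <- vs') (e v w)%:R * (x v - x w) ^+ 2 + pair_energy e x vs'
  else 0.

Lemma triangular_sub_diag d M : triangular M -> triangular (sub_diag d M).
Proof.
elim: M d => [|[|p m] M IH] [|a d] //= /andP[mM tM].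
suff -> : size (sub_diag d M) = size M by rewrite mM IH.
by elim: M d {IH mM tM} => [|[|q n] M IHM] [|b d] //=; rewrite IHM.
Qed.

Lemma size_sub_diag d M : size (sub_diag d M) = size M.
Proof. by elim: M d => [|[|q n] M IHM] [|b d] //=; rewrite IHM. Qed.

Lemma tri_eval_sub_diag d M x : size d = size M -> triangular M ->
  tri_eval (sub_diag d M) x = tri_eval M x - dotz d [seq a ^+ 2 | a <- x].
Proof.
elim: M d x => [|[|p m] M IH] [|a d] [|c x] //=; rewrite ?subr0 // => -[dM] /andP[_ tM].
by rewrite IH // zrB; ring.
Qed.
End Elimination.

Fixpoint adj_table (V : Type) (e : rel V) (vs : seq V) : seq bitseq :=
  if vs is v :: vs' then map (e v) vs' :: adj_table e vs' else [::].

Section Table.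
Variables (R : rcfType) (V : finType).
Implicit Types (e : rel V) (vs : seq V) (d : positive).

Lemma size_adj_table e vs : size (adj_table e vs) = size vs.
Proof. by elim: vs => //= v vs ->. Qed.

Lemma size_tri_form d t tb : size (tri_form d t tb) = size tb.
Proof. by elim: tb => //= r tb IH; rewrite size_sub_diag IH. Qed.

Lemma triangular_tri_form d t e vs : triangular (tri_form d t (adj_table e vs)).
Proof.
elim: vs => //= v vs IH.
by rewrite size_sub_diag size_tri_form size_adj_table !size_map eqxx triangular_sub_diag.
Qed.

Lemma zr_bz d b : zr R (bz d b) = zr R (Zpos d) * b%:R.
Proof. by case: b; rewrite ?mulr0 ?mulr1. Qed.

Lemma tri_eval_table d t e vs (x : V -> R) :
  tri_eval (tri_form d t (adj_table e vs)) (map x vs) =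
  (zr R t * zr R (Zpos d) - 1) * (\sum_(v <- vs) x v ^+ 2)
    - zr R (Zpos d) * pair_energy e x vs.
Proof.
elim: vs => [|v vs IH] /=; first by rewrite big_nil !mulr0 subr0.
rewrite tri_eval_sub_diag ?triangular_tri_form ?size_tri_form ?size_adj_table ?size_map //.
rewrite IH big_cons !zrB zrM.
have -> : zr R (Zpos 1) = 1 by [].
set D := zr R (Zpos d); set a := zr R t * D - 1.
have E : forall ws,
   - zr R (foldr Z.add Z0 [seq bz d i | i <- [seq e v i | i <- ws]]) * x v ^+ 2
   + 2 * x v * dotz [seq bz d i | i <- [seq e v i | i <- ws]] [seq x i | i <- ws]
   - dotz [seq bz d i | i <- [seq e v i | i <- ws]] [seq a0 ^+ 2 | a0 <- [seq x i | i <- ws]]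
   = - D * \sum_(w <- ws) (e v w)%:R * (x v - x w) ^+ 2.
  elim=> [|w ws IHw] /=; first by rewrite big_nil zr0; ring.
  by rewrite big_cons [RHS]mulrDr -IHw zrD zr_bz -/D; case: (e v w) => /=; ring.
by have := E vs; rewrite /a; lra.
Qed.

Lemma energy_pair_energy e vs (x : V -> R) : symmetric e -> irreflexive e -> uniq vs ->
  (forall u v, e u v -> u \in vs) -> energy e x = 2 * pair_energy e x vs.
Proof.
move=> e_sym e_irr uvs sup.
pose f u v := (e u v)%:R * (x u - x v) ^+ 2.
have fsym u v : f u v = f v u by rewrite /f e_sym; ring.
have -> : energy e x = \sum_(u <- vs) \sum_(v <- vs) f u v.
  have out u v : u \notin vs -> f u v = 0.
    move=> uvs'; rewrite /f; case euv: (e u v); last by rewrite mul0r.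
    by rewrite (sup _ _ euv) in uvs'.
  rewrite big_uniq //= [LHS](bigID (mem vs)) /= [X in _ + X]big1 ?addr0; last first.
    by move=> u /out h; apply: big1 => v _; apply: h.
  apply: eq_bigr => u _; rewrite [RHS]big_uniq //= [LHS](bigID (mem vs)) /=.
  by rewrite [X in _ + X]big1 ?addr0 // => v /out h; rewrite -/(f u v) fsym.
elim: vs {uvs sup} => [|v vs IH] /=; first by rewrite big_nil mulr0.
under eq_bigr do rewrite big_cons.
rewrite big_split /= !big_cons IH /f e_irr mul0r add0r mulrDr.
have -> : \sum_(j <- vs) f j v = \sum_(j <- vs) f v j by apply: eq_bigr.
by rewrite /f; ring.
Qed.

(** The list [vs] only has to contain the vertices incident with an edge: the others add nothing to
    the energy but count in the norm, and t > 0. *)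
Lemma index_le_table d e vs (t s : nat) : symmetric e -> irreflexive e -> uniq vs ->
    (forall u v, e u v -> u \in vs) -> (0 < t)%N ->
    (table_index d (Z.of_nat t) (adj_table e vs) <= s)%N ->
  index_le e (t%:R : R) s.
Proof.
move=> e_sym e_irr uvs sup t0.
have [] := @nonpos_pivotsP R (size (adj_table e vs)) (tri_form d (Z.of_nat t) (adj_table e vs)).
- by rewrite size_tri_form.
- exact: triangular_tri_form.
move=> fs sz pos le_s.
(* The functionals of the elimination, extended by zero outside [vs]. *)
exists [seq [ffun v => if v \in vs then nth 0 f (index v vs) else 0] | f : seq R <- fs].
  by rewrite size_map (leq_trans sz).
move=> x x0 ker.
have tE : zr R (Z.of_nat t) = t%:R.
  by rewrite /zr; have -> : int_of_Z (Z.of_nat t) = t%:Z by lia.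
rewrite (energy_pair_energy x e_sym e_irr uvs sup) -mulrA ltr_pM2l ?ltr0n //.
have sV : 0 < \sum_v x v ^+ 2 by apply: sum_sqr_gt0.
have s_vs : \sum_(v <- vs) x v ^+ 2 <= \sum_v x v ^+ 2.
  rewrite big_uniq //= [leRHS](bigID (mem vs)) /= lerDl.
  by apply: sumr_ge0 => v _; apply: sqr_ge0.
have s_vs0 : 0 <= \sum_(v <- vs) x v ^+ 2 by apply: sumr_ge0 => v _; apply: sqr_ge0.
have t_ge1 : 1 <= t%:R :> R by rewrite ler1n.
case: (boolP (has (fun a => a != 0) (map x vs))) => [nz|].
  have : 0 < tri_eval (tri_form d (Z.of_nat t) (adj_table e vs)) (map x vs).
    apply: pos => //; first by rewrite size_map size_tri_form size_adj_table.
    move=> f ff; set F := [ffun v => if v \in vs then nth 0 f (index v vs) else 0].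
    have : \sum_v F v * x v = 0 by apply: ker; rewrite map_f.
    rewrite (bigID (mem vs)) /= [X in _ + X]big1 ?addr0; last first.
      by move=> v /negPf vvs; rewrite ffunE vvs mul0r.
    rewrite -big_uniq //= => h; apply: etrans h.
    rewrite (eq_big_seq (fun v => nth 0 f (index v vs) * x v)); last first.
      by move=> v vvs; rewrite ffunE vvs.
    rewrite /dotr; elim: vs f uvs {F ff ker sup sz le_s s_vs s_vs0 nz} => [|v vs IH] f.
      by rewrite /= big_nil; case: f => *; rewrite big_nil.
    case: f => [|a f] /= /andP[vvs uvs].
      rewrite big_nil big_cons nth_nil mul0r add0r big1_seq // => w _.
      by rewrite nth_nil mul0r.
    rewrite !big_cons /= eqxx IH //; congr (_ + _); apply: eq_big_seq => w wvs.
    by rewrite eq_sym (negPf (memPn vvs w wvs)).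
  rewrite tri_eval_table tE; set a := \sum_(v <- vs) _ in s_vs s_vs0 *.
  set b := \sum_v _ in sV s_vs *; set q := pair_energy _ _ _; set D := zr R _ => h.
  have D0 : 0 < D by apply: zr_gt0.
  have ab : t%:R * a <= t%:R * b by rewrite ler_wpM2l.
  (* The elimination gives (t D - 1) a - D q > 0; the slack is dropped here because a >= 0. *)
  have : D * (t%:R * a - q) > 0 by lra.
  by rewrite pmulr_rgt0 // subr_gt0 => /lt_le_trans; apply.
rewrite has_predC negbK => /allP z0.
have -> : pair_energy e x vs = 0.
  have {}z0 v : v \in vs -> x v = 0 by move=> vvs; apply/eqP/z0/map_f.
  elim: vs z0 {uvs sup sz pos le_s s_vs s_vs0 ker} => //= v vs IH z0.
  rewrite IH ?addr0; last by move=> w wvs; rewrite z0 // inE wvs orbT.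
  rewrite big1_seq // => w /andP[_ wvs].
  by rewrite !z0 ?mem_head ?inE ?wvs ?orbT // subrr expr0n mulr0.
by rewrite mulr_gt0 // ltr0n.
Qed.

End Table.

(* A graph e living on the vertices of a shortest cycle cs and on a set K of
   further vertices. *)
Record cycle_config (V : finType) (e : rel V) (cs : seq V) (K : {set V}) : Prop :=
  CycleConfig {
    cfg_sym : symmetric e;
    cfg_irr : irreflexive e;
    cfg_cycle : ucycle e cs;
    cfg_size : (3 < size cs)%N;
    cfg_girth : forall c, ucycle e c -> (2 < size c)%N -> (size cs <= size c)%N;
    cfg_out : forall v, v \in K -> v \notin cs;
    cfg_supp : forall u v, e u v -> (u \in cs) || (u \in K) }.

(** The hypotheses say that both arcs between two of the points on a [g]-cycle have length at least
    g - p - 1 (and similarly with q and r). The three arcs between the points add up to [g]. *)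
Lemma three_points_far (g x y z p q r : nat) :
  (g <= p + 1 + ((x - y) + (y - x)) -> (x - y) + (y - x) <= p + 1 ->
   g <= q + 1 + ((y - z) + (z - y)) -> (y - z) + (z - y) <= q + 1 ->
   g <= r + 1 + ((z - x) + (x - z)) -> (z - x) + (x - z) <= r + 1 ->
   2 * g <= p + q + r + 3)%N.
Proof.
have [xy|/ltnW xy] := leqP x y; have [yz|/ltnW yz] := leqP y z;
have [zx|/ltnW zx] := leqP z x; lia.
Qed.

(** Here [i0] is the position of the foot of a vertex u, and [i1], [i2], [i3] are those of three
    branches leaving u with n1 + 1, n2 + 1 and n3 + 1 vertices. Together with u these are n1 + n2 +
    n3 + 4 vertices, too many to fit among [k]. *)
Lemma four_points_far (g i0 i1 i2 i3 n1 n2 n3 k : nat) :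
  let gap (x y : nat) := ((x - y) + (y - x))%N in
  let far p (x y : nat) := (g <= p + 1 + gap x y /\ gap x y <= p + 1)%N in
  (i0 < g -> i1 < g -> i2 < g -> i3 < g -> k < g -> 4 < g ->
   far (n1 + 2) i0 i1 -> far (n2 + 2) i0 i2 -> far (n3 + 2) i0 i3 ->
   far (n1 + n2 + 3) i1 i2 -> far (n2 + n3 + 3) i2 i3 -> far (n3 + n1 + 3) i3 i1 ->
   k < n1 + n2 + n3 + 4)%N.
Proof.
move=> gap far l0 l1 l2 l3 kg g4 [a1 b1] [a2 b2] [a3 b3] [a12 b12] [a23 b23] [a31 b31].
rewrite ltnNge; apply/negP => small.
have gapC x y : gap x y = gap y x by rewrite /gap addnC.
have t12 : (2 * g <= (n1 + 2) + (n1 + n2 + 3) + (n2 + 2) + 3)%N.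
  by apply: (@three_points_far g i0 i1 i2) => //; rewrite -/(gap _ _) gapC.
have t23 : (2 * g <= (n2 + 2) + (n2 + n3 + 3) + (n3 + 2) + 3)%N.
  by apply: (@three_points_far g i0 i2 i3) => //; rewrite -/(gap _ _) gapC.
have t31 : (2 * g <= (n3 + 2) + (n3 + n1 + 3) + (n1 + 2) + 3)%N.
  by apply: (@three_points_far g i0 i3 i1) => //; rewrite -/(gap _ _) gapC.
(* A triangle through [i0] gives g <= ni + nj + 5 for its two branches, while [small] gives g >= n1
   + n2 + n3 + 5. *)
have [gE n1E n2E n3E] : [/\ g = 5, n1 = 0, n2 = 0 & n3 = 0]%N.
  by clear -t12 t23 t31 small kg g4; split; lia.
(* A pentagon has only two points at distance two from [i0], yet [i1], [i2], [i3] are distinct. *)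
move: l0 l1 l2 l3 a1 b1 a2 b2 a3 b3 a12 a23 a31; rewrite /gap gE n1E n2E n3E.
clear; case: i0 => [|[|[|[|[|i0]]]]] // _;
case: i1 => [|[|[|[|[|i1]]]]] // _; case: i2 => [|[|[|[|[|i2]]]]] // _;
by case: i3 => [|[|[|[|[|i3]]]]].
Qed.

(** * Chords, ears and the forest around a shortest cycle *)

Section Structure.
Local Open Scope nat_scope.
Variables (V : finType) (e : rel V) (cs : seq V) (K : {set V}).
Hypothesis cfg : cycle_config e cs K.
Let e_sym := cfg_sym cfg.
Let e_irr := cfg_irr cfg.
Local Notation g := (size cs).
Implicit Types (a b u v w x y z : V) (P Q p q : seq V).

Let cs_uniq : uniq cs := ucycle_uniq (cfg_cycle cfg).
Let cs_cycle : cycle e cs := ucycle_cycle (cfg_cycle cfg).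
(** [P] lists the interior vertices only, so the ear has [size P + 1] edges. The ends may coincide,
    and [P] may be empty (a chord). *)
Definition ear P a b := [&& uniq P, all (fun v => v \notin cs) P & path e a (rcons P b)].

Lemma ear_rev P a b : ear P a b -> ear (rev P) b a.
Proof.
case/and3P => uP oP pP; apply/and3P; split; rewrite ?rev_uniq ?all_rev //.
have := rev_path e a (rcons P b); rewrite last_rcons belast_rcons rev_cons => ->.
by rewrite (eq_path (e' := e)) // => x y; rewrite e_sym.
Qed.

Lemma ear_cycle C P a A b B : cycle e C -> uniq C -> C =i cs -> C = a :: A ++ b :: B ->
  ear P b a -> 0 < size A + size P -> g <= size A + size P + 2.
Proof.
move=> cC uC Ccs CE /and3P[uP oP pP] AP.
have uc : ucycle e ((a :: A) ++ b :: P).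
  apply/andP; split.
    move: cC; rewrite CE /= !rcons_cat /= !cat_path /= => /and3P[-> ->] _ /=.
    by move: pP; rewrite rcons_path.
  rewrite -cat_rcons cat_uniq uP andbT.
  move: uC; rewrite CE -cat_cons -cat_rcons cat_uniq => /and3P[-> _ _] /=.
  apply/hasPn => v vP; move/allP: oP => /(_ v vP); apply: contra => vA.
  by rewrite -Ccs CE -cat_cons -cat_rcons mem_cat vA.
have := cfg_girth cfg uc; rewrite size_cat /=; lia.
Qed.

(** An absolute difference in truncated subtraction: the length of one of the arcs between [a] and
    [b], the other being [g] minus it. *)
Definition gap a b := (index a cs - index b cs) + (index b cs - index a cs).

Lemma ear_gap_lt P a b : a \in cs -> b \in cs -> index a cs < index b cs ->
    ear P a b -> 0 < size P ->
  g <= size P + 1 + gap a b /\ gap a b <= size P + 1.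
Proof.
move=> acs bcs ab ePab P0.
pose i := index a cs; pose j := index b cs.
have jg : j < g by rewrite index_mem.
pose A := take (j - i).-1 (drop i.+1 cs).
have E : cs = take i cs ++ a :: A ++ b :: drop j.+1 cs.
  rewrite -{1}(cat_take_drop i cs) (drop_nth a) ?index_mem // nth_index //.
  congr (_ ++ _ :: _); rewrite -{1}(cat_take_drop (j - i).-1 (drop _ _)) drop_drop.
  have -> : (j - i).-1 + i.+1 = j by rewrite -/i -/j in ab *; lia.
  by rewrite (drop_nth b jg) [nth b cs j]nth_index.
have sA : size A = (j - i).-1.
  by rewrite size_takel // size_drop; rewrite -/i -/j in ab *; lia.
set C := a :: A ++ b :: drop j.+1 cs ++ take i cs.
have CE : C = rot i cs.
  rewrite /rot; have -> : drop i cs = a :: A ++ b :: drop j.+1 cs.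
    by rewrite {1}E drop_size_cat // size_takel // ltnW // index_mem.
  by rewrite /C /= -catA.
have cC : cycle e C by rewrite CE rot_cycle.
have uC : uniq C by rewrite CE rot_uniq.
have Ccs : C =i cs by move=> v; rewrite CE mem_rot.
have ePba := ear_rev ePab.
have := ear_cycle cC uC Ccs (erefl _) ePba; rewrite size_rev sA => h1.
pose C' := b :: (drop j.+1 cs ++ take i cs) ++ a :: A.
have C'E : C' = rot (size (a :: A)) C by rewrite /C -cat_cons rot_size_cat.
have cC' : cycle e C' by rewrite C'E rot_cycle.
have uC' : uniq C' by rewrite C'E rot_uniq.
have C'cs : C' =i cs by move=> v; rewrite C'E mem_rot Ccs.
have := ear_cycle cC' uC' C'cs (erefl _) ePab; rewrite size_cat size_drop size_takel => [h2|]; last by rewrite ltnW // index_mem.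
rewrite /gap -/i -/j in ab *.
have arith (i' j' m g' : nat) : i' < j' -> j' < g' -> 0 < m ->
    (0 < (j' - i').-1 + m -> g' <= (j' - i').-1 + m + 2) ->
    (0 < g' - j'.+1 + i' + m -> g' <= g' - j'.+1 + i' + m + 2) ->
    g' <= m + 1 + (i' - j' + (j' - i')) /\ i' - j' + (j' - i') <= m + 1.
  by clear; lia.
exact: arith ab jg P0 h1 h2.
Qed.

Lemma ear_loop P a : a \in cs -> ear P a a -> 1 < size P -> g <= size P + 1.
Proof.
move=> acs /and3P[uP oP pP] P1.
have uc : ucycle e (a :: P).
  apply/andP; split => //=; rewrite uP andbT.
  by apply/negP => aP; move/allP: oP => /(_ a aP); rewrite acs.
by have := cfg_girth cfg uc; rewrite /=; lia.
Qed.

(** Closing the ear with either arc gives a cycle of length at least [g]; one inequality per arc. If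
    a = b the ear is itself a cycle, which is why two interior vertices are then required. *)
Lemma ear_gap P a b : a \in cs -> b \in cs -> ear P a b ->
    (1 < size P) || ((a != b) && (0 < size P)) ->
  g <= size P + 1 + gap a b /\ gap a b <= size P + 1.
Proof.
move=> acs bcs ePab P1.
have gapC : gap a b = gap b a by rewrite /gap addnC.
case: (ltngtP (index a cs) (index b cs)) => [lt|gt|eq].
- by apply: ear_gap_lt => //; lia.
- rewrite gapC -(size_rev P); apply: ear_gap_lt => //; first exact: ear_rev.
  by rewrite size_rev; lia.
have ab : a = b by rewrite -(nth_index a acs) eq nth_index.
subst b; rewrite /gap subnn; have := ear_loop acs ePab.
by rewrite eqxx orbF /= in P1 *; move=> /(_ P1); lia.
Qed.

(* A chord of a shortest cycle would create a shorter one. *)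
Lemma cycle_chord a b : a \in cs -> b \in cs -> e a b -> b = next cs a \/ b = prev cs a.
Proof.
move=> acs bcs eab.
have ab : a != b by apply: contraTneq eab => ->; rewrite e_irr.
have [i A B _ _ CE] := rot_to_arc cs_uniq acs bcs ab.
have cC : cycle e (rot i cs) by rewrite rot_cycle.
have uC : uniq (rot i cs) by rewrite rot_uniq.
have Ccs : rot i cs =i cs by move=> v; rewrite mem_rot.
have eba : ear [::] b a by rewrite /ear /= e_sym eab.
have := ear_cycle cC uC Ccs CE eba.
have sg : size A + size B + 2 = g by rewrite -(size_rot i cs) CE /= size_cat /=; lia.
case: A CE sg => [|x A] CE sg h.
  left; have -> : next cs a = next (rot i cs) a by rewrite next_rot.
  by rewrite CE /= eqxx.
case: B CE sg => [|y B] CE sg; last first.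
  by move: (h isT) sg; rewrite /= addn0; clear; lia.
right; rewrite -[LHS](prev_next cs_uniq); congr (prev cs _).
have -> : next cs b = next (rot (size (a :: x :: A)) (rot i cs)) b.
  by rewrite !next_rot ?rot_uniq.
by rewrite CE -cat_cons rot_size_cat /= eqxx.
Qed.

Definition degree_in (A : {set V}) v := #|[set u in A | e v u]|.

Lemma degree_cycle a : a \in cs -> degree_in [set x in cs] a <= 2.
Proof.
move=> acs; apply: (@leq_trans #|[set next cs a; prev cs a]|); last first.
  by rewrite cards2; case: (_ == _).
apply: subset_leq_card; apply/subsetP => b; rewrite !inE => /andP[bcs eab].
by case: (cycle_chord acs bcs eab) => ->; rewrite eqxx ?orbT.
Qed.

Lemma supp_sym u v : e u v -> (v \in cs) || (v \in K).
Proof. by rewrite e_sym; apply: (cfg_supp cfg). Qed.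

Lemma degree_out v : v \notin cs -> v \notin K -> degree e v = 0.
Proof.
move=> vcs vK; apply/eqP; rewrite cards_eq0; apply/eqP/setP => u; rewrite !inE.
by apply/negP => /(cfg_supp cfg); rewrite (negPf vcs) (negPf vK).
Qed.

Lemma degree_split v : degree e v = degree_in [set x in cs] v + degree_in K v.
Proof.
rewrite /degree /degree_in -(cardsID [set x in cs] [set u | e v u]).
congr (_ + _); first by apply: eq_card => u; rewrite !inE andbC.
apply: eq_card => u; rewrite !inE; apply/andP/andP => -[h1 h2]; split => //.
  by move: (supp_sym h2); rewrite (negPf h1).
exact: (cfg_out cfg).
Qed.

Section LargeGirth.
Hypothesis g5 : 4 < g.

(** Two feet of [u] would bound an ear with one interior vertex, so gap <= 2 and g <= 2 + gap <=
    4. *)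
Lemma attach_uniq u a b : u \in K -> a \in cs -> b \in cs -> e u a -> e u b -> a = b.
Proof.
move=> uK acs bcs ua ub; apply: contraTeq g5 => ab.
have ePab : ear [:: u] a b.
  by rewrite /ear /= (cfg_out cfg uK) ub e_sym ua.
by have := ear_gap acs bcs ePab; rewrite ab /= => /(_ isT); lia.
Qed.

Lemma degree_attach u : u \in K -> degree_in [set x in cs] u <= 1.
Proof.
move=> uK; rewrite leqNgt; apply/negP => /card_gt1P[a [b [ha hb /eqP ab]]].
move: ha hb; rewrite !inE => /andP[acs ea] /andP[bcs eb].
exact: ab (attach_uniq uK acs bcs ea eb).
Qed.

End LargeGirth.

Section SmallComplement.
Hypothesis K_small : #|K| < g.

Lemma size_in (c : seq V) : uniq c -> all (mem K) c -> size c <= #|K|.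
Proof.
move=> uc cK; rewrite -(card_uniqP uc); apply: subset_leq_card.
by apply/subsetP => v /(allP cK).
Qed.

Lemma acyclic_in (c : seq V) : ucycle e c -> all (mem K) c -> size c <= 2.
Proof.
move=> uc cK; rewrite leqNgt; apply/negP => /(cfg_girth cfg uc).
by move=> h; have := leq_ltn_trans (leq_trans h (size_in (ucycle_uniq uc) cK)) K_small; rewrite ltnn.
Qed.

(** The path grows at its head until it reaches a leaf of the forest induced on [K]. A new neighbour
    of the head cannot lie on the path, and repetition-free paths in [K] have bounded length. *)
Lemma extend_path q z : uniq (z :: q) -> path e z q -> all (mem K) (z :: q) ->
    0 < size q ->
  exists z' q', [/\ suffix (z :: q) (z' :: q'), uniq (z' :: q'), path e z' q',
     all (mem K) (z' :: q') & degree_in K z' <= 1].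
Proof.
have [m] := ubnP (#|K| - size q); elim: m q z => // m IH q z mK uq pq qK q0.
have [dz|] := leqP (degree_in K z) 1; first by exists z, q; rewrite suffix_refl.
case: q mK uq pq qK q0 => // h q mK uq pq qK _.
move=> /card_gt1P[w1 [w2 [hw1 hw2 w12]]].
have [w [wK ezw wh]] : exists w, [/\ w \in K, e z w & w != h].
  move: hw1 hw2; rewrite !inE => /andP[w1K zw1] /andP[w2K zw2].
  have [w1h|] := eqVneq w1 h; last by exists w1.
  by exists w2; split=> //; rewrite -w1h eq_sym.
have wz : w != z by apply: contraTneq ezw => ->; rewrite e_irr.
(* A neighbour already on the path would close a cycle inside [K]. *)
case: (boolP (w \in q)) => [wq|wq].
  case/splitPr: wq uq pq qK mK => A B uq pq qK _.
  have uc : ucycle e (z :: h :: rcons A w).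
    apply/andP; split.
      move: pq; rewrite /= -cat_rcons cat_path => /and3P[-> pA _].
      by rewrite /= rcons_path pA last_rcons e_sym ezw.
    by move: uq; rewrite -cat_rcons -!cat_cons cat_uniq => /andP[].
  have := acyclic_in uc; move: qK; rewrite -cat_rcons -!cat_cons all_cat => /andP[-> _].
  by move/(_ isT); rewrite /= size_rcons.
have [|||||z' [q' [sq ? ? ? ?]]] := IH (z :: h :: q) w.
- have := size_in uq qK; rewrite /=; move: mK; rewrite /=.
  by move: (size q) #|K| => k1 k2; clear; lia.
- by rewrite cons_uniq uq andbT !inE (negPf wz) (negPf wh).
- by rewrite /= e_sym ezw.
- by move: qK => /= ->; rewrite wK.
- by [].
exists z', q'; split => //; apply: suffix_trans sq.
by rewrite -[w :: _]cat1s suffix_suffix.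
Qed.

Lemma connect_forest_leaf x : x \in K ->
  exists2 z, z \in K & degree_in K z <= 1 /\
    exists p, [/\ path e x p, last x p = z & all (mem K) (x :: p)].
Proof.
move=> xK; have [dx|] := leqP (degree_in K x) 1.
  by exists x => //; split => //; exists [::]; rewrite /= xK.
move=> /ltnW; rewrite card_gt0 => /set0Pn[y]; rewrite inE => /andP[yK exy].
have yx : y != x by apply: contraTneq exy => ->; rewrite e_irr.
have [|||//|z [q [/suffixP[r rE] uq pq qK dz]]] := @extend_path [:: x] y.
- by rewrite /= inE yx.
- by rewrite /= e_sym exy.
- by rewrite /= xK yK.
have lastq : last z q = x by rewrite -[LHS]/(last z (z :: q)) rE last_cat.
exists z; first by move: qK => /andP[].
split=> //; exists (rev (belast z q)); split.
- by rewrite -lastq rev_path (eq_path (e' := e)) // => ? ?; rewrite e_sym.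
- by case: (q) lastq => [/= ->|a q' _] //=; rewrite rev_cons last_rcons.
- have -> : x :: rev (belast z q) = rev (z :: q) by rewrite [z :: q]lastI rev_rcons lastq.
  by rewrite all_rev.
Qed.

(** Two branches that met again would close a cycle through [u] inside [K]. *)
Lemma disjoint_branches u v1 v2 p1 p2 :
    path e u (v1 :: p1) -> path e u (v2 :: p2) ->
    uniq (u :: v1 :: p1) -> uniq (u :: v2 :: p2) ->
    all (mem K) (u :: v1 :: p1) -> all (mem K) (u :: v2 :: p2) -> v1 != v2 ->
  ~~ has (mem (v1 :: p1)) (v2 :: p2).
Proof.
move=> path1 path2 uniq1 uniq2 K1 K2 v12; apply/negP => meet.
(* [w] is the first vertex of the second branch that lies on the first; stopping there keeps the
   closed walk free of repetitions. *)
have [w [A [B [L2E wL1 AL1]]]] : exists w A B,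
    [/\ v2 :: p2 = rcons A w ++ B, w \in v1 :: p1 & ~~ has (mem (v1 :: p1)) A].
  by case: (split_find meet) => w A B ? ?; exists w, A, B.
have [A' [B' L1E]] : exists A' B', v1 :: p1 = A' ++ w :: B'.
  by case/splitPr: wL1 => A' B'; exists A', B'.
rewrite L2E in path2 uniq2 K2; rewrite L1E in path1 uniq1 K1 AL1.
have uc : ucycle e (u :: rcons A w ++ rev A').
  apply/andP; split.
    move: path2; rewrite /= rcons_cat !cat_path => /andP[-> _] /=; rewrite last_rcons.
    move: path1; rewrite -cat_rcons cat_path => /andP[pA' _].
    have := rev_path e u (rcons A' w).
    rewrite last_rcons belast_rcons rev_cons => ->.
    by rewrite (eq_path (e' := e)) // => ? ?; rewrite e_sym.
  move: uniq1 uniq2; rewrite !cons_uniq !mem_cat !negb_or !cat_uniq rev_uniq /=.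
  rewrite mem_rev => /and4P[/andP[uA' _] uqA' hA' _] /and4P[/andP[uA _] uqA _ _].
  rewrite uA uA' uqA uqA' !andbT /=; apply/hasPn => x; rewrite mem_rev => xA'.
  rewrite mem_rcons inE negb_or; apply/andP; split.
    by move: hA' => /norP[wA' _]; apply: contraNneq wA' => <-.
  apply/negP => xA; move/hasPn: AL1 => /(_ x xA); rewrite inE /= mem_cat.
  by rewrite xA'.
have cK : all (mem K) (u :: rcons A w ++ rev A').
  move: K1 K2; rewrite /= !all_cat all_rev => /and3P[-> -> _] /and3P[_ -> _].
  by [].
have := acyclic_in uc cK; rewrite /= size_cat size_rcons size_rev.
case: A A' {uc cK path1 path2 uniq1 uniq2 K1 K2 AL1} L2E L1E => [|x A] [|x' A'] //=.
  by move=> [v2w _] [v1w _]; rewrite v1w v2w eqxx in v12.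
all: by rewrite ?addnS ?addSn.
Qed.

Hypothesis g5 : 4 < g.
Hypothesis no_leaf : forall v, v \in K -> 1 < degree e v.

Lemma forest_leaf_attached z : z \in K -> degree_in K z <= 1 ->
  exists2 a, a \in cs & e z a.
Proof.
move=> zK dz; have := no_leaf zK; rewrite degree_split.
have [|d0] := posnP (degree_in [set x in cs] z); first by move: dz; lia.
move=> _; move: d0; rewrite card_gt0 => /set0Pn[a]; rewrite !inE => /andP[acs eza].
by exists a.
Qed.

(** The walk that leaves [u] through [v] is continued to a leaf of the forest; as that leaf has
    degree at least two in the graph, it has a foot on the cycle. *)
Lemma route u v : u \in K -> v \in K -> e u v ->
  exists a p, [/\ a \in cs, uniq (u :: v :: p), all (mem K) (u :: v :: p) &
                 path e u (rcons (v :: p) a)].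
Proof.
move=> uK vK euv; have vu : v != u by apply: contraTneq euv => ->; rewrite e_irr.
have [|||//|z [q [/suffixP[r rE] uq pq qK dz]]] := @extend_path [:: u] v.
- by rewrite /= inE vu.
- by rewrite /= e_sym euv.
- by rewrite /= uK vK.
have zK : z \in K by move: qK => /andP[].
have [a acs eza] := forest_leaf_attached zK dz.
have E : u :: v :: rev r = rev (z :: q) by rewrite rE rev_cat.
exists a, (rev r); split => //.
- by rewrite E rev_uniq.
- by rewrite E all_rev.
have paq : path e a (z :: q) by rewrite /= e_sym eza.
have zqE : z :: q = rcons (rcons r v) u by rewrite rE -!cats1 -catA.
move: paq; rewrite zqE.
move=> pq'; have := rev_path e a (rcons (rcons r v) u).
rewrite last_rcons belast_rcons rev_cons rev_rcons => ->.
by rewrite (eq_path (e' := e)) // => ? ?; rewrite e_sym.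
Qed.

Lemma ear_of_routes u p1 p2 a1 a2 :
    path e u (rcons p1 a1) -> path e u (rcons p2 a2) ->
    uniq (u :: p1) -> uniq (u :: p2) -> ~~ has (mem p1) p2 ->
    all (mem K) (u :: p1) -> all (mem K) (u :: p2) ->
  ear (rev p1 ++ u :: p2) a1 a2.
Proof.
rewrite !cons_uniq => path1 path2 /andP[u1 uq1] /andP[u2 uq2] disj /andP[uK K1] /andP[_ K2].
apply/and3P; split.
- rewrite cat_uniq rev_uniq uq1 /= uq2 u2 mem_rev negb_or u1 !andbT /=.
  by apply: contraNN disj => /hasP[x x2]; rewrite /= mem_rev => x1; apply/hasP; exists x.
- rewrite all_cat all_rev /= (cfg_out cfg uK) /=; apply/andP; split; apply/allP => x.
    by move=> /(allP K1) /(cfg_out cfg).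
  by move=> /(allP K2) /(cfg_out cfg).
rewrite rcons_cat -cat_rcons cat_path last_rcons path2 andbT.
have := rev_path e u (rcons p1 a1); rewrite last_rcons belast_rcons rev_cons => ->.
by rewrite (eq_path (e' := e)) // => ? ?; rewrite e_sym.
Qed.

Lemma uniq_branches u p1 p2 p3 :
    uniq (u :: p1) -> uniq (u :: p2) -> uniq (u :: p3) ->
    ~~ has (mem p1) p2 -> ~~ has (mem p2) p3 -> ~~ has (mem p3) p1 ->
  uniq (u :: p1 ++ p2 ++ p3).
Proof.
rewrite !cons_uniq !mem_cat !negb_or => /andP[-> u1] /andP[-> u2] /andP[-> u3] d12 d23 d31.
rewrite !cat_uniq u1 u2 u3 d23 /= has_cat negb_or d12 /= andbT.
apply: contraNN d31 => /hasP[x x3 x1]; by apply/hasP; exists x.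
Qed.

(* Three branches of the forest leaving an attached vertex u all reach the
   cycle; the four points where u and these branches meet it are too far apart. *)
Lemma attached_degree_in u a : u \in K -> a \in cs -> e u a -> degree_in K u <= 2.
Proof.
move=> uK acs eua; rewrite leqNgt; apply/negP.
move=> /card_gt2P[v1 [v2 [v3 [[h1 h2 h3] [v12 v23 v31]]]]].
move: h1 h2 h3; rewrite !inE => /andP[v1K uv1] /andP[v2K uv2] /andP[v3K uv3].
have [a1 [p1 [a1cs uq1 K1 path1]]] := route uK v1K uv1.
have [a2 [p2 [a2cs uq2 K2 path2]]] := route uK v2K uv2.
have [a3 [p3 [a3cs uq3 K3 path3]]] := route uK v3K uv3.
have sub v p b : path e u (rcons (v :: p) b) -> path e u (v :: p).
  by rewrite rcons_path => /andP[].
have d12 := disjoint_branches (sub _ _ _ path1) (sub _ _ _ path2) uq1 uq2 K1 K2 v12.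
have d23 := disjoint_branches (sub _ _ _ path2) (sub _ _ _ path3) uq2 uq3 K2 K3 v23.
have d31 := disjoint_branches (sub _ _ _ path3) (sub _ _ _ path1) uq3 uq1 K3 K1 v31.
have e12 := ear_of_routes path1 path2 uq1 uq2 d12 K1 K2.
have e23 := ear_of_routes path2 path3 uq2 uq3 d23 K2 K3.
have e31 := ear_of_routes path3 path1 uq3 uq1 d31 K3 K1.
have path0 : path e u (rcons [::] a) by rewrite /= eua.
have uq0 : uniq [:: u] by [].
have K0 : all (mem K) [:: u] by rewrite /= uK.
have disj0 p : ~~ has (mem [::]) p by rewrite (eq_has (a2 := pred0)) ?has_pred0.
have e01 := ear_of_routes path0 path1 uq0 uq1 (disj0 _) K0 K1.
have e02 := ear_of_routes path0 path2 uq0 uq2 (disj0 _) K0 K2.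
have e03 := ear_of_routes path0 path3 uq0 uq3 (disj0 _) K0 K3.
have total : size (u :: (v1 :: p1) ++ (v2 :: p2) ++ v3 :: p3) <= #|K|.
  apply: size_in; last first.
    apply/allP => x; rewrite inE !mem_cat => /or4P[/eqP->//|xp|xp|xp].
    - by apply: (allP K1); rewrite inE xp orbT.
    - by apply: (allP K2); rewrite inE xp orbT.
    - by apply: (allP K3); rewrite inE xp orbT.
  exact: uniq_branches.
have sz0 v p : size (rev [::] ++ u :: v :: p) = size p + 2 by rewrite /= addn2.
have szd v w p q : size (rev (v :: p) ++ u :: w :: q) = size p + size q + 3.
  by rewrite size_cat size_rev /= addSn !addnS addn0.
have far0 b v p : b \in cs -> ear (rev [::] ++ u :: v :: p) a b ->
    g <= size p + 2 + 1 + gap a b /\ gap a b <= size p + 2 + 1.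
  by move=> bcs eab; rewrite -(sz0 v); apply: ear_gap => //; rewrite sz0 addn2.
have fard b c v w p q : b \in cs -> c \in cs ->
    ear (rev (v :: p) ++ u :: w :: q) b c ->
    g <= size p + size q + 3 + 1 + gap b c /\ gap b c <= size p + size q + 3 + 1.
  by move=> bcs ccs ebc; rewrite -(szd v w); apply: ear_gap => //; rewrite szd addn3.
have idx b : b \in cs -> index b cs < g by rewrite index_mem.
have := four_points_far (idx _ acs) (idx _ a1cs) (idx _ a2cs) (idx _ a3cs) K_small g5
  (far0 _ _ _ a1cs e01) (far0 _ _ _ a2cs e02) (far0 _ _ _ a3cs e03)
  (fard _ _ _ _ _ _ a1cs a2cs e12) (fard _ _ _ _ _ _ a2cs a3cs e23)
  (fard _ _ _ _ _ _ a3cs a1cs e31).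
rewrite ltnNge => /negP; apply; apply: leq_trans total.
by rewrite /= size_cat /= size_cat /= !addnS addn0 !addnA.
Qed.

End SmallComplement.

End Structure.

Lemma config_delete (V : finType) (e : rel V) cs (K D : {set V}) :
    cycle_config e cs K -> (forall v, v \in D -> v \notin cs) ->
  cycle_config (delete_vertices e D) cs (K :\: D).
Proof.
move=> cfg Dcs; split.
- by move=> u v; rewrite /delete_vertices (cfg_sym cfg) [(u \notin D) && _]andbC.
- by move=> u; rewrite /delete_vertices (cfg_irr cfg).
- have /andP[cc uc] := cfg_cycle cfg; apply/andP; split=> //.
  have csD : all [pred v | v \notin D] cs.
    by apply/allP => v vcs; apply: contraL vcs; apply: Dcs.
  rewrite (eq_in_cycle (e' := e) _ csD) // => u v; rewrite !inE => uD vD.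
  by rewrite /delete_vertices uD vD !andbT.
- exact: cfg_size cfg.
- move=> c /andP[cc uc]; apply: (cfg_girth cfg); apply/andP; split=> //.
  by apply: sub_cycle cc => u v /and3P[].
- by move=> v; rewrite inE => /andP[_]; apply: (cfg_out cfg).
- move=> u v /and3P[euv uD vD]; rewrite inE uD /=; exact: (cfg_supp cfg) euv.
Qed.

(** * Upper bounds for girth at least five *)

Section LargeGirth.
Variables (R : rcfType) (V : finType).
Local Open Scope nat_scope.
Implicit Types (e : rel V) (cs : seq V) (K : {set V}).

Lemma degree_delete_edges e (E : seq (V * V)) v : degree (delete_edges e E) v <= degree e v.
Proof.
by apply: subset_leq_card; apply/subsetP => u; rewrite !inE => /and3P[].
Qed.

Lemma degree_sub e e' (A : {set V}) v : (forall u, e' v u -> e v u && (u \in A)) ->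
  degree e' v <= degree_in e A v.
Proof.
by move=> h; apply: subset_leq_card; apply/subsetP => u; rewrite !inE => /h /andP[-> ->].
Qed.

Lemma delete_edges_sym e E : symmetric e -> symmetric (delete_edges e E).
Proof. by move=> e_sym u v; rewrite /delete_edges e_sym; congr (_ && _); rewrite andbC. Qed.

Lemma connect_delete_edges e E (A : pred V) u v p :
    (forall x y, e x y -> A x -> A y -> delete_edges e E x y) ->
    path e u p -> all A (u :: p) -> last u p = v -> connect (delete_edges e E) u v.
Proof.
move=> sub; elim: p u => [|w p IH] u /= => [_ _ ->|/andP[euw pw] /and3P[Au Aw Ap] lv].
  exact: connect0.
apply: connect_trans (IH w pw _ lv); first by apply/connect1/sub.
by rewrite /= Aw Ap.
Qed.

Lemma connect_cycle_delete_edges e E cs a b : cycle e cs ->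
    (forall x y, e x y -> x \in cs -> y \in cs -> delete_edges e E x y) ->
    a \in cs -> b \in cs -> connect (delete_edges e E) a b.
Proof.
move=> cc sub; apply: connect_cycle.
have ccs : all (mem cs) cs by apply/allP.
by rewrite (eq_in_cycle (e' := e) _ ccs) // => x y /= xcs ycs; apply/idP/idP => [/and3P[]//|/sub]; apply.
Qed.

(* Deleting the foot of v opens the cycle. *)
Lemma index_le_lonely_leaf e cs K v a :
    cycle_config e cs K -> v \in K -> degree e v <= 1 -> a \in cs -> e v a ->
    (forall u b, u \in K -> b \in cs -> e u b -> u = v) ->
  index_le e (4 : R)%R #|K|.
Proof.
move=> cfg vK dv acs eva only.
have e_sym := cfg_sym cfg.
have only_a b : b \in cs -> e v b -> b = a.
  move=> bcs evb; apply: contraTeq dv => ba; rewrite -ltnNge.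
  by apply/card_gt1P; exists b, a; rewrite !inE.
(* The condition at [v] is traded for one at its foot, so their number is unchanged. *)
have -> : #|K| = #|a |: (K :\ v)|.
  have aK : a \notin K by apply: contraL acs => /(cfg_out cfg).
  by rewrite cardsU1 !inE (negPf aK) andbF (cardsD1 v K) vK.
apply: (index_le_degree_two _ e_sym) => [x|x].
  rewrite !inE negb_or negb_and negbK => /andP[xa /orP[/eqP->|xK]]; first exact: leq_trans dv _.
  case: (boolP (x \in cs)) => [xcs|xcs]; last by rewrite (degree_out cfg).
  apply: leq_trans (degree_cycle cfg xcs); apply: degree_sub => y exy.
  rewrite exy inE; have /orP[//|yK] := supp_sym cfg exy.
  have yv : y = v by apply: only yK xcs _; rewrite e_sym.
  have := only_a x xcs; rewrite -yv e_sym exy => /(_ isT) xaE.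
  by rewrite xaE eqxx in xa.
case: (boolP (x \in cs)) => [xcs|xcs].
  by exists a; [apply: (connect_cycle (ucycle_cycle (cfg_cycle cfg))) | rewrite !inE eqxx].
exists x => //; rewrite !inE.
have [->|xv] := eqVneq x v; first by rewrite dv orbT.
case: (boolP (x \in K)) => [_|xK]; first by rewrite orbT.
by rewrite (degree_out cfg) // orbT.
Qed.

(** The [#|K|] conditions are spent as follows: x vanishes at the foot [a] of one forest leaf [u]; x
    is equal at the ends of the attaching edge of every other attached vertex; x vanishes at the
    vertices of forest degree above two, none of which is attached by [attached_degree_in]. The
    remaining degrees are at most two. The cycle contains [a], and each tree contains either a leaf
    that has lost its foot or [u], which is still joined to [a]. *)
Lemma index_le_no_leaf e cs K :
    cycle_config e cs K -> 4 < size cs -> #|K| < size cs -> 0 < #|K| ->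
    (forall v, v \in K -> 1 < degree e v) ->
  index_le e (4 : R)%R #|K|.
Proof.
move=> cfg g5 Kg K0 no_leaf.
have e_sym := cfg_sym cfg; have e_irr := cfg_irr cfg.
have [u uK du] : exists2 u, u \in K & degree_in e K u <= 1.
  move: K0; rewrite card_gt0 => /set0Pn[x xK].
  by have [z zK [dz _]] := connect_forest_leaf cfg Kg xK; exists z.
have [a acs eua] := forest_leaf_attached cfg Kg g5 no_leaf uK du.
pose attached := [set w in K | [exists c, (c \in cs) && e w c]].
have uatt : u \in attached.
  by rewrite inE uK; apply/existsP; exists a; rewrite acs.
pose foot w := odflt a [pick c in cs | e w c].
have footP w c : w \in K -> c \in cs -> e w c -> foot w = c.
  move=> wK ccs ewc; rewrite /foot; case: pickP => [c' /andP[c'cs ewc']|/(_ c)] /=.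
    exact: (attach_uniq cfg g5 wK c'cs ccs ewc' ewc).
  by rewrite ccs ewc.
pose E := [seq (w, foot w) | w <- enum (attached :\ u)].
pose S := a |: [set w in K | 2 < degree_in e K w].
have cutE w c : w \in K -> c \in cs -> e w c -> w != u -> (w, c) \in E.
  move=> wK ccs ewc wu; apply/mapP; exists w; last by rewrite (footP w c).
  by rewrite mem_enum !inE wu wK; apply/existsP; exists c; rewrite ccs.
have inE_att x y : (x, y) \in E -> [/\ x \in K, x != u & y = foot x].
  by move=> /mapP[w]; rewrite mem_enum !inE => /and3P[wu wK _] [-> ->].
have foot_cs x y : (x, y) \in E -> y \in cs.
  move=> /mapP[w _ [_ ->]]; rewrite /foot; by case: pickP => [c /andP[]|].
have keepK x y : e x y -> x \in K -> y \in K -> delete_edges e E x y.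
  move=> exy xK yK; rewrite /delete_edges exy /=; apply/andP; split; apply/negP => h; have := foot_cs _ _ h.
    by rewrite (negPf (cfg_out cfg yK)).
  by rewrite (negPf (cfg_out cfg xK)).
have keepC x y : e x y -> x \in cs -> y \in cs -> delete_edges e E x y.
  move=> exy xcs ycs; rewrite /delete_edges exy /=; apply/andP; split; apply/negP.
    by move=> /inE_att[/(cfg_out cfg)]; rewrite xcs.
  by move=> /inE_att[/(cfg_out cfg)]; rewrite ycs.
have keepu : delete_edges e E u a.
  rewrite /delete_edges eua /=; apply/andP; split; apply/negP => /inE_att[].
    by rewrite eqxx.
  by move=> /(cfg_out cfg); rewrite acs.
(* One for [a], one for each attached vertex except [u], at most one for each other vertex of [K]:
   the saving at [u] pays for [a]. *)
have big : #|S| + size E <= #|K|.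
  rewrite size_map -cardE.
  have cS : #|S| <= 1 + #|K :\: attached|.
    apply: leq_trans (leq_card_setU _ _) _; rewrite cards1 leq_add2l.
    apply: subset_leq_card; apply/subsetP => w; rewrite !inE => /andP[wK dw].
    rewrite wK andbT /=; apply/negP => /existsP[c /andP[ccs ewc]].
    by move: dw; rewrite ltnNge (attached_degree_in cfg Kg g5 no_leaf wK ccs ewc).
  rewrite -(cardsID attached K) (setIidPr _); last by apply/subsetP => w; rewrite inE => /andP[].
  by rewrite (cardsD1 u attached) uatt; move: cS; clear; lia.
have e'_sym := delete_edges_sym E e_sym.
apply: (@index_le_mono R V e e 4%R 4%R _ _ _ _ big) => //.
apply: index_le_delete_edges; apply: (index_le_degree_two _ e'_sym) => [x|x].
  rewrite !inE negb_or negb_and => /andP[xa xK].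
  case: (boolP (x \in K)) => [xinK|xnK].
    have [->|xu] := eqVneq x u.
      apply: leq_trans (degree_delete_edges _ _ _) _; rewrite (degree_split cfg).
      by have := degree_attach cfg g5 uK; move: du; clear; lia.
    move: xK; rewrite xinK /= -leqNgt; apply: leq_trans.
    apply: degree_sub => y /and3P[exy xyE _]; rewrite exy /=.
    have /orP[ycs|//] := supp_sym cfg exy.
    by rewrite (cutE x y) in xyE.
  case: (boolP (x \in cs)) => [xcs|xcs].
    apply: leq_trans (degree_cycle cfg xcs).
    apply: degree_sub => y /and3P[exy _ yxE]; rewrite exy inE /=.
    have /orP[//|yK] := supp_sym cfg exy.
    have eyx : e y x by rewrite e_sym.
    have [yu|yu] := eqVneq y u; last by rewrite (cutE y x) in yxE.
    by rewrite yu in eyx; rewrite -(footP u x) // (footP u a) ?eqxx // in xa.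
  by apply: leq_trans (degree_delete_edges _ _ _) _; rewrite (degree_out cfg).
have deg1 z : z \in K -> degree_in e K z <= 1 -> z != u -> degree (delete_edges e E) z <= 1.
  move=> zK dz zu; apply: leq_trans dz; apply: degree_sub => y /and3P[ezy zyE _].
  rewrite ezy /=; have /orP[ycs|//] := supp_sym cfg ezy.
  by rewrite (cutE z y) in zyE.
case: (boolP (x \in K)) => [xK|xK]; last first.
  case: (boolP (x \in cs)) => [xcs|xcs].
    exists a; last by rewrite !inE eqxx.
    exact: connect_cycle_delete_edges (ucycle_cycle (cfg_cycle cfg)) keepC xcs acs.
  exists x => //; apply/orP; right.
  by apply: leq_trans (degree_delete_edges _ _ _) _; rewrite (degree_out cfg).
have [z zK [dz [p [xp lp pK]]]] := connect_forest_leaf cfg Kg xK.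
have xz := connect_delete_edges keepK xp pK lp.
have [zu|zu] := eqVneq z u.
  exists a; last by rewrite !inE eqxx.
  by apply: connect_trans xz _; rewrite zu; apply: connect1.
by exists z => //; rewrite deg1 ?orbT.
Qed.

(** Induction on [#|K|]: a vertex [v] of degree at most one is split off by equalizing x along its
    edge, provided another vertex of [K] stays attached. If [v] is the only attached one, its foot
    is used instead. *)
Lemma index_le_core e cs K :
    cycle_config e cs K -> 4 < size cs -> #|K| < size cs ->
    (exists u a, [/\ u \in K, a \in cs & e u a]) ->
  index_le e (4 : R)%R #|K|.
Proof.
have [m] := ubnP #|K|; elim: m K e => // m IH K e Km cfg g5 Kg cross.
have K0 : 0 < #|K| by rewrite card_gt0; apply/set0Pn; have [u [a [uK _ _]]] := cross; exists u.
case: (boolP [exists v in K, degree e v <= 1]) => [/exists_inP[v vK dv]|]; last first.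
  rewrite negb_exists_in => /forall_inP no_leaf.
  by apply: (index_le_no_leaf cfg) => // v /no_leaf; rewrite -ltnNge.
case: (boolP [exists u in K :\ v, [exists a in cs, e u a]]).
  move=> /exists_inP[u uKv /exists_inP[a acs eua]].
  have cfg' : cycle_config (delete_vertices e [set v]) cs (K :\ v).
    by apply: config_delete => // w; rewrite inE => /eqP->; apply: (cfg_out cfg).
  have cK : #|K| = #|K :\ v|.+1 by rewrite (cardsD1 v K) vK.
  have : index_le (delete_vertices e [set v]) (4 : R)%R #|K :\ v|.
    apply: (IH (K :\ v)) => //; try by move: Km Kg; rewrite cK; clear; lia.
    exists u, a; split => //.
    rewrite /delete_vertices eua !inE; move: uKv; rewrite !inE => /andP[-> _] /=.
    by apply: contraTneq acs => ->; apply: (cfg_out cfg).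
  move=> H; apply: (@index_le_mono R V e e 4%R 4%R (#|K :\ v| + size [seq (v, u) | u <- enum [set u | e v u]])) => //.
    by rewrite size_map -cardE cK -addn1 leq_add2l.
  apply: index_le_delete_edges; apply: index_le_mono H => // x y /and3P[exy xE yE].
  rewrite /delete_vertices exy !inE /=; apply/andP; split.
    apply: contraNneq xE => xv; apply/mapP; exists y; last by rewrite xv.
    by rewrite mem_enum inE -xv.
  apply: contraNneq yE => yv; apply/mapP; exists x; last by rewrite yv.
  by rewrite mem_enum inE -yv (cfg_sym cfg).
rewrite negb_exists_in => /forall_inP only.
have {}only u b : u \in K -> b \in cs -> e u b -> u = v.
  move=> uK bcs eub; apply/eqP; apply: contraT => uv.
  have := only u; rewrite !inE uv uK => /(_ isT)/exists_inP[]; by exists b.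
have [u [a [uK acs eua]]] := cross.
have uv := only _ _ uK acs eua; rewrite uv in eua.
exact: index_le_lonely_leaf cfg vK dv acs eua only.
Qed.

Lemma config_sub e e' cs K : cycle_config e cs K -> symmetric e' -> subrel e' e ->
    (forall x y, e x y -> x \in cs -> y \in cs -> e' x y) -> cycle_config e' cs K.
Proof.
move=> cfg e'_sym sub keep; split => //.
- by move=> x; apply/negP => /sub; rewrite (cfg_irr cfg).
- have /andP[cc uc] := cfg_cycle cfg; apply/andP; split=> //.
  have ccs : all (mem cs) cs by apply/allP.
  by apply: sub_in_cycle ccs cc => x y xcs ycs exy; apply: keep.
- exact: cfg_size cfg.
- by move=> c /andP[cc uc]; apply: (cfg_girth cfg); apply/andP; split=> //; apply: sub_cycle cc.
- exact: cfg_out cfg.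
- by move=> x y /sub; apply: (cfg_supp cfg).
Qed.

(** [S] takes all feet but [z], which carries a single vertex of [K]; so [z] is the one vertex of
    degree three that level 5 allows. *)
Lemma index_le_five e cs K (S : {set V}) z :
    cycle_config e cs K -> z \in cs ->
    (forall u c, u \in K -> c \in cs -> e u c -> (c \in S) || (c == z)) ->
    (forall u w, u \in K -> w \in K -> e u z -> e w z -> z \notin S -> u = w) ->
    (forall u, u \in K -> degree e u <= 2) ->
  index_le e (5 : R)%R #|S|.
Proof.
move=> cfg zcs feet single deg2.
apply: (@index_le_degree_three R V e S z) => [|x xS xz|zS|].
- exact: cfg_sym cfg.
- case: (boolP (x \in K)) => [|xK]; first exact: deg2.
  case: (boolP (x \in cs)) => [xcs|xcs]; last by rewrite (degree_out cfg).
  apply: leq_trans (degree_cycle cfg xcs); apply: degree_sub => y exy.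
  rewrite exy inE; have /orP[//|yK] := supp_sym cfg exy.
  by have := feet y x yK xcs; rewrite (negPf xS) (negPf xz) (cfg_sym cfg) exy => /(_ isT).
- rewrite (degree_split cfg); apply: (@leq_add _ _ 2 1); first exact: (degree_cycle cfg zcs).
  rewrite leqNgt; apply/negP => /card_gt1P[u [w [hu hw /eqP uw]]]; apply: uw.
  move: hu hw; rewrite !inE => /andP[uK ezu] /andP[wK ezw].
  by apply: single => //; rewrite (cfg_sym cfg).
- by rewrite (cfg_irr cfg).
Qed.

(** The foot is made total: a vertex without a neighbour on the cycle gets an arbitrary cycle
    vertex. *)
Lemma exists_foot e cs K : cycle_config e cs K -> 4 < size cs ->
  exists foot : V -> V, (forall u, foot u \in cs) /\
    (forall u c, u \in K -> c \in cs -> e u c -> c = foot u).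
Proof.
move=> cfg g5; have [a acs] : exists a, a \in cs.
  by case: cs cfg g5 => // a cs' _ _; exists a; rewrite mem_head.
exists (fun u => odflt a [pick c in cs | e u c]); split => [u|u c uK ccs euc].
  by case: pickP => //= c /andP[].
case: pickP => [c' /andP[c'cs ewc']|/(_ c)] /=; last by rewrite ccs euc.
exact: (attach_uniq cfg g5 uK ccs c'cs euc ewc').
Qed.

Lemma index_le_core2 e cs K : cycle_config e cs K -> 4 < size cs -> #|K| = 2 ->
  index_le e (5 : R)%R 1.
Proof.
move=> cfg g5 /eqP/cards2P[u1 [u2 [u12 KE]]].
have [foot [foot_cs footP]] := exists_foot cfg g5.
apply: (@index_le_mono R V e e 5%R 5%R _ _ _ _ (eq_leq (cards1 (foot u1)))) => //.
apply: (index_le_five cfg (z := foot u2)) => // [u c uK ccs euc|u w uK wK eu ew|u uK].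
- rewrite inE (footP u c) //; move: uK; rewrite KE !inE => /orP[]/eqP->; by rewrite eqxx ?orbT.
- rewrite inE => z12; have only x : x \in K -> e x (foot u2) -> x = u2.
    move=> xK ex; move: (xK); rewrite KE !inE => /orP[]/eqP // xE.
    by rewrite (footP x _ xK _ ex) // xE eqxx in z12.
  by rewrite (only u) // (only w).
- rewrite (degree_split cfg); apply: (@leq_add _ _ 1 1); first exact: (degree_attach cfg g5).
  rewrite leqNgt; apply/negP => /card_gt1P[x [y [hx hy xy]]].
  have : 2 < #|K|; last by rewrite KE cards2 u12.
  apply/card_gt2P; exists x, y, u; move: hx hy; rewrite !inE => /andP[xK ux] /andP[yK uy].
  split=> //; split=> //; first by apply: contraTneq uy => ->; rewrite (cfg_irr cfg).
  by apply: contraTneq ux => ->; rewrite (cfg_irr cfg).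
Qed.

Lemma no_triangle e cs K x y z : cycle_config e cs K -> e x y -> e y z -> e z x -> False.
Proof.
move=> cfg xy yz zx.
have ne a b : e a b -> a != b by move=> eab; apply: contraTneq eab => ->; rewrite (cfg_irr cfg).
have uc : ucycle e [:: x; y; z].
  apply/andP; split; rewrite /= ?xy ?yz ?zx // !inE negb_or.
  by rewrite (ne x y) // (ne y z) // eq_sym (ne z x).
by have := cfg_girth cfg uc isT; have := cfg_size cfg; rewrite /=; case: (size cs) => [|[|[|[|n]]]].
Qed.

(** If no vertex of [K] has degree three, x vanishes at two feet and the third is the exceptional
    vertex. Otherwise some [u] is joined to both others and to its foot; one condition removes the
    edge to the foot, the other is spent at the foot of [u1]. The vertices [u1], [u3] are not
    adjacent, as there is no triangle. *)
Lemma index_le_core3 e cs K : cycle_config e cs K -> 4 < size cs -> #|K| = 3 ->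
  index_le e (5 : R)%R 2.
Proof.
move=> cfg g5 K3.
have [foot [foot_cs footP]] := exists_foot cfg g5.
have degK u : u \in K -> degree_in e K u <= 2.
  move=> uK; rewrite -ltnS -K3 [in X in _ < X](cardsD1 u K) uK ltnS.
  apply: subset_leq_card; apply/subsetP => x; rewrite !inE => /andP[-> eux].
  by rewrite andbT; apply: contraTneq eux => ->; rewrite (cfg_irr cfg).
case: (boolP [exists u in K, 2 < degree e u]) => [/exists_inP[u uK du]|]; last first.
  rewrite negb_exists_in => /forall_inP deg2.
  have [u1 [u2 [u3 [[h1 h2 h3] [u12 u23 u31]]]]] := card_gt2P (eq_leq (esym K3)).
  have KE : K = [set u1; u2; u3].
    apply/esym/eqP; rewrite eqEcard K3 -setUA; apply/andP; split.
      by apply/subsetP => x; rewrite !inE => /or3P[]/eqP->.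
    by rewrite cardsU1 cards2 !inE negb_or u12 u23 [u1 == u3]eq_sym u31.
  have S2 : #|[set foot u1; foot u2]| <= 2 by rewrite cards2; case: (_ != _).
  apply: (@index_le_mono R V e e 5%R 5%R _ _ _ _ S2) => //.
  apply: (index_le_five cfg (z := foot u3)) => // [u c uK ccs euc|u w uK wK eu ew|u /deg2].
  + rewrite !inE (footP u c) //; move: uK; rewrite KE !inE -orbA => /or3P[]/eqP->; by rewrite eqxx ?orbT.
  + rewrite !inE negb_or => /andP[z31 z32].
    have only x : x \in K -> e x (foot u3) -> x = u3.
      move=> xK ex; move: (xK); rewrite KE !inE -orbA => /or3P[]/eqP // xE.
        by rewrite (footP x _ xK _ ex) // xE eqxx in z31.
      by rewrite (footP x _ xK _ ex) // xE eqxx in z32.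
    by rewrite (only u) // (only w).
  + by rewrite -leqNgt.
have [dK2 dC] : degree_in e K u = 2 /\ degree_in e [set x in cs] u = 1.
  have := degree_attach cfg g5 uK; have := degK u uK; move: du; rewrite (degree_split cfg).
  by clear; lia.
have /eqP/cards2P[u1 [u3 [u13 NE]]] := dK2.
have /andP[u1K uu1] : (u1 \in K) && e u u1 by have := set21 u1 u3; rewrite -NE inE.
have /andP[u3K uu3] : (u3 \in K) && e u u3 by have := set22 u1 u3; rewrite -NE inE.
have uN1 : u != u1 by apply: contraTneq uu1 => <-; rewrite (cfg_irr cfg).
have uN3 : u != u3 by apply: contraTneq uu3 => <-; rewrite (cfg_irr cfg).
have KE : K = [set u; u1; u3].
  apply/esym/eqP; rewrite eqEcard K3 -setUA; apply/andP; split.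
    by apply/subsetP => x; rewrite !inE => /or3P[]/eqP->.
  by rewrite cardsU1 cards2 !inE negb_or uN1 uN3 u13.
pose E := [:: (u, foot u)].
have e'_sym := delete_edges_sym E (cfg_sym cfg).
have keep x y : e x y -> x \in cs -> y \in cs -> delete_edges e E x y.
  move=> exy xcs ycs; rewrite /delete_edges exy !inE /= !xpair_eqE.
  by apply/andP; split; apply/negP => /andP[/eqP xu _]; move: (cfg_out cfg uK); rewrite -xu ?xcs ?ycs.
have sub : subrel (delete_edges e E) e by move=> x y /and3P[].
have cfg' := config_sub cfg e'_sym sub keep.
have foot' x c : x \in K -> c \in cs -> delete_edges e E x c -> (x == u1) || (x == u3).
  move=> xK ccs /and3P[exc xcE _]; move: (xK); rewrite KE !inE -orbA => /or3P[/eqP xu| -> | ->]; rewrite ?orbT //.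
  by move: xcE; rewrite (footP x c) // xu !inE eqxx.
apply: (@index_le_delete_edges R V e E 5%R 1).
apply: (@index_le_mono R V (delete_edges e E) (delete_edges e E) 5%R 5%R _ _ _ _ (eq_leq (cards1 (foot u1)))) => //.
apply: (index_le_five cfg' (z := foot u3)) => // [x c xK ccs exc|x w xK wK ex ew|x xK].
- rewrite !inE (footP x c) // ?sub //; case/orP: (foot' _ _ xK ccs exc) => /eqP->; by rewrite eqxx ?orbT.
- rewrite inE => z31; have only y : y \in K -> delete_edges e E y (foot u3) -> y = u3.
    move=> yK ey; case/orP: (foot' _ _ yK (foot_cs _) ey) => /eqP // yE.
    by rewrite (footP y _ yK _ (sub _ _ ey)) // yE eqxx in z31.
  by rewrite (only x) // (only w).
have [xu|xu] := eqVneq x u.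
  rewrite xu; apply: leq_trans (degK u uK); apply: degree_sub => y euy.
  rewrite sub //=; have /orP[ycs|//] := supp_sym cfg' euy.
  by have := foot' _ _ uK ycs euy; rewrite (negPf uN1) (negPf uN3).
apply: leq_trans (degree_delete_edges _ _ _) _; rewrite (degree_split cfg).
apply: (@leq_add _ _ 1 1); first exact: (degree_attach cfg g5).
have exu : e u x by move: xK; rewrite KE !inE (negPf xu) => /orP[]/eqP->.
rewrite -(cards1 u); apply: subset_leq_card; apply/subsetP => y; rewrite !inE => /andP[yK exy].
apply: contraT => yu; have euy : e u y by move: yK; rewrite KE !inE (negPf yu) => /orP[]/eqP->.
by case: (no_triangle cfg exu exy); rewrite (cfg_sym cfg).
Qed.

End LargeGirth.

(** * Girth four: enumeration of the adjacency tables that contain a square *)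

Section Tables.
Local Open Scope nat_scope.

Fixpoint bitseqs n : seq bitseq :=
  if n is n'.+1 then [seq b :: s | b <- [:: true; false], s <- bitseqs n'] else [:: [::]].

Lemma mem_bitseqs s : s \in bitseqs (size s).
Proof.
elim: s => // b s IH; apply: (@allpairs_f _ _ _ (fun b s => b :: s)) => //.
by case: b; rewrite !inE.
Qed.

Fixpoint all_tables n : seq (seq bitseq) :=
  if n is n'.+1 then [seq r :: tb | r <- bitseqs n', tb <- all_tables n'] else [:: [::]].

Lemma mem_all_tables (V : Type) (e : rel V) (vs : seq V) :
  adj_table e vs \in all_tables (size vs).
Proof.
elim: vs => //= v vs IH; apply: (@allpairs_f _ _ _ (fun r tb => r :: tb)) => //.
by rewrite -(size_map (e v)) mem_bitseqs.
Qed.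

(** Row [i] of a triangular table starts at column i + 1; meaningful for i < j only. *)
Definition table_adj (tb : seq bitseq) i j := nth false (nth [::] tb i) (j - i.+1).

(** For a graph containing a square, being free of triangles says exactly that the girth is four. *)
Definition triangle_free (tb : seq bitseq) :=
  let n := size tb in
  all (fun i => all (fun j => all (fun k =>
     ~~ [&& table_adj tb i j, table_adj tb j k & table_adj tb i k])
     (iota j.+1 (n - j.+1))) (iota i.+1 (n - i.+1))) (iota 0 n).

Lemma table_adjE (V : Type) (e : rel V) (vs : seq V) v0 i j : i < j -> j < size vs ->
  table_adj (adj_table e vs) i j = e (nth v0 vs i) (nth v0 vs j).
Proof.
elim: vs i j => // v vs IH [|i] [|j] //= ij jn.
  by rewrite /table_adj /= subn1 /= (nth_map v0).
by rewrite -IH // /table_adj /= subSS.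
Qed.

Lemma adj_table_triangle_free (V : Type) (e : rel V) (vs : seq V) :
    symmetric e -> (forall x y z, e x y -> e y z -> e z x -> False) ->
  triangle_free (adj_table e vs).
Proof.
move=> e_sym no_tri; case: vs => // v0 vs'; set vs := v0 :: vs'.
have sz : size (adj_table e vs) = size vs.
  by elim: (vs) => //= v s ->.
rewrite /triangle_free sz; apply/allP => i _; apply/allP => j; rewrite mem_iota => /andP[ij jn].
apply/allP => k; rewrite mem_iota => /andP[jk kn].
have {}kn : k < size vs by move: kn jn ij jk; clear; lia.
have {}jn : j < size vs by apply: ltn_trans kn.
rewrite !(table_adjE _ v0) //; last exact: ltn_trans jk.
by apply/negP => /and3P[h1 h2 h3]; apply: (no_tri _ _ _ h1 h2); rewrite e_sym.
Qed.

(* The 4-cycle 0123 together with s further vertices. *)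
Definition square_table (r : bitseq * bitseq * bitseq * bitseq) tb :=
  [:: [:: true, false, true & r.1.1.1], [:: true, false & r.1.1.2], true :: r.1.2, r.2 & tb].

Definition all_square_tables s (P : seq bitseq -> bool) :=
  all (fun tb => all (fun r0 => all (fun r1 => all (fun r2 => all (fun r3 =>
    let T := square_table (r0, r1, r2, r3) tb in
    if triangle_free T then P T else true)
    (bitseqs s)) (bitseqs s)) (bitseqs s)) (bitseqs s)) (all_tables s).

Definition crossing_table (tb : seq bitseq) :=
  has (fun i => has (fun j => table_adj tb i j) (iota 4 (size tb - 4))) (iota 0 4).

(** The diagonals of the square are absent because they would create triangles, so the table of the
    graph occurs in the enumeration. *)
Lemma all_square_tablesP (V : finType) (e : rel V) c0 c1 c2 c3 us P :
    symmetric e -> (forall x y z, e x y -> e y z -> e z x -> False) ->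
    e c0 c1 -> e c1 c2 -> e c2 c3 -> e c3 c0 ->
    all_square_tables (size us) P -> P (adj_table e [:: c0, c1, c2, c3 & us]).
Proof.
move=> e_sym no_tri e01 e12 e23 e30 allP_.
have e02 : e c0 c2 = false.
  by apply/negP => e02; apply: (no_tri _ _ _ e01 e12); rewrite e_sym.
have e13 : e c1 c3 = false.
  by apply/negP => e13; apply: (no_tri _ _ _ e12 e23); rewrite e_sym.
have TE : adj_table e [:: c0, c1, c2, c3 & us] =
    square_table (map (e c0) us, map (e c1) us, map (e c2) us, map (e c3) us) (adj_table e us).
  by rewrite /= e01 e02 e12 e13 e23 (e_sym c0 c3) e30.
have tf := adj_table_triangle_free [:: c0, c1, c2, c3 & us] e_sym no_tri.
have mb c : map (e c) us \in bitseqs (size us) by rewrite -(size_map (e c)) mem_bitseqs.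
have := allP_ => /allP/(_ _ (mem_all_tables e us))/allP/(_ _ (mb c0)).
move=> /allP/(_ _ (mb c1))/allP/(_ _ (mb c2))/allP/(_ _ (mb c3)).
move=> h; move: tf; rewrite TE => tf.
have : if triangle_free (square_table (map (e c0) us, map (e c1) us, map (e c2) us, map (e c3) us) (adj_table e us))
  then P (square_table (map (e c0) us, map (e c1) us, map (e c2) us, map (e c3) us) (adj_table e us)) else true by exact: h.
by rewrite tf.
Qed.

Lemma square_index1 : all_square_tables 1
  (fun T => if crossing_table T then table_index 2 4 T <= 1 else true).
Proof. by vm_compute. Qed.

Lemma square_index2 : all_square_tables 2
  (fun T => if crossing_table T then table_index 2 4 T <= 2 else true).
Proof. by vm_compute. Qed.

Lemma square_index3 : all_square_tables 3
  (fun T => if crossing_table T then table_index 2 4 T <= 3 else true).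
Proof. by vm_compute. Qed.

Lemma square_index_five2 : all_square_tables 2 (fun T => table_index 2 5 T <= 1).
Proof. by vm_compute. Qed.

Lemma square_index_five3 : all_square_tables 3 (fun T => table_index 2 5 T <= 2).
Proof. by vm_compute. Qed.

End Tables.

(** * Both girth ranges together, and the lift to larger complements *)

Section AnyGirth.
Variables (R : rcfType) (V : finType).
Local Open Scope nat_scope.
Implicit Types (e : rel V) (cs : seq V) (K B : {set V}).

Lemma config_uniq e cs K : cycle_config e cs K -> uniq (cs ++ enum K).
Proof.
move=> cfg; rewrite cat_uniq enum_uniq (ucycle_uniq (cfg_cycle cfg)) andbT /=.
by apply/hasPn => v; rewrite mem_enum => /(cfg_out cfg).
Qed.

Lemma config_supp e cs K u v : cycle_config e cs K -> e u v -> u \in cs ++ enum K.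
Proof. by move=> cfg /(cfg_supp cfg); rewrite mem_cat mem_enum. Qed.

Lemma index_le_square d e cs K (t s : nat) P :
    cycle_config e cs K -> size cs = 4 -> all_square_tables #|K| P ->
    0 < t -> (P (adj_table e (cs ++ enum K)) ->
      table_index d (Z.of_nat t) (adj_table e (cs ++ enum K)) <= s) ->
  index_le e (t%:R : R)%R s.
Proof.
move=> cfg sz allP_ t0 Ps.
apply: (@index_le_table R V d e (cs ++ enum K)) => //.
- exact: cfg_sym cfg.
- exact: cfg_irr cfg.
- exact: config_uniq cfg.
- by move=> u v; apply: config_supp cfg.
apply: Ps; case/andP: (cfg_cycle cfg) => + _.
case: cs cfg sz => [|c0 [|c1 [|c2 [|c3 [|c4 cs]]]]] //= cfg _ /and5P[e01 e12 e23 e30 _].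
apply: (@all_square_tablesP _ e c0 c1 c2 c3 (enum K) P (cfg_sym cfg)) => //.
  by move=> x y z; apply: (no_triangle cfg).
by rewrite -cardE.
Qed.

Lemma crossing_config e cs K u a :
    cycle_config e cs K -> size cs = 4 -> u \in K -> a \in cs -> e u a ->
  crossing_table (adj_table e (cs ++ enum K)).
Proof.
move=> cfg sz uK acs eua.
have szt : size (adj_table e (cs ++ enum K)) = 4 + #|K|.
  by rewrite size_adj_table size_cat sz -cardE.
have uE : u \in enum K by rewrite mem_enum.
apply/hasP; exists (index a cs); first by rewrite mem_iota /= add0n -sz index_mem.
apply/hasP; exists (4 + index u (enum K)).
  by rewrite mem_iota szt addKn leq_addr ltn_add2l cardE index_mem.
have i4 : index a cs < 4 by rewrite -sz index_mem.
rewrite (table_adjE e a); last first.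
- by rewrite size_cat sz ltn_add2l index_mem.
- exact: leq_trans i4 (leq_addr _ _).
rewrite !nth_cat sz i4 ltnNge leq_addr /= addKn !nth_index //.
by rewrite (cfg_sym cfg).
Qed.

Lemma index_le_config e cs K :
    cycle_config e cs K -> #|K| < size cs ->
    (exists u a, [/\ u \in K, a \in cs & e u a]) ->
  index_le e (4 : R)%R #|K|.
Proof.
move=> cfg Kg cross; have := cfg_size cfg; rewrite leq_eqVlt => /orP[/eqP g4|g5].
  have [u [a [uK acs eua]]] := cross.
  have cT := crossing_config cfg (esym g4) uK acs eua.
  move: Kg; rewrite -g4 !ltnS leq_eqVlt ltnS leq_eqVlt ltnS leq_eqVlt ltnS leqn0.
  case/or4P => /eqP K_; last by move: uK; rewrite (card0_eq K_).
  - have sq := square_index3; rewrite -K_ in sq.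
    by apply: (index_le_square (d := 2) cfg (esym g4) sq) => //; rewrite cT K_.
  - have sq := square_index2; rewrite -K_ in sq.
    by apply: (index_le_square (d := 2) cfg (esym g4) sq) => //; rewrite cT K_.
  - have sq := square_index1; rewrite -K_ in sq.
    by apply: (index_le_square (d := 2) cfg (esym g4) sq) => //; rewrite cT K_.
exact: index_le_core cfg g5 Kg cross.
Qed.

Lemma index_le_config2 e cs K : cycle_config e cs K -> #|K| = 2 -> index_le e (5 : R)%R 1.
Proof.
move=> cfg K2; have := cfg_size cfg; rewrite leq_eqVlt => /orP[/eqP g4|g5].
  have sq := square_index_five2; rewrite -K2 in sq.
  exact: (index_le_square (d := 2) cfg (esym g4) sq).
exact: index_le_core2 cfg g5 K2.
Qed.

Lemma index_le_config3 e cs K : cycle_config e cs K -> #|K| = 3 -> index_le e (5 : R)%R 2.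
Proof.
move=> cfg K3; have := cfg_size cfg; rewrite leq_eqVlt => /orP[/eqP g4|g5].
  have sq := square_index_five3; rewrite -K3 in sq.
  exact: (index_le_square (d := 2) cfg (esym g4) sq).
exact: index_le_core3 cfg g5 K3.
Qed.

Lemma subset_of_size (A : {set V}) k : k <= #|A| -> exists2 B : {set V}, B \subset A & #|B| = k.
Proof.
move=> kA; exists [set x in take k (enum A)].
  by apply/subsetP => x; rewrite inE => /mem_take; rewrite mem_enum.
by rewrite cardsE (card_uniqP _) ?take_uniq ?enum_uniq // size_takel // -cardE.
Qed.

Lemma index_le_lift e cs K B (t : nat) s :
    cycle_config e cs K -> B \subset K ->
    index_le (delete_vertices e (K :\: B)) (t%:R : R)%R s ->
  index_le e ((t + (#|K| - #|B|))%:R : R)%R (s + (#|K| - #|B|)).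
Proof.
move=> cfg BK; rewrite -(setIidPr BK) -cardsD setIC (setIidPl BK) natrD.
exact: index_le_delete_vertices.
Qed.

Lemma config_restrict e cs K B : cycle_config e cs K -> B \subset K ->
  cycle_config (delete_vertices e (K :\: B)) cs B.
Proof.
move=> cfg BK; have BE : K :\: (K :\: B) = B by rewrite setDDr setDv set0U (setIidPr BK).
have := @config_delete _ _ _ _ (K :\: B) cfg; rewrite BE; apply=> v.
by rewrite inE => /andP[_]; apply: (cfg_out cfg).
Qed.

(** The set [B] of [k] surviving vertices is chosen to contain an attached one, so that an edge to
    the cycle remains after the deletion. *)
Lemma index_le_threshold e cs K k :
    cycle_config e cs K -> 0 < k -> k < size cs -> k <= #|K| ->
    (exists u a, [/\ u \in K, a \in cs & e u a]) ->
  index_le e ((#|K| - k + 4)%:R : R)%R #|K|.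
Proof.
move=> cfg k0 kg kK [u [a [uK acs eua]]].
have [B' B'sub B'k] : exists2 B' : {set V}, B' \subset K :\ u & #|B'| = k.-1.
  by apply: subset_of_size; move: kK; rewrite (cardsD1 u K) uK; case: (k) k0.
pose B := u |: B'.
have BK : B \subset K.
  by rewrite subUset sub1set uK (subset_trans B'sub) ?subD1set.
have Bk : #|B| = k.
  rewrite cardsU1; have -> : u \notin B' by apply/negP => /(subsetP B'sub); rewrite !inE eqxx.
  by rewrite B'k /= add1n prednK.
have := index_le_lift cfg BK (t := 4) (s := k).
rewrite Bk [4 + _]addnC subnKC //; apply.
rewrite -[X in index_le _ _ X]Bk; apply: (index_le_config (config_restrict cfg BK)); first by rewrite Bk.
exists u, a; split=> //; first by rewrite !inE eqxx.
rewrite /delete_vertices eua !inE eqxx /=; apply/negP => /andP[_ aK].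
by have := cfg_out cfg aK; rewrite acs.
Qed.

Lemma index_le_threshold1 e cs K : cycle_config e cs K -> 1 < #|K| ->
  index_le e ((#|K| + 3)%:R : R)%R (#|K| - 1).
Proof.
move=> cfg K2; have [B BK B2] := subset_of_size K2.
have := index_le_lift cfg BK (t := 5) (s := 1).
have -> : 5 + (#|K| - #|B|) = #|K| + 3 by rewrite B2; move: K2; clear; lia.
have -> : 1 + (#|K| - #|B|) = #|K| - 1 by rewrite B2; move: K2; clear; lia.
by apply; apply: (index_le_config2 (config_restrict cfg BK)).
Qed.

Lemma index_le_threshold2 e cs K : cycle_config e cs K -> 2 < #|K| ->
  index_le e ((#|K| + 2)%:R : R)%R (#|K| - 1).
Proof.
move=> cfg K3; have [B BK B3] := subset_of_size K3.
have := index_le_lift cfg BK (t := 5) (s := 2).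
have -> : 5 + (#|K| - #|B|) = #|K| + 2 by rewrite B3; move: K3; clear; lia.
have -> : 2 + (#|K| - #|B|) = #|K| - 1 by rewrite B3; move: K3; clear; lia.
by apply; apply: (index_le_config3 (config_restrict cfg BK)).
Qed.

End AnyGirth.

Local Open Scope nat_scope.

(** * Isomorphism by equality of tables, and the tables of the named graphs *)

Definition enumerates (T : eqType) (vs : seq T) := uniq vs /\ forall v, v \in vs.

Lemma adj_table_map (V W : Type) (e : rel V) (r : rel W) (h : W -> V) ws :
  (forall x y, e (h x) (h y) = r x y) -> adj_table e (map h ws) = adj_table r ws.
Proof.
move=> hr; elim: ws => //= w ws ->; congr (_ :: _).
by rewrite -map_comp; apply: eq_map => x /=.
Qed.

Lemma isomorphic_table (G H : sgraph) (vs : seq G) (ws : seq H) :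
    enumerates vs -> enumerates ws -> 0 < size vs -> size vs = size ws ->
    adj_table (@adj G) vs = adj_table (@adj H) ws ->
  isomorphic G H.
Proof.
move=> [uvs avs] [uws aws] n0 sz TE.
have w0 : H by case: ws sz {uws aws TE} => [|w //] sz; rewrite sz in n0.
have v0 : G by case: vs n0 {uvs avs sz TE}.
pose f v := nth w0 ws (index v vs); pose h w := nth v0 vs (index w ws).
have lt v : index v vs < size vs by rewrite index_mem.
have lt' w : index w ws < size ws by rewrite index_mem.
exists f.
  exists h => [v|w]; first by rewrite /h /f index_uniq ?nth_index -?sz.
  by rewrite /h /f index_uniq ?nth_index ?sz.
have aux x y : index x vs < index y vs -> adj (f x) (f y) = adj x y.
  move=> xy; rewrite /f -(table_adjE (@adj H) w0 xy) -?sz // -TE.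
  by rewrite (table_adjE (@adj G) v0 xy) // !nth_index.
move=> x y; case: (ltngtP (index x vs) (index y vs)) => [/aux//|/aux|eq].
  by rewrite adj_sym => ->; rewrite adj_sym.
have -> : x = y by rewrite -(nth_index v0 (avs x)) eq nth_index.
by rewrite !adj_irrefl.
Qed.

Lemma isomorphic_transport (G H : sgraph) (ws : seq H) :
    isomorphic G H -> enumerates ws ->
  exists vs : seq G, [/\ enumerates vs, size vs = size ws &
    adj_table (@adj G) vs = adj_table (@adj H) ws].
Proof.
move=> [f [h fK hK] fmono] [uws aws]; exists (map h ws); split.
- split; first by rewrite map_inj_uniq //; apply: can_inj hK.
  by move=> v; apply/mapP; exists (f v); rewrite ?fK.
- by rewrite size_map.
by apply: adj_table_map => x y; rewrite -fmono !hK.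
Qed.

Fixpoint nat_table m (r : rel nat) : seq bitseq :=
  if m is m'.+1 then
    [seq r 0 j.+1 | j <- iota 0 m'] :: nat_table m' (fun i j => r i.+1 j.+1)
  else [::].

Lemma adj_table_nat (V : Type) (e : rel V) vs (r : rel nat) v0 :
    (forall i j, i < j -> j < size vs -> e (nth v0 vs i) (nth v0 vs j) = r i j) ->
  adj_table e vs = nat_table (size vs) r.
Proof.
elim: vs r => //= v vs IH r er; congr (_ :: _).
  apply: (@eq_from_nth _ false); first by rewrite !size_map size_iota.
  move=> i; rewrite size_map => iv; rewrite (nth_map v0) // (nth_map 0) ?size_iota //.
  by rewrite nth_iota // -(er 0 i.+1).
by apply: IH => i j ij jv; rewrite -(er i.+1 j.+1).
Qed.

Lemma nat_table_adj (V : Type) (e : rel V) vs (r : rel nat) v0 m :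
    adj_table e vs = nat_table m r -> forall i j, i < j -> j < size vs ->
  e (nth v0 vs i) (nth v0 vs j) = r i j.
Proof.
elim: vs m r => [|v vs IH] [|m] r //= [row tbl] [|i] [|j] //= ij jv; last first.
  exact: (IH m (fun i j => r i.+1 j.+1) tbl i j ij jv).
have sz : size vs = m by have := congr1 size row; rewrite !size_map size_iota.
have /(congr1 (fun s => nth false s j)) := row.
by rewrite (nth_map v0) // (nth_map 0) ?size_iota -?sz // nth_iota -?sz // add0n.
Qed.

(** Only consulted for i < j, hence not symmetric; the second alternative is the closing edge. *)
Definition cycle_adj g : rel nat := fun i j => (j == i.+1) || ((i == 0) && (j == g.-1)).

(* The g-cycle 0, ..., g - 1, the vertex g attached to 0, the vertex g + 1
   attached to d, and the edge between these two vertices when ad holds. *)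
Definition cycle2_adj (g d : nat) (ad : bool) : rel nat := fun i j =>
  if j < g then cycle_adj g i j
  else if i < g then if j == g then i == 0 else i == d else ad.

Definition cycle1_adj g : rel nat := fun i j => if j < g then cycle_adj g i j else i == 0.

Definition cycle2_table (g d : nat) ad := nat_table (g + 2) (cycle2_adj g d ad).
Definition cycle1_table g := nat_table (g + 1) (cycle1_adj g).

Definition K24_vertices : seq (complete_bipartite 2 4) :=
  [:: inl ord0; inr ord0; inl ord_max; inr (Ordinal (isT : 1 < 4));
      inr (Ordinal (isT : 2 < 4)); inr ord_max].

Definition K23_a : K23 := inl ord0.
Definition K23s_vertices : seq K23s :=
  [:: Some K23_a; Some K23_x; Some K23_b; Some K23_y; Some K23_z; None].
Definition K23_vertices : seq K23 := [:: K23_a; K23_x; K23_b; K23_y; K23_z].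
(** The orders of the named graphs begin with a shortest cycle, as in a [cycle_config]. Here it is
    a, y, b, the vertex on bz, z; the two others are x, attached at position 0, and the vertex on
    bx, attached at position 2. *)
Definition K23ss_vertices : seq K23ss :=
  [:: Some (Some K23_a); Some (Some K23_y); Some (Some K23_b); Some None;
      Some (Some K23_z); Some (Some K23_x); None].
Definition K23sss_vertices : seq K23sss :=
  [:: Some (Some (Some K23_a)); Some (Some (Some K23_x)); Some None;
      Some (Some (Some K23_b)); Some (Some None); Some (Some (Some K23_z));
      Some (Some (Some K23_y)); None].

Lemma ord_cases2 (i : 'I_2) : i = ord0 \/ i = ord_max.
Proof. by case: i => [[|[|//]] lt]; [left | right]; apply: val_inj. Qed.

Lemma enum_K24 : enumerates K24_vertices.
Proof.
split; first by vm_compute.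
by case=> [] [[|[|[|[|i]]]] lt] //.
Qed.

Lemma enum_K23 : enumerates K23_vertices.
Proof. by split=> //; case=> [] [[|[|[|[|i]]]] lt]. Qed.

Lemma enumerates_some (T : eqType) (ws : seq T) ws' :
  enumerates ws -> perm_eq ws' (None :: map Some ws) -> enumerates (ws' : seq (option T)).
Proof.
move=> [uws aws] p; split.
  rewrite (perm_uniq p) /= map_inj_uniq ?uws ?andbT; last by move=> ? ? [].
  by apply/negP => /mapP[].
by move=> v; rewrite (perm_mem p) inE; case: v => //= v; rewrite map_f.
Qed.

Lemma enum_K23s : enumerates K23s_vertices.
Proof. by apply: (enumerates_some enum_K23); vm_compute. Qed.

Lemma enum_K23ss : enumerates K23ss_vertices.
Proof. by apply: (enumerates_some enum_K23s); vm_compute. Qed.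

Lemma enum_K23sss : enumerates K23sss_vertices.
Proof. by apply: (enumerates_some enum_K23ss); vm_compute. Qed.

Lemma table_K23ss : adj_table (@adj K23ss) K23ss_vertices = cycle2_table 5 2 true.
Proof. by vm_compute. Qed.

Lemma table_K23sss : adj_table (@adj K23sss) K23sss_vertices = cycle2_table 6 3 true.
Proof. by vm_compute. Qed.

Lemma cycle_graph_adj g (i j : 'I_g) : 2 < g -> i < j ->
  @adj (cycle_graph g) i j = cycle_adj g i j.
Proof.
move=> g2 ij; rewrite /adj /= /rel_adj /cycle_adj -val_eqE /= neq_ltn ij /=.
have jg := ltn_ord j.
rewrite modn_small; last exact: leq_ltn_trans ij jg.
congr (_ || _); case: (ltngtP j.+1 g) => [lt|gt|eq].
- rewrite modn_small //; move: ij lt; clear; lia.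
- by move: jg gt; clear; lia.
- have -> : j.+1 %% g = 0 by rewrite eq modnn.
  have jE : nat_of_ord j = g.-1 := congr1 predn eq.
  by rewrite jE eqxx andbT eq_sym.
Qed.

Lemma add_vertex_some (G : sgraph) (P : pred G) x y :
  @adj (add_vertex P) (Some x) (Some y) = adj x y.
Proof.
rewrite {1}/adj /= /rel_adj [adj y x]adj_sym orbb (inj_eq Some_inj).
by case: eqVneq => [->|]; rewrite ?adj_irrefl.
Qed.

Lemma add_vertex_none (G : sgraph) (P : pred G) x :
  @adj (add_vertex P) (Some x) None = P x.
Proof. by []. Qed.

Definition Y_vertices n i : seq (Y_graph n i) :=
  rcons (rcons [seq Some (Some j) | j <- enum 'I_(n - 2)] (Some None)) None.

Lemma enum_Y n i : enumerates (Y_vertices n i).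
Proof.
apply: (@enumerates_some _ (rcons [seq Some j | j <- enum 'I_(n - 2)] None)).
  apply: (@enumerates_some _ (enum 'I_(n - 2))).
    by split; [apply: enum_uniq | move=> v; rewrite mem_enum].
  by rewrite perm_rcons.
have -> : Y_vertices n i = rcons (map Some (rcons [seq Some j | j <- enum 'I_(n - 2)] None)) None.
  by rewrite /Y_vertices map_rcons -map_comp.
by rewrite perm_rcons.
Qed.

Lemma table_Y n i : 4 < n -> 0 < i -> i <= n - 2 -> 1 < i ->
  adj_table (@adj (Y_graph n i)) (Y_vertices n i) = cycle2_table (n - 2) (i - 1) false.
Proof.
move=> n4 i0 ig i1; set g := n - 2.
have sz : size (Y_vertices n i) = g + 2 by rewrite !size_rcons size_map size_enum_ord addn2.
rewrite /cycle2_table -sz; apply: (adj_table_nat (v0 := None)) => a b ab.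
rewrite sz => bg; rewrite /Y_vertices !nth_rcons !size_rcons size_map size_enum_ord -/g.
rewrite /cycle2_adj.
have nthE c : c < g -> exists2 j : 'I_g, val j = c &
    nth None [seq Some (Some j) | j <- enum 'I_g] c = Some (Some j).
  move=> cg; exists (Ordinal cg) => //.
  rewrite (nth_map (Ordinal cg)) ?size_enum_ord //; congr (Some (Some _)).
  by apply: val_inj; rewrite /= nth_enum_ord.
have ag : a < g + 1 by move: ab bg; clear; lia.
case: (ltnP b g) => [blt|bge].
  have alt := ltn_trans ab blt; have aS : a < g.+1 by apply: leqW.
  have bS : b < g.+1 by apply: leqW.
  rewrite aS bS alt; have [j jE ->] := nthE _ blt; have [k kE ->] := nthE _ alt.
  rewrite -jE -kE -(cycle_graph_adj (g := g)) ?jE ?kE //; last first.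
    by rewrite /g; move: n4; clear; lia.
  by rewrite !add_vertex_some.
rewrite [b < g.+1]ltnS.
case: (ltnP a g) => [alt|age].
  have aS : a < g.+1 by apply: leqW.
  have [j jE jn] := nthE _ alt.
  rewrite aS jn; case: (ltngtP b g) bge => // [gb|bE] _.
    have bE : b == g.+1 by move: gb bg; clear; lia.
    by rewrite bE -jE.
  by rewrite add_vertex_some add_vertex_none jE.
have aE : a = g by move: ag age; clear; lia.
have bE : b = g.+1 by move: ab bg aE; clear; lia.
by rewrite aE bE ltnSn eqxx ltnn eqxx.
Qed.

Definition U_vertices n : seq (U_graph n) :=
  rcons [seq Some j | j <- enum 'I_(n - 1)] None.

Lemma enum_U n : enumerates (U_vertices n).
Proof.
apply: (@enumerates_some _ (enum 'I_(n - 1))).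
  by split; [apply: enum_uniq | move=> v; rewrite mem_enum].
by rewrite /U_vertices perm_rcons.
Qed.

Lemma table_U n : 3 < n ->
  adj_table (@adj (U_graph n)) (U_vertices n) = cycle1_table (n - 1).
Proof.
move=> n4; set g := n - 1.
have sz : size (U_vertices n) = g + 1 by rewrite size_rcons size_map size_enum_ord addn1.
rewrite /cycle1_table -sz; apply: (adj_table_nat (v0 := None)) => a b ab.
rewrite sz => bg; rewrite /U_vertices !nth_rcons size_map size_enum_ord -/g /cycle1_adj.
have nthE c : c < g -> exists2 j : 'I_g, val j = c &
    nth None [seq Some j | j <- enum 'I_g] c = Some j.
  move=> cg; exists (Ordinal cg) => //.
  rewrite (nth_map (Ordinal cg)) ?size_enum_ord //; congr (Some _).
  by apply: val_inj; rewrite /= nth_enum_ord.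
have ag : a < g by move: ab bg; clear; lia.
have [k kE kn] := nthE _ ag; rewrite ag kn.
case: (ltnP b g) => [blt|bge].
  have [j jE ->] := nthE _ blt.
  rewrite -jE -kE -(cycle_graph_adj (g := g)) ?jE ?kE //; last first.
    by rewrite /g; move: n4; clear; lia.
  by rewrite add_vertex_some.
have bE : b = g by move: bg bge; clear; lia.
by rewrite bE eqxx add_vertex_none -kE.
Qed.

(** * Test planes on which q >= 4 |x|^2 *)

Section LowerBounds.
Local Open Scope ring_scope.
Variable R : rcfType.

Fixpoint row_energy (r : bitseq) (a : R) (xs : seq R) : R :=
  match r, xs with
  | b :: r', c :: xs' => if b then (a - c) ^+ 2 + row_energy r' a xs' else row_energy r' a xs'
  | _, _ => 0
  end.

Fixpoint table_energy (tb : seq bitseq) (xs : seq R) : R :=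
  match tb, xs with
  | r :: tb', a :: xs' => row_energy r a xs' + table_energy tb' xs'
  | _, _ => 0
  end.

Lemma pair_energy_table (V : finType) (e : rel V) (x : V -> R) vs :
  pair_energy e x vs = table_energy (adj_table e vs) (map x vs).
Proof.
elim: vs => //= v vs ->; congr (_ + _).
elim: vs => [|w vs IH] /=; first by rewrite big_nil.
by rewrite big_cons IH; case: (e v w); rewrite ?mul1r ?mul0r ?add0r.
Qed.

Definition combine (f1 f2 : seq R) (y1 y2 : R) := [seq y1 * p.1 + y2 * p.2 | p <- zip f1 f2].

Lemma count_ge2_enum (G : sgraph) (vs : seq G) (f : 'I_2 -> nat -> R) p q (b : R) :
    enumerates vs -> (p < size vs)%N -> (q < size vs)%N -> #|G|%:R <= b ->
    f ord0 p = 1 -> f ord0 q = 0 -> f ord_max p = 0 -> f ord_max q = 1 ->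
    (forall (y1 y2 : R) h, (forall i, h i = y1 * f ord0 i + y2 * f ord_max i) ->
       8 * \sum_v h (index v vs) ^+ 2 <= energy (@adj G) (fun v => h (index v vs))) ->
  (2 <= laplacian_count G 4 b)%N.
Proof.
move=> [uvs avs] pv qv Gb f0p f0q f1p f1q pos.
have v0 : G by case: vs pv {uvs avs qv pos} => [//|v _ _]; exact: v.
apply: (@laplacian_count_ge R G 4 b 2 (fun i v => f i (index v vs))
   (fun j => nth v0 vs (if j == ord0 then p else q))) => // [i j|y].
  rewrite index_uniq //; last by case: ifP.
  by case: (ord_cases2 i) => ->; case: (ord_cases2 j) => ->; rewrite ?eqxx /= ?f0p ?f0q ?f1p ?f1q.
have E : (fun v => \sum_i y i * f i (index v vs)) =1
    (fun v => y ord0 * f ord0 (index v vs) + y ord_max * f ord_max (index v vs)).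
  by move=> v; rewrite big_ord_recl big_ord1; congr (_ + y _ * f _ _); apply: val_inj.
have := pos (y ord0) (y ord_max) _ (fun=> erefl).
have -> : 8 = 2 * 4 :> R by ring.
rewrite (eq_bigr (fun v => (\sum_i y i * f i (index v vs)) ^+ 2)); last by move=> v _; rewrite E.
move/le_trans; apply; rewrite /energy le_eqVlt; apply/orP; left; apply/eqP.
by apply: eq_bigr => u _; apply: eq_bigr => v _; rewrite !E.
Qed.

Lemma count_ge2_table (G : sgraph) (vs : seq G) (f1 f2 : seq R) p q (b : R) T :
    enumerates vs -> adj_table (@adj G) vs = T ->
    size f1 = size vs -> size f2 = size vs ->
    (p < size vs)%N -> (q < size vs)%N -> #|G|%:R <= b ->
    f1`_p = 1 -> f1`_q = 0 -> f2`_p = 0 -> f2`_q = 1 ->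
    (forall y1 y2, 4 * \sum_(c <- combine f1 f2 y1 y2) c ^+ 2 <=
       table_energy T (combine f1 f2 y1 y2)) ->
  (2 <= laplacian_count G 4 b)%N.
Proof.
move=> enum_vs TE s1 s2 pv qv Gb f1p f1q f2p f2q pos.
have [uvs avs] := enum_vs.
apply: (@count_ge2_enum G vs (fun i j => if i == ord0 then f1`_j else f2`_j) p q) => // y1 y2 h hE.
rewrite (energy_pair_energy _ (@adj_sym G) (@adj_irrefl G) uvs) ?pair_energy_table // TE.
have mapE : [seq h (index v vs) | v <- vs] = combine f1 f2 y1 y2.
  have v0 : G by case: vs pv {uvs avs qv enum_vs TE s1 s2 pos hE} => [//|v _ _]; exact: v.
  apply: (@eq_from_nth _ 0); first by rewrite !size_map size_zip s1 s2 minnn.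
  move=> i; rewrite size_map => iv; rewrite (nth_map v0) // (nth_map (0, 0)); last first.
    by rewrite size_zip s1 s2 minnn.
  by rewrite nth_zip ?s1 ?s2 // index_uniq // hE.
rewrite mapE; have := pos y1 y2; rewrite -mapE big_map.
have -> : \sum_(v <- vs) h (index v vs) ^+ 2 = \sum_v h (index v vs) ^+ 2.
  by rewrite [RHS](perm_big vs) //; apply: uniq_perm => // [|v]; rewrite ?index_enum_uniq // mem_index_enum avs.
rewrite mapE; lra.
Qed.

Definition K24_table : seq bitseq := adj_table (@adj (complete_bipartite 2 4)) K24_vertices.
Definition K23s_table : seq bitseq := adj_table (@adj K23s) K23s_vertices.

(* On a path of length l between two branch vertices the test vectors
   alternate in sign and interpolate linearly in absolute value. *)
Lemma count_K24 (G : sgraph) (vs : seq G) (b : R) : enumerates vs -> size vs = 6%N ->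
    adj_table (@adj G) vs = K24_table -> #|G|%:R <= b ->
  (2 <= laplacian_count G 4 b)%N.
Proof.
move=> enum_vs sz TE Gb.
have T : K24_table = [:: [:: true; false; true; true; true]; [:: true; false; false; false];
   [:: true; true; true]; [:: false; false]; [:: false]; [::]] by vm_compute.
apply: (count_ge2_table (f1 := [:: 1; - 1 / 2; 0; - 1 / 2; - 1 / 2; - 1 / 2])
  (f2 := [:: 0; - 1 / 2; 1; - 1 / 2; - 1 / 2; - 1 / 2]) (p := 0%N) (q := 2%N) enum_vs (etrans TE T)) => //; rewrite ?sz //.
move=> y1 y2; rewrite /combine /= !big_cons big_nil.
have := sqr_ge0 (y1 + y2); have := sqr_ge0 (y1 - y2); have := sqr_ge0 y1; have := sqr_ge0 y2; lra.
Qed.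

Lemma count_K23s (G : sgraph) (vs : seq G) (b : R) : enumerates vs -> size vs = 6%N ->
    adj_table (@adj G) vs = K23s_table -> #|G|%:R <= b ->
  (2 <= laplacian_count G 4 b)%N.
Proof.
move=> enum_vs sz TE Gb.
have T : K23s_table = [:: [:: true; false; true; true; false]; [:: true; false; false; false];
   [:: true; false; true]; [:: false; false]; [:: true]; [::]] by vm_compute.
apply: (count_ge2_table (f1 := [:: 1; - 1 / 2; 0; - 1 / 2; - 2 / 3; 1 / 3])
  (f2 := [:: 0; - 1 / 2; 1; - 1 / 2; 1 / 3; - 2 / 3]) (p := 0%N) (q := 2%N) enum_vs (etrans TE T)) => //; rewrite ?sz //.
move=> y1 y2; rewrite /combine /= !big_cons big_nil.
have := sqr_ge0 (y1 + y2); have := sqr_ge0 (y1 - y2); have := sqr_ge0 y1; have := sqr_ge0 y2; lra.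
Qed.

Lemma count_K23ss (G : sgraph) (vs : seq G) (b : R) : enumerates vs -> size vs = 7%N ->
    adj_table (@adj G) vs = cycle2_table 5 2 true -> #|G|%:R <= b ->
  (2 <= laplacian_count G 4 b)%N.
Proof.
move=> enum_vs sz TE Gb.
apply: (count_ge2_table (f1 := [:: 1; - 1 / 2; 0; 1 / 3; - 2 / 3; - 2 / 3; 1 / 3])
  (f2 := [:: 0; - 1 / 2; 1; - 2 / 3; 1 / 3; 1 / 3; - 2 / 3]) (p := 0%N) (q := 2%N) enum_vs TE) => //; rewrite ?sz //.
move=> y1 y2; rewrite /combine /= !big_cons big_nil.
have := sqr_ge0 (y1 + y2); have := sqr_ge0 (y1 - y2); have := sqr_ge0 y1; have := sqr_ge0 y2; lra.
Qed.

Lemma count_K23sss (G : sgraph) (vs : seq G) (b : R) : enumerates vs -> size vs = 8%N ->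
    adj_table (@adj G) vs = cycle2_table 6 3 true -> #|G|%:R <= b ->
  (2 <= laplacian_count G 4 b)%N.
Proof.
move=> enum_vs sz TE Gb.
apply: (count_ge2_table (f1 := [:: 1; - 2 / 3; 1 / 3; 0; 1 / 3; - 2 / 3; - 2 / 3; 1 / 3])
  (f2 := [:: 0; 1 / 3; - 2 / 3; 1; - 2 / 3; 1 / 3; 1 / 3; - 2 / 3]) (p := 0%N) (q := 3%N) enum_vs TE) => //; rewrite ?sz //.
move=> y1 y2; rewrite /combine /= !big_cons big_nil.
have := sqr_ge0 (y1 + y2); have := sqr_ge0 (y1 - y2); have := sqr_ge0 y1; have := sqr_ge0 y2; lra.
Qed.

(** For a lower bound a list of some of the edges suffices, given by positions i < j; the energy
    contains each of them in both directions. *)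
Lemma energy_ge (V : finType) (e : rel V) vs v0 (E : seq (nat * nat)) (h : nat -> R) :
    symmetric e -> uniq vs -> uniq E ->
    (forall i j, (i, j) \in E -> [/\ (i < j)%N, (j < size vs)%N & e (nth v0 vs i) (nth v0 vs j)]) ->
  2 * (\sum_(p <- E) (h p.1 - h p.2) ^+ 2) <= energy e (fun v => h (index v vs)).
Proof.
move=> e_sym uvs uE EP.
pose vp (p : nat * nat) := (nth v0 vs p.1, nth v0 vs p.2).
pose F (p : V * V) := (h (index p.1 vs) - h (index p.2 vs)) ^+ 2.
pose sw (p : nat * nat) := (nth v0 vs p.2, nth v0 vs p.1).
have idx p : p \in E -> index (nth v0 vs p.1) vs = p.1 /\ index (nth v0 vs p.2) vs = p.2.
  by case: p => i j /EP[ij jv _] /=; rewrite !index_uniq // (ltn_trans ij).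
have inj1 : {in E &, injective vp}.
  move=> p q pE qE [e1 e2]; have [p1 p2] := idx p pE; have [q1 q2] := idx q qE.
  by rewrite (surjective_pairing p) (surjective_pairing q) -p1 -p2 -q1 -q2 e1 e2.
have inj2 : {in E &, injective sw}.
  by move=> p q pE qE [e1 e2]; apply: inj1 => //; rewrite /vp e1 e2.
have uL : uniq (map vp E ++ map sw E).
  rewrite cat_uniq (map_inj_in_uniq inj1) (map_inj_in_uniq inj2) uE /= andbT.
  apply/hasPn => _ /mapP[p pE ->]; apply/negP => /mapP[q qE [e1 e2]].
  have [p1 p2] := idx p pE; have [q1 q2] := idx q qE.
  move: pE qE; rewrite (surjective_pairing p) (surjective_pairing q).
  move=> /EP[lt1 _ _] /EP[lt2 _ _]; move: lt1 lt2.
  have -> : p.1 = q.2 by rewrite -p1 e2 q2.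
  have -> : p.2 = q.1 by rewrite -p2 e1 q1.
  by clear; lia.
have sum1 : \sum_(p <- map vp E) F p = \sum_(p <- E) (h p.1 - h p.2) ^+ 2.
  by rewrite big_map; apply: eq_big_seq => p /idx[p1 p2]; rewrite /F /= p1 p2.
have sum2 : \sum_(p <- map sw E) F p = \sum_(p <- E) (h p.1 - h p.2) ^+ 2.
  rewrite big_map; apply: eq_big_seq => p /idx[p1 p2]; rewrite /F /= p1 p2.
  by rewrite -[LHS]sqrrN opprB.
have -> : 2 * (\sum_(p <- E) (h p.1 - h p.2) ^+ 2) = \sum_(p <- map vp E ++ map sw E) F p.
  by rewrite big_cat sum1 sum2 mulr_natl mulr2n.
rewrite /energy pair_big /= big_uniq //= big_mkcond /=; apply: ler_sum => p _.
case: ifP => pL; last by rewrite mulr_ge0 ?sqr_ge0 ?ler0n.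
suff -> : e p.1 p.2 by rewrite mul1r.
move: pL; rewrite mem_cat => /orP[] /mapP[[i j] /EP[_ _ eij] ->] //=.
by rewrite e_sym.
Qed.

(** From (a - b)^2 = 2 a^2 + 2 b^2 - (a + b)^2 around a closed walk: the deficit of the cycle
    against 4 |x|^2 is the sum of the squared sums of consecutive values. *)
Lemma sum_cyclic_shift (H : nat -> R) g : H g ^+ 2 = H 0%N ^+ 2 ->
  \sum_(0 <= i < g) (H i - H i.+1) ^+ 2 =
    4 * \sum_(0 <= i < g) H i ^+ 2 - \sum_(0 <= i < g) (H i + H i.+1) ^+ 2.
Proof.
move=> Hg.
have shift : \sum_(0 <= i < g) H i.+1 ^+ 2 = \sum_(0 <= i < g) H i ^+ 2.
  apply: (@addrI _ (H 0%N ^+ 2)); rewrite -(big_nat_recl _ _ (fun i => H i ^+ 2)) //.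
  by rewrite big_nat_recr //= Hg addrC.
have -> : 4 * \sum_(0 <= i < g) H i ^+ 2 =
   \sum_(0 <= i < g) (2 * H i ^+ 2) + \sum_(0 <= i < g) (2 * H i.+1 ^+ 2).
  by rewrite -!mulr_sumr shift; ring.
by rewrite -big_split -sumrB; apply: eq_bigr => i _ /=; ring.
Qed.

Section Ramp.
Variables (l : nat) (y1 y2 : R).

(** Alternating signs times a linear interpolation. Sums of consecutive values then have constant
    modulus, which minimizes the deficit for given end values. *)
Definition ramp (i : nat) : R :=
  (-1) ^+ i * (y1 + ((-1) ^+ l * y2 - y1) * (i%:R / l%:R)).

Lemma ramp0 : ramp 0 = y1.
Proof. by rewrite /ramp expr0 mul0r mulr0 addr0 mul1r. Qed.

Hypothesis l0 : (0 < l)%N.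

Lemma rampl : ramp l = y2.
Proof.
rewrite /ramp divff ?pnatr_eq0 ?gtn_eqF // mulr1 addrC subrK mulrA -exprMn mulrNN mulr1.
by rewrite expr1n mul1r.
Qed.

Lemma ramp_step i : (ramp i + ramp i.+1) ^+ 2 = ((-1) ^+ l * y2 - y1) ^+ 2 / l%:R ^+ 2.
Proof.
have lR : l%:R != 0 :> R by rewrite pnatr_eq0 gtn_eqF.
rewrite /ramp [(-1) ^+ i.+1]exprS; set s := (-1) ^+ i; set c := (-1) ^+ l * y2 - y1.
have -> : s * (y1 + c * (i%:R / l%:R)) + -1 * s * (y1 + c * (i.+1%:R / l%:R)) = - s * (c / l%:R).
  by rewrite -natr1; field.
by rewrite exprMn sqrrN /s -exprM mulnC exprM sqrrN expr1n expr1n mul1r expr_div_n.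
Qed.

Lemma sum_ramp : \sum_(0 <= i < l) (ramp i + ramp i.+1) ^+ 2 = ((-1) ^+ l * y2 - y1) ^+ 2 / l%:R.
Proof.
have lR : l%:R != 0 :> R by rewrite pnatr_eq0 gtn_eqF.
rewrite (eq_bigr (fun=> ((-1) ^+ l * y2 - y1) ^+ 2 / l%:R ^+ 2)); last by move=> i _; apply: ramp_step.
by rewrite sumr_const_nat subn0 -mulr_natr; field.
Qed.

End Ramp.

(** With a, c the inverse lengths of the two arcs and s1, s2 their parities, the left side is the
    deficit of the cycle. For equal parities it is (a + c) times one square, itself at most 2 (y1^2
    + y2^2); for different parities the two squares add up to 2 (y1^2 + y2^2). *)
Lemma two_ramps_le (a c y1 y2 : R) (s1 s2 : bool) :
    0 <= c -> c <= a -> a <= 1 / 2 -> (s1 = s2 -> a + c <= 2 / 3) ->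
  ((-1) ^+ s1 * y2 - y1) ^+ 2 * a + ((-1) ^+ s2 * y1 - y2) ^+ 2 * c <=
    4 / 3 * (y1 ^+ 2 + y2 ^+ 2).
Proof.
move=> c0 ca a2 same.
have main (z w : R) : 0 <= z -> 0 <= w -> z + w = 2 * (y1 ^+ 2 + y2 ^+ 2) ->
   z * a + w * c <= 4 / 3 * (y1 ^+ 2 + y2 ^+ 2).
  move=> z0 w0 zw; have : z * a + w * c <= z * (1 / 2) + w * (1 / 2).
    by rewrite lerD // ler_wpM2l // (le_trans ca).
  have := sqr_ge0 y1; have := sqr_ge0 y2; lra.
have same_le (z : R) : 0 <= z -> z <= 2 * (y1 ^+ 2 + y2 ^+ 2) -> a + c <= 2 / 3 ->
   z * a + z * c <= 4 / 3 * (y1 ^+ 2 + y2 ^+ 2).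
  move=> z0 zle ac; rewrite -mulrDr; apply: le_trans (ler_wpM2l z0 ac) _; lra.
have := sqr_ge0 (y1 - y2); have := sqr_ge0 (y1 + y2).
case: s1 s2 same => [] [] same; rewrite ?expr1 ?expr0 ?mulN1r ?mul1r => pp mm.
- have -> : (- y1 - y2) ^+ 2 = (- y2 - y1) ^+ 2 by ring.
  by apply: same_le; [exact: sqr_ge0 | lra | exact: same].
- by apply: main; [exact: sqr_ge0 | exact: sqr_ge0 | ring].
- by apply: main; [exact: sqr_ge0 | exact: sqr_ge0 | ring].
have -> : (y1 - y2) ^+ 2 = (y2 - y1) ^+ 2 by ring.
by apply: same_le; [exact: sqr_ge0 | lra | exact: same].
Qed.

(** The surplus of the two pendant edges must cover the deficit of the cycle. If [g] is odd the two
    arcs have different parities; otherwise the bound 1/d + 1/(g - d) <= 2/3 is needed, which is the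
    stated inequality on [g] and [d]. *)
Lemma count_cycle2 (G : sgraph) (vs : seq G) (g d : nat) (b : R) :
    enumerates vs -> size vs = (g + 2)%N ->
    adj_table (@adj G) vs = cycle2_table g d false ->
    (1 < d)%N -> (d + d <= g)%N -> odd g || (3 * g <= 2 * (d * (g - d)))%N ->
    #|G|%:R <= b ->
  (2 <= laplacian_count G 4 b)%N.
Proof.
move=> enum_vs sz TE d1 dg odd_or Gb; have [uvs avs] := enum_vs.
have v0 : G by case: vs sz {uvs avs TE enum_vs} => [|v _ _]; [rewrite addn2 | exact: v].
have d0 : (0 < d)%N by apply: ltnW.
have dltg : (d < g)%N by move: d1 dg; clear; lia.
have gd0 : (0 < g - d)%N by rewrite subn_gt0.
have g0 : (0 < g)%N by apply: leq_trans d0 _; apply: ltnW.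
have d_le_g := ltnW dltg.
pose H y1 y2 i := if (i < d)%N then ramp d y1 y2 i else ramp (g - d) y2 y1 (i - d).
(* A pendant value s y at a vertex of value y has surplus ((1 - s)^2 - 4 s^2) y^2 over level 4,
   which is largest, namely 4/3 y^2, at s = -1/3. *)
pose F y1 y2 i := if (i < g)%N then H y1 y2 i else if i == g then - y1 / 3 else - y2 / 3.
apply: (@count_ge2_enum G vs (fun j i => if j == ord0 then F 1 0 i else F 0 1 i) 0%N d) => //.
- by rewrite sz addn2.
- by rewrite sz; apply: leq_trans dltg (leq_addr _ _).
- by rewrite /F g0 /H d0 ramp0.
- by rewrite /F dltg /H ltnn subnn ramp0.
- by rewrite /= /F g0 /H d0 ramp0.
- by rewrite /= /F dltg /H ltnn subnn ramp0.
move=> y1 y2 h hE.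
have {}hE i : h i = F y1 y2 i.
  rewrite hE /= /F /H /ramp; case: ifP => _; last by case: ifP => _; field.
  by case: ifP => _; ring.
have Hlow i : (i <= d)%N -> H y1 y2 i = ramp d y1 y2 i.
  rewrite leq_eqVlt => /orP[/eqP->|id]; last by rewrite /H id.
  by rewrite /H ltnn subnn ramp0 rampl.
have Hhigh i : (d <= i)%N -> H y1 y2 i = ramp (g - d) y2 y1 (i - d).
  by move=> di; rewrite /H ltnNge di.
have H0 : H y1 y2 0 = y1 by rewrite Hlow // ramp0.
have Hd : H y1 y2 d = y2 by rewrite Hhigh // subnn ramp0.
have Hg : H y1 y2 g = y1 by rewrite Hhigh ?rampl.
have hH i : (i < g)%N -> h i = H y1 y2 i by move=> ig; rewrite hE /F ig.
pose E := [seq (i, i.+1) | i <- iota 0 g.-1] ++ [:: (0%N, g.-1); (0%N, g); (d, g.+1)].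
have g3 : (3 < g)%N by apply: leq_trans dg; apply: (leq_add d1 d1).
have uE : uniq E.
  rewrite cat_uniq map_inj_uniq ?iota_uniq /=; last by move=> i j [].
  rewrite !inE !xpair_eqE; apply/andP; split.
    by rewrite !negb_or; apply/and4P; split => //; apply/negP => E_in; have [i i_in] := mapP E_in;
      move: i_in; rewrite mem_iota add0n => /andP[_ ig] []; move: ig g3 d1 d_le_g; clear; lia.
  by move: g3 d0; clear; lia.
have edge := nat_table_adj v0 TE.
have EP i j : (i, j) \in E -> [/\ (i < j)%N, (j < size vs)%N & adj (nth v0 vs i) (nth v0 vs j)].
  suff h' : (i, j) \in E -> [/\ (i < j)%N, (j < size vs)%N & cycle2_adj g d false i j].
    by move=> /h'[ij js r]; split=> //; rewrite edge.
  rewrite mem_cat sz => /orP[/mapP[k]|].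
    rewrite mem_iota add0n => /andP[_ kg] [-> ->].
    have kg' : (k.+1 < g)%N by move: kg g0; clear; lia.
    by split=> //; [apply: leq_trans kg' (leq_addr _ _) | rewrite /cycle2_adj kg' /cycle_adj eqxx].
  rewrite !inE !xpair_eqE => /or3P[] /andP[/eqP-> /eqP->].
  - have gp : (g.-1 < g)%N by rewrite ltn_predL.
    split; [by move: g3; clear; lia | exact: leq_trans gp (leq_addr _ _) |].
    by rewrite /cycle2_adj gp /cycle_adj !eqxx orbT.
  - by split=> //; [rewrite addn2 | rewrite /cycle2_adj ltnn g0 !eqxx].
  - split; [exact: leqW | by rewrite addn2 |].
    by rewrite /cycle2_adj ltnNge leqnSn /= dltg gtn_eqF ?ltnSn // eqxx.
apply: le_trans (energy_ge h (@adj_sym G) uvs uE EP).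
have sumE : \sum_(p <- E) (h p.1 - h p.2) ^+ 2 =
    \sum_(0 <= i < g) (H y1 y2 i - H y1 y2 i.+1) ^+ 2 + (y1 + y1 / 3) ^+ 2 + (y2 + y2 / 3) ^+ 2.
  rewrite big_cat big_map /= !big_cons big_nil /= addr0.
  have -> : h 0%N = y1 by rewrite hH.
  have -> : h d = y2 by rewrite hH.
  have -> : h g = - y1 / 3 by rewrite hE /F ltnn eqxx.
  have -> : h g.+1 = - y2 / 3 by rewrite hE /F ltnNge leqnSn /= gtn_eqF.
  have -> : h g.-1 = H y1 y2 g.-1 by rewrite hH // ltn_predL.
  have -> : \sum_(0 <= i < g) (H y1 y2 i - H y1 y2 i.+1) ^+ 2 =
     \sum_(0 <= i < g.-1) (H y1 y2 i - H y1 y2 i.+1) ^+ 2 + (H y1 y2 g.-1 - y1) ^+ 2.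
    by rewrite -{1}(prednK g0) big_nat_recr //= prednK // Hg.
  have -> : \sum_(i <- iota 0 g.-1) (h i - h i.+1) ^+ 2 =
     \sum_(0 <= i < g.-1) (H y1 y2 i - H y1 y2 i.+1) ^+ 2.
    rewrite /index_iota subn0; apply: eq_big_seq => i; rewrite mem_iota add0n => /andP[_ ig].
    by rewrite !hH //; move: ig g0; clear; lia.
  by rewrite mulNr !opprK -[(y1 - H _ _ _) ^+ 2]sqrrN opprB mulNr opprK; ring.
have normE : \sum_v h (index v vs) ^+ 2 =
    \sum_(0 <= i < g) H y1 y2 i ^+ 2 + (y1 / 3) ^+ 2 + (y2 / 3) ^+ 2.
  have -> : \sum_v h (index v vs) ^+ 2 = \sum_(v <- vs) h (index v vs) ^+ 2.
    by rewrite [LHS](perm_big vs) //; apply: uniq_perm => // [|v]; rewrite ?index_enum_uniq // mem_index_enum avs.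
  have -> : \sum_(v <- vs) h (index v vs) ^+ 2 = \sum_(0 <= i < g + 2) h i ^+ 2.
    by rewrite (big_nth v0) -sz; apply: eq_big_nat => i /andP[_ iv]; rewrite index_uniq.
  rewrite addn2 !big_nat_recr //=.
  have -> : h g = - y1 / 3 by rewrite hE /F ltnn eqxx.
  have -> : h g.+1 = - y2 / 3 by rewrite hE /F ltnNge leqnSn /= gtn_eqF.
  rewrite !mulNr !sqrrN; congr (_ + _ + _).
  by apply: eq_big_nat => i /andP[_ ig]; rewrite hH.
rewrite sumE normE sum_cyclic_shift ?Hg ?H0 //.
have -> : \sum_(0 <= i < g) (H y1 y2 i + H y1 y2 i.+1) ^+ 2 =
   ((-1) ^+ d * y2 - y1) ^+ 2 / d%:R + ((-1) ^+ (g - d) * y1 - y2) ^+ 2 / (g - d)%:R.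
  rewrite (big_cat_nat (leq0n d) d_le_g) /=; congr (_ + _).
    rewrite -sum_ramp //; apply: eq_big_nat => i /andP[_ id].
    by rewrite !Hlow // ltnW.
  rewrite -sum_ramp // -{1}[d]add0n big_addn; apply: eq_big_nat => i _.
  by rewrite !Hhigh ?leq_addl // ?addnK -?addSn ?addnK ?leq_addl.
have dR : (0 : R) < d%:R by rewrite ltr0n.
have gR : (0 : R) < (g - d)%:R by rewrite ltr0n.
have := @two_ramps_le (d%:R^-1) ((g - d)%:R^-1) y1 y2 (odd d) (odd (g - d)).
rewrite !signr_odd => /(_ _ _ _ _)/= lem.
have {}lem : ((-1) ^+ d * y2 - y1) ^+ 2 / d%:R + ((-1) ^+ (g - d) * y1 - y2) ^+ 2 / (g - d)%:R <=
    4 / 3 * (y1 ^+ 2 + y2 ^+ 2).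
  apply: lem.
  - by rewrite invr_ge0 ltW.
  - by rewrite lef_pV2 // ler_nat; move: dg; clear; lia.
  - by rewrite mul1r lef_pV2 // ?posrE ?ltr0n // ler_nat.
  move=> same; have {}odd_or : (3 * g <= 2 * (d * (g - d)))%N.
    case/orP: odd_or => // og; move: og; rewrite -{1}(subnKC d_le_g) oddD same addbb.
    by [].
  have -> : d%:R^-1 + (g - d)%:R^-1 = g%:R / (d%:R * (g - d)%:R) :> R.
    have -> : g%:R = d%:R + (g - d)%:R :> R by rewrite -natrD subnKC.
    by field; rewrite !gt_eqF.
  rewrite ler_pdivrMr ?mulr_gt0 //.
  have : (3 * g)%:R <= (2 * (d * (g - d)))%:R :> R by rewrite ler_nat.
  rewrite !natrM; lra.
move: lem; set S := _ + _; set T := \sum_(0 <= i < g) _; lra.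
Qed.

End LowerBounds.

(** * From connectedness and girth to a normalized cycle configuration *)

Section GraphConfig.
Local Open Scope nat_scope.

Lemma girth_config (G : sgraph) g : has_girth G g -> 4 <= g ->
  exists2 cs : seq G, size cs = g & cycle_config (@adj G) cs (~: [set x in cs]).
Proof.
move=> [[cs [sz uc] <-] min] g4; exists cs => //; split => //.
- exact: adj_sym.
- exact: adj_irrefl.
- by move=> c uc' c2; apply: min; split.
- by move=> v; rewrite !inE.
- by move=> u v _; rewrite !inE orbN.
Qed.

Lemma card_complement (T : finType) (cs : seq T) : uniq cs ->
  #|~: [set x in cs]| = #|T| - size cs.
Proof. by move=> ucs; rewrite cardsCs setCK cardsE (card_uniqP ucs). Qed.

(** Otherwise the vertex set of the cycle would be closed under adjacency. *)
Lemma connected_crossing (G : sgraph) (cs : seq G) a u :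
    (forall x y : G, connect (@adj G) x y) -> a \in cs -> u \notin cs ->
  exists u a, [/\ u \in ~: [set x in cs], a \in cs & adj u a].
Proof.
move=> conn acs ucs.
case: (boolP [exists p : G * G, [&& p.1 \notin cs, p.2 \in cs & adj p.1 p.2]]) => [|no].
  by move=> /existsP[[v b] /and3P[vcs bcs evb]]; exists v, b; rewrite !inE.
have cl : closed (@adj G) [set x in cs].
  move=> x y xy; move/existsPn: no => no; rewrite !inE.
  case xcs: (x \in cs); case ycs: (y \in cs) => //.
    by have := no (y, x); rewrite /= xcs ycs adj_sym xy.
  by have := no (x, y); rewrite /= xcs ycs xy.
by have := closed_connect cl (conn a u); rewrite !inE acs (negPf ucs).
Qed.

Lemma config_eq (V : finType) (e : rel V) cs cs' K : cycle_config e cs K ->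
  ucycle e cs' -> cs' =i cs -> cycle_config e cs' K.
Proof.
move=> cfg uc' eq_cs.
have sz : size cs' = size cs.
  apply/eqP; rewrite -(uniq_size_uniq (ucycle_uniq (cfg_cycle cfg))) ?(ucycle_uniq uc') //.
split; rewrite ?sz //.
- exact: cfg_sym cfg.
- exact: cfg_irr cfg.
- exact: cfg_size cfg.
- exact: cfg_girth cfg.
- by move=> v; rewrite eq_cs; apply: (cfg_out cfg).
- by move=> u v; rewrite eq_cs; apply: (cfg_supp cfg).
Qed.

Lemma rot_config (V : finType) (e : rel V) cs K a : cycle_config e cs K -> a \in cs ->
  exists t, [/\ cycle_config e (a :: t) K, a :: t =i cs & size (a :: t) = size cs].
Proof.
move=> cfg acs; have [i t tE] := rot_to acs; exists t; rewrite -tE size_rot.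
have eq_cs : rot i cs =i cs by move=> x; rewrite mem_rot.
by split=> //; apply: (config_eq cfg _ eq_cs); rewrite rot_ucycle; apply: (cfg_cycle cfg).
Qed.

(** The traversal is rotated to start at [a] and, if [b] lies beyond the middle, reversed to
    [a :: rev t]. *)
Lemma normalize_config (V : finType) (e : rel V) cs K a b :
    cycle_config e cs K -> a \in cs -> b \in cs -> a != b ->
  exists cs', [/\ cycle_config e cs' K, cs' =i cs, size cs' = size cs,
    index a cs' = 0 & 2 * index b cs' <= size cs'].
Proof.
move=> cfg acs bcs ab; have [t [cfg1 eq1 sz1]] := rot_config cfg acs.
have b1 : b \in a :: t by rewrite eq1.
have [small|large] := leqP (2 * index b (a :: t)) (size (a :: t)).
  by exists (a :: t); split=> //; rewrite /= eqxx.
have /andP[cc uc] := cfg_cycle cfg1.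
have revE : a :: rev t = rotr 1 (rev (a :: t)) by rewrite rev_cons rotr1_rcons.
have ucr : ucycle e (a :: rev t).
  apply/andP; rewrite revE rotr_cycle rotr_uniq rev_uniq uc; split=> //.
  by rewrite rev_cycle (eq_cycle (e' := e)) // => x y; rewrite (cfg_sym cfg1).
have eqr : a :: rev t =i a :: t by move=> x; rewrite !inE mem_rev.
exists (a :: rev t); split.
- exact: config_eq cfg1 ucr eqr.
- by move=> x; rewrite eqr.
- by rewrite -sz1 /= size_rev.
- by rewrite /= eqxx.
have bt : b \in t by move: b1; rewrite inE eq_sym (negPf ab).
have idx : index b (rev t) = size t - (index b t).+1.
  have it : index b t < size t by rewrite index_mem.
  have -> : b = nth a (rev t) (size t - (index b t).+1).
    rewrite nth_rev; last by move: it; clear; lia.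
    by rewrite subnSK // subKn ?nth_index // ltnW.
  rewrite index_uniq ?size_rev ?rev_uniq; last by move: uc => /andP[].
    by rewrite nth_rev ?subnSK ?subKn ?nth_index // ?index_uniq //; move: it; clear; lia.
  by move: it; clear; lia.
have it : index b t < size t by rewrite index_mem.
move: large it; rewrite /= (negPf ab) idx size_rev. move: (index b t) (size t) => i m; clear; lia.
Qed.

End GraphConfig.

(** * Two vertices off the cycle: sharper bounds and the surviving graphs *)

Section TwoVertices.
Variables (R : rcfType) (V : finType).
Implicit Types (e : rel V) (cs : seq V) (K : {set V}).

(** One condition, x = 0 at the only foot; all other degrees are at most two, and connectedness
    gives the strictness. *)
Lemma index_le_single_foot e cs K a :
    cycle_config e cs K -> 4 < size cs -> #|K| = 2 -> a \in cs ->
    (forall x y, connect e x y) ->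
    (forall u c, u \in K -> c \in cs -> e u c -> c = a) ->
  index_le e (4 : R)%R 1.
Proof.
move=> cfg g5 K2 acs conn foot.
apply: (@index_le_mono R V e e 4%R 4%R _ _ _ _ (eq_leq (cards1 a))) => //.
apply: (index_le_degree_two _ (cfg_sym cfg)) => [x|x]; last first.
  by exists a; [apply: conn | rewrite inE eqxx].
rewrite inE => xa; rewrite (degree_split cfg).
case: (boolP (x \in cs)) => [xcs|xcs].
  have -> : degree_in e K x = 0; last by rewrite addn0; exact: (degree_cycle cfg xcs).
  apply/eqP; rewrite cards_eq0; apply/eqP/setP => u; rewrite !inE.
  apply/negP => /andP[uK exu]; rewrite (foot u x uK xcs) ?eqxx // in xa.
  by rewrite (cfg_sym cfg).
case: (boolP (x \in K)) => [xK|xK]; last first.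
  by rewrite -(degree_split cfg) (degree_out cfg).
apply: (@leq_add _ _ 1 1); first exact: (degree_attach cfg g5).
rewrite -ltnS -K2 [in X in _ < X](cardsD1 x K) xK ltnS.
apply: subset_leq_card; apply/subsetP => y; rewrite !inE => /andP[-> exy].
by rewrite andbT; apply: contraTneq exy => ->; rewrite (cfg_irr cfg).
Qed.

(* Removing the edge between the two consecutive feet leaves a path. *)
Lemma index_le_adjacent_feet e a1 a2 t u1 u2 :
    cycle_config e [:: a1, a2 & t] [set u1; u2] -> 4 < size [:: a1, a2 & t] ->
    e u1 a1 -> e u2 a2 -> ~~ e u1 u2 ->
  index_le e (4 : R)%R 1.
Proof.
set cs := [:: a1, a2 & t] => cfg g5 ua1 ua2 u12.
have e_sym := cfg_sym cfg.
have a1cs : a1 \in cs by rewrite !inE eqxx.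
have a2cs : a2 \in cs by rewrite !inE eqxx orbT.
have K1 : u1 \in [set u1; u2] by rewrite !inE eqxx.
have K2 : u2 \in [set u1; u2] by rewrite !inE eqxx orbT.
have nE : next cs a1 = a2 by rewrite /cs /= eqxx.
pose E := [:: (a1, a2)]; pose e' := delete_edges e E.
have e'_sym : symmetric e' := delete_edges_sym E e_sym.
have e'E x y : e' x y = [&& e x y, (x, y) != (a1, a2) & (y, x) != (a1, a2)].
  by rewrite /e' /delete_edges !inE.
(* The only condition is equality of x at [a1] and [a2]; what remains needs none, since it has a
   vertex of degree one. *)
apply: (@index_le_delete_edges R V e E 4%R 0).
apply: (@index_le_mono R V e' e' 4%R 4%R _ _ _ _ (eq_leq (cards0 V))) => //.
have footE u c : u \in [set u1; u2] -> c \in cs -> e u c -> (u == u1) && (c == a1) || (u == u2) && (c == a2).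
  move=> uK ccs euc; move: (uK); rewrite !inE => /orP[]/eqP uE; subst u; rewrite eqxx /=.
    by rewrite (attach_uniq cfg g5 K1 ccs a1cs euc ua1) eqxx.
  by rewrite (attach_uniq cfg g5 K2 ccs a2cs euc ua2) eqxx orbT.
have deg_u u : u \in [set u1; u2] -> degree e u <= 1.
  move=> uK; rewrite (degree_split cfg).
  have -> : degree_in e [set u1; u2] u = 0; last by rewrite addn0; exact: (degree_attach cfg g5).
  apply/eqP; rewrite cards_eq0; apply/eqP/setP => y; rewrite !inE.
  apply/negP; move: uK; rewrite !inE => /orP[]/eqP-> /andP[/orP[]/eqP->];
    by rewrite ?(cfg_irr cfg) ?(negPf u12) // e_sym (negPf u12).
apply: (index_le_degree_two _ e'_sym) => [x _|x].
  case: (boolP (x \in cs)) => [xcs|xcs]; last first.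
    case: (boolP (x \in [set u1; u2])) => [xK|xK].
      by apply: leq_trans (degree_delete_edges _ _ _) _; apply: leqW; apply: deg_u.
    by apply: leq_trans (degree_delete_edges _ _ _) _; rewrite (degree_out cfg).
  have [x1|x1] := eqVneq x a1.
    apply: (@leq_trans #|[set prev cs a1; u1]|); last by rewrite cards2; case: (_ != _).
    apply: subset_leq_card; apply/subsetP => y; rewrite !inE e'E x1 => /and3P[ey n1 n2].
    have /orP[ycs|yK] := supp_sym cfg ey.
      case: (cycle_chord cfg a1cs ycs ey) => yE; last by rewrite yE eqxx.
      by move: n1; rewrite yE nE eqxx.
    have := footE y a1 yK a1cs; rewrite e_sym ey => /(_ isT)/orP[]/andP[yE]; first by rewrite yE orbT.
    by move=> /eqP a12; move: n1; case/andP: (cfg_cycle cfg) => _ /=; rewrite inE a12 eqxx.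
  have [x2|x2] := eqVneq x a2.
    apply: (@leq_trans #|[set next cs a2; u2]|); last by rewrite cards2; case: (_ != _).
    apply: subset_leq_card; apply/subsetP => y; rewrite !inE e'E x2 => /and3P[ey n1 n2].
    have /orP[ycs|yK] := supp_sym cfg ey.
      case: (cycle_chord cfg a2cs ycs ey) => yE; first by rewrite yE eqxx.
      by move: n2; rewrite yE -nE prev_next ?eqxx // (ucycle_uniq (cfg_cycle cfg)).
    have := footE y a2 yK a2cs; rewrite e_sym ey => /(_ isT)/orP[]/andP[yE]; last by rewrite yE orbT.
    by move=> /eqP a12; move: n1; case/andP: (cfg_cycle cfg) => _ /=; rewrite inE a12 eqxx.
  apply: leq_trans (degree_cycle cfg xcs); apply: degree_sub => y.
  rewrite e'E inE => /andP[exy _]; rewrite exy /=; have /orP[//|yK] := supp_sym cfg exy.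
  by have := footE y x yK xcs; rewrite e_sym exy (negPf x1) (negPf x2) !andbF => /(_ isT).
case: (boolP (x \in cs)) => [xcs|xcs]; last first.
  exists x => //; rewrite inE /=.
  case: (boolP (x \in [set u1; u2])) => [xK|xK].
    by apply: leq_trans (degree_delete_edges _ _ _) _; apply: deg_u.
  by apply: leq_trans (degree_delete_edges _ _ _) _; rewrite (degree_out cfg).
exists u1; last by rewrite inE /=; apply: leq_trans (degree_delete_edges _ _ _) _; apply: deg_u.
have [a3 [t' tE]] : exists a3 t', t = a3 :: t'.
  by move: g5; rewrite /cs; case: (t) => [|a3 t'] // _; exists a3, t'.
have csE : cs = [:: a1, a2, a3 & t'] by rewrite /cs tE.
have /andP[cc uc] := cfg_cycle cfg.
have uc' : uniq [:: a1, a2, a3 & t'] by rewrite -csE.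
have paths : [/\ e a2 a3 & path e a3 (rcons t' a1)].
  by move: cc; rewrite csE /= => /and3P[_ -> ->].
have [e23 p3] := paths.
have ne : [/\ a1 != a2, a1 != a3 & a2 != a3].
  by move: uc'; rewrite /= !inE !negb_or => /and3P[/and3P[-> -> _] /andP[-> _] _].
have [a12 a13 a23] := ne.
(* The cycle from [a3] on to [a1] avoids [a2], hence the removed edge; with the edge from [a2] to
   [a3] it still connects all cycle vertices. *)
have p3' : path e' a3 (rcons t' a1).
  apply: (@sub_in_path _ (predC1 a2) e e') p3 => [y z|].
    rewrite !inE => y2 z2 eyz; rewrite e'E eyz !xpair_eqE negb_and (negPf z2) /= orbT /=.
    by rewrite negb_and (negPf y2) orbT.
  apply/allP => y; rewrite !inE mem_rcons inE => /or3P[/eqP->|/eqP->|yt] //; first by rewrite eq_sym.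
  by apply: contraTneq yt => ->; move: uc' => /and3P[_]; rewrite inE negb_or => /andP[].
have sym' := sym_connect_sym e'_sym.
have c3 y : y \in a3 :: rcons t' a1 -> connect e' a3 y by move: y; apply: path_connect.
have c23 : connect e' a3 a2.
  by rewrite sym'; apply: connect1; rewrite e'E e23 !xpair_eqE [a2 == a1]eq_sym (negPf a12) [a3 == a1]eq_sym (negPf a13).
have c_all y : y \in cs -> connect e' a3 y.
  rewrite csE !inE => /or4P[/eqP->|/eqP->|/eqP->|yt] //.
  - by apply: c3; rewrite inE mem_rcons mem_head orbT.
  - by apply: c3; rewrite inE mem_rcons inE yt !orbT.
apply: connect_trans (_ : connect e' x a1) _.
  by rewrite sym'; apply: connect_trans (c_all x xcs); rewrite sym'; apply: c_all.
apply: connect1; rewrite e'E e_sym ua1 !xpair_eqE /=.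
have n1 : u1 != a1 by apply: contraTneq a1cs => <-; apply: (cfg_out cfg).
have n2 : u1 != a2 by apply: contraTneq a2cs => <-; apply: (cfg_out cfg).
by rewrite (negPf n1) (negPf n2) andbF.
Qed.

End TwoVertices.

Lemma next_nth_cycle (T : eqType) (cs : seq T) x0 i : uniq cs -> i < size cs ->
  next cs (nth x0 cs i) = nth x0 cs (if i.+1 < size cs then i.+1 else 0).
Proof.
move=> ucs ics; rewrite next_nth mem_nth // index_uniq //.
case: cs ucs ics => // y p _ ics; case: ifP => [ip|/negbT]; last by rewrite -leqNgt => ip; rewrite nth_default.
exact: set_nth_default.
Qed.

Section Tables.
Variables (V : finType).
Implicit Types (e : rel V) (cs : seq V) (K : {set V}).

Lemma cycle_config_adj e cs K v0 i j : cycle_config e cs K -> i < j -> j < size cs ->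
  e (nth v0 cs i) (nth v0 cs j) = cycle_adj (size cs) i j.
Proof.
move=> cfg ij js; have /andP[cc uc] := cfg_cycle cfg.
have is_ : i < size cs := ltn_trans ij js.
have nE k := @next_nth_cycle _ cs v0 k uc.
have nthcs k : k < size cs -> nth v0 cs k \in cs by apply: mem_nth.
have eqn k l : k < size cs -> l < size cs -> (nth v0 cs k == nth v0 cs l) = (k == l).
  by move=> ks ls; rewrite nth_uniq.
apply/idP/idP => [eij|].
  have [jE|jE] := cycle_chord cfg (nthcs i is_) (nthcs j js) eij.
    have i1 : i.+1 < size cs := leq_ltn_trans ij js.
    by move/eqP: jE; rewrite nE // i1 eqn // /cycle_adj => ->.
  have /eqP : nth v0 cs i = next cs (nth v0 cs j) by rewrite jE next_prev.
  rewrite nE // eqn //; last by case: ifP => // _; apply: leq_ltn_trans js.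
  rewrite /cycle_adj; case: ifP => [_ /eqP iE|jl /eqP->].
    by move: ij; rewrite iE ltnNge leqW.
  by rewrite eqxx orbC; move: js jl; move: (size cs) => m; clear; lia.
have succ k : k < size cs -> e (nth v0 cs k) (nth v0 cs (if k.+1 < size cs then k.+1 else 0)).
  by move=> ks; rewrite -nE //; apply: (next_cycle cc); apply: nthcs.
case/orP => [/eqP jE|/andP[/eqP i0 /eqP jE]].
  by have := succ i is_; rewrite -jE js.
have s0 : 0 < size cs by apply: leq_ltn_trans js.
by have := succ j js; rewrite jE i0 (prednK s0) ltnn (cfg_sym cfg).
Qed.

Lemma cycle2_config_table e cs K u1 u2 a1 a2 :
    cycle_config e cs K -> 4 < size cs -> u1 \in K -> u2 \in K ->
    a1 \in cs -> a2 \in cs -> index a1 cs = 0 -> e u1 a1 -> e u2 a2 ->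
  adj_table e (cs ++ [:: u1; u2]) = cycle2_table (size cs) (index a2 cs) (e u1 u2).
Proof.
move=> cfg g5 u1K u2K a1cs a2cs i0 ua1 ua2.
have sz : size (cs ++ [:: u1; u2]) = size cs + 2 by rewrite size_cat.
rewrite /cycle2_table -sz; apply: (adj_table_nat (v0 := a1)) => i j ij; rewrite sz => js.
have foot u a k : u \in K -> a \in cs -> e u a -> k < size cs -> e (nth a1 cs k) u = (k == index a cs).
  move=> uK acs ua ks; rewrite (cfg_sym cfg); apply/idP/eqP => [uk|->]; last by rewrite nth_index.
  rewrite (attach_uniq cfg g5 uK acs (mem_nth _ ks) ua uk) index_uniq //.
  exact: (ucycle_uniq (cfg_cycle cfg)).
rewrite /cycle2_adj !nth_cat; case: (ltnP j (size cs)) => [jcs|jcs].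
  by rewrite (ltn_trans ij jcs) (cycle_config_adj _ cfg).
case: (ltnP i (size cs)) => [ics|ics].
  have [jE|jN] := eqVneq j (size cs); first by rewrite jE subnn /= (foot u1 a1) ?i0.
  have -> : j - size cs = 1 by move: jcs js jN; move: (size cs) => m; clear; lia.
  by rewrite /= (foot u2 a2).
have [-> ->] : i = size cs /\ j = (size cs).+1.
  by move: ij ics js; move: (size cs) => m; clear; lia.
by rewrite subSnn subnn.
Qed.

Lemma cycle1_config_table e cs K u a :
    cycle_config e cs K -> u \in K -> index a cs = 0 -> a \in cs ->
    (forall b, b \in cs -> e u b = (b == a)) ->
  adj_table e (rcons cs u) = cycle1_table (size cs).
Proof.
move=> cfg uK i0 acs foot.
have sz : size (rcons cs u) = size cs + 1 by rewrite size_rcons addn1.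
rewrite /cycle1_table -sz; apply: (adj_table_nat (v0 := a)) => i j ij; rewrite sz => js.
have ics : i < size cs by move: ij js; move: (size cs) => m; clear; lia.
rewrite /cycle1_adj !nth_rcons ics; case: (ltnP j (size cs)) => [jcs|jcs].
  by rewrite (cycle_config_adj _ cfg).
have -> : j == size cs by move: jcs js; move: (size cs) => m; clear; lia.
rewrite (cfg_sym cfg) foot ?mem_nth // -{2}(nth_index a acs) i0 nth_uniq //.
  by apply: leq_ltn_trans ics.
exact: (ucycle_uniq (cfg_cycle cfg)).
Qed.

Lemma config_enum e cs K u1 u2 : cycle_config e cs K -> (forall v, (v \in cs) || (v \in K)) ->
  u1 != u2 -> K = [set u1; u2] -> enumerates (cs ++ [:: u1; u2]).
Proof.
move=> cfg cover u12 KE; split.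
  rewrite cat_uniq (ucycle_uniq (cfg_cycle cfg)) /= inE u12 orbF andbT negb_or.
  by rewrite !(cfg_out cfg) // KE !inE eqxx ?orbT.
by move=> v; rewrite mem_cat !inE; move: (cover v); rewrite KE !inE.
Qed.

(** One condition is enough if there are fewer than two feet, or if they are consecutive and [u1],
    [u2] are not adjacent. Otherwise the graph is determined by [g], the distance [d] of the feet
    and the adjacency of [u1] and [u2]. *)
Lemma two_vertex_table (R : rcfType) e cs K : cycle_config e cs K -> 4 < size cs ->
    #|K| = 2 -> (forall v, (v \in cs) || (v \in K)) -> (forall x y, connect e x y) ->
    index_le e (4 : R)%R 1 \/
    exists (vs : seq V) (d : nat) ad,
      [/\ enumerates vs, size vs = size cs + 2, adj_table e vs = cycle2_table (size cs) d ad,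
          (1 < d) && (2 * d <= size cs) &
          ad -> (size cs = 5 /\ d = 2) \/ (size cs = 6 /\ d = 3)].
Proof.
move=> cfg g5 K2 cover conn.
have /eqP/cards2P[u1 [u2 [u12 KE]]] := K2.
have u1K : u1 \in K by rewrite KE !inE eqxx.
have u2K : u2 \in K by rewrite KE !inE eqxx orbT.
have [foot [foot_cs footP]] := exists_foot cfg g5.
have single a : a \in cs -> (forall u c, u \in K -> c \in cs -> e u c -> c = a) ->
  index_le e (4 : R)%R 1 by move=> acs; apply: (index_le_single_foot R cfg g5 K2 acs conn).
have KP u : u \in K -> u = u1 \/ u = u2 by rewrite KE !inE => /orP[]/eqP; [left|right].
have nofoot u : u \in K -> ~~ e u (foot u) -> forall c, c \in cs -> ~~ e u c.
  by move=> uK nf c ccs; apply: contraNN nf => uc; rewrite -(footP u c).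
case: (boolP (e u1 (foot u1))) => [ua1|nf]; last first.
  left; apply: (single (foot u2)) => // u c /KP[]-> ccs uc.
    by have := nofoot _ u1K nf c ccs; rewrite uc.
  exact: footP.
case: (boolP (e u2 (foot u2))) => [ua2|nf]; last first.
  left; apply: (single (foot u1)) => // u c /KP[]-> ccs uc; first exact: footP.
  by have := nofoot _ u2K nf c ccs; rewrite uc.
have [eqf|a12] := eqVneq (foot u1) (foot u2).
  left; apply: (single (foot u1)) => // u c /KP[]-> ccs uc; first exact: footP.
  by rewrite eqf; apply: footP.
have [cs' [cfg' eq_cs sz i1 half]] := normalize_config cfg (foot_cs u1) (foot_cs u2) a12.
have cover' v : (v \in cs') || (v \in K) by rewrite eq_cs.
have a1 : foot u1 \in cs' by rewrite eq_cs.
have a2 : foot u2 \in cs' by rewrite eq_cs.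
have g5' : 4 < size cs' by rewrite sz.
rewrite -sz.
have d0 : 0 < index (foot u2) cs'.
  rewrite lt0n; apply: contra_neq a12 => i2.
  by rewrite -(nth_index (foot u1) a1) i1 -i2 nth_index.
case: (boolP (e u1 u2)) => [eu|neu].
  right; exists (cs' ++ [:: u1; u2]), (index (foot u2) cs'), (e u1 u2).
  (* An ear with two interior vertices: g <= d + 3 and d <= 3, so with g >= 5 and 2 d <= g only (5,
     2) and (6, 3) remain for (g, d). *)
  have eE : ear e cs' [:: u1; u2] (foot u1) (foot u2).
    rewrite /ear /= inE u12 (cfg_out cfg' u1K) (cfg_out cfg' u2K) eu ua2 (cfg_sym cfg') ua1.
    by [].
  have := ear_gap cfg' a1 a2 eE isT; rewrite /gap i1 sub0n subn0 add0n /=.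
  move=> [h1 h2].
  split.
  - exact: config_enum cfg' cover' u12 KE.
  - by rewrite size_cat.
  - exact: (cycle2_config_table cfg' g5' u1K u2K a1 a2 i1 ua1 ua2).
  - rewrite half andbT; move: h1 h2 d0 half g5'; move: (size cs') (index _ _) => m d; clear; lia.
  by move=> _; move: h1 h2 half g5'; move: (size cs') (index _ _) => m d; clear; lia.
have [d1|d1] := leqP (index (foot u2) cs') 1.
  left; have {}d1 : index (foot u2) cs' = 1 by apply/eqP; rewrite eqn_leq d1.
  case: cs' cfg' g5' i1 d1 a1 a2 {eq_cs sz half d0 cover'} => [//|b1 [//|b2 t]] cfg' g5' i1 d1 a1 a2.
  have b1E : b1 = foot u1 by rewrite -(nth_index b1 a1) i1.
  have b2E : b2 = foot u2 by rewrite -(nth_index b1 a2) d1.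
  subst b1 b2; rewrite KE in cfg'; exact: index_le_adjacent_feet cfg' g5' ua1 ua2 neu.
right; exists (cs' ++ [:: u1; u2]), (index (foot u2) cs'), (e u1 u2).
split.
- exact: config_enum cfg' cover' u12 KE.
- by rewrite size_cat.
- exact: (cycle2_config_table cfg' g5' u1K u2K a1 a2 i1 ua1 ua2).
- by rewrite d1.
by rewrite (negPf neu).
Qed.

End Tables.

(** These orders, and those of [K23s], begin with a square and represent all tables so obtained: the
    branch vertices occupy one or the other diagonal, and for [K23s] the last two vertices may also
    be exchanged. *)
Definition K24_orders : seq (seq (complete_bipartite 2 4)) :=
  let x1 := inr ord0 in let x2 := inr (Ordinal (isT : 1 < 4)) in
  let x3 := inr (Ordinal (isT : 2 < 4)) in let x4 := inr ord_max in
  [:: [:: inl ord0; x1; inl ord_max; x2; x3; x4]; [:: x1; inl ord0; x2; inl ord_max; x3; x4]].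

Definition K23s_orders : seq (seq K23s) :=
  let s := @Some K23 in
  [:: [:: s K23_a; s K23_x; s K23_b; s K23_y; s K23_z; None];
      [:: s K23_a; s K23_x; s K23_b; s K23_y; None; s K23_z];
      [:: s K23_x; s K23_a; s K23_y; s K23_b; s K23_z; None];
      [:: s K23_x; s K23_a; s K23_y; s K23_b; None; s K23_z]].

Lemma enum_K24_orders vs : vs \in K24_orders -> enumerates vs /\ size vs = 6.
Proof.
suff p : all (fun vs => perm_eq vs K24_vertices) K24_orders.
  move=> /(allP p) pvs; have [u a] := enum_K24; split; last by rewrite (perm_size pvs).
  by split=> [|v]; rewrite ?(perm_uniq pvs) ?(perm_mem pvs).
by vm_compute.
Qed.

Lemma enum_K23s_orders vs : vs \in K23s_orders -> enumerates vs /\ size vs = 6.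
Proof.
suff p : all (fun vs => perm_eq vs K23s_vertices) K23s_orders.
  move=> /(allP p) pvs; have [u a] := enum_K23s; split; last by rewrite (perm_size pvs).
  by split=> [|v]; rewrite ?(perm_uniq pvs) ?(perm_mem pvs).
by vm_compute.
Qed.

Definition square_exception T :=
  (T \in map (adj_table (@adj (complete_bipartite 2 4))) K24_orders) ||
  (T \in map (adj_table (@adj K23s)) K23s_orders).

Lemma square_index_exception : all_square_tables 2 (fun T =>
  if square_exception T then true else if crossing_table T then table_index 4 4 T <= 1 else true).
Proof. by vm_compute. Qed.

Lemma square_exception_graph (G : sgraph) (vs : seq G) : enumerates vs -> size vs = 6 ->
    square_exception (adj_table (@adj G) vs) ->
  isomorphic G (complete_bipartite 2 4) \/ isomorphic G K23s.
Proof.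
move=> avs sz /orP[] /mapP[ws ws_in TE]; [left | right].
  have [aws szw] := enum_K24_orders ws_in.
  by apply: (isomorphic_table avs aws) TE; rewrite sz.
have [aws szw] := enum_K23s_orders ws_in.
by apply: (isomorphic_table avs aws) TE; rewrite sz.
Qed.

(** This is Y_{8,3}, the reason why only i = 4 is listed for n = 8. It has the eigenvalue 2 + 2
    cos(pi/9), about 3.879, on the vectors changing sign under its reflection, so a slack of 1/8
    would be too coarse. *)
Lemma cycle62_index : table_index 16 4 (cycle2_table 6 2 false) <= 1.
Proof. by vm_compute. Qed.

Section Square.
Variables (R : rcfType) (G : sgraph).

Lemma two_vertex_square (cs : seq G) (K : {set G}) :
    cycle_config (@adj G) cs K -> size cs = 4 ->
    #|K| = 2 -> (forall v, (v \in cs) || (v \in K)) ->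
    (exists u a, [/\ u \in K, a \in cs & adj u a]) ->
    index_le (@adj G) (4 : R)%R 1 \/
    isomorphic G (complete_bipartite 2 4) \/ isomorphic G K23s.
Proof.
move=> cfg sz K2 cover [u [a [uK acs ua]]].
have cT := crossing_config cfg sz uK acs ua.
case exT: (square_exception (adj_table (@adj G) (cs ++ enum K))).
  right; apply: (@square_exception_graph _ (cs ++ enum K)) exT.
    split; first exact: config_uniq cfg.
    by move=> v; rewrite mem_cat mem_enum.
  by rewrite size_cat sz -cardE K2.
left; have sq := square_index_exception; rewrite -K2 in sq.
by apply: (@index_le_square R G 4 (@adj G) cs K 4 1 _ cfg sz sq) => //; rewrite exT cT.
Qed.

Lemma two_vertex_graph (cs : seq G) (K : {set G}) :
    cycle_config (@adj G) cs K ->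
    #|K| = 2 -> (forall v, (v \in cs) || (v \in K)) ->
    (exists u a, [/\ u \in K, a \in cs & adj u a]) ->
    (forall x y : G, connect adj x y) ->
    let n := size cs + 2 in
    index_le (@adj G) (4 : R)%R 1 \/
    [\/ n = 6 /\ (isomorphic G (complete_bipartite 2 4) \/ isomorphic G K23s),
              n = 7 /\ (isomorphic G K23ss \/ isomorphic G (Y_graph 7 3)),
              n = 8 /\ (isomorphic G K23sss \/ isomorphic G (Y_graph 8 4)) |
              (9 <= n) /\
                exists2 i : nat, (3 <= i <= uphalf (n - 1)) &
                  isomorphic G (Y_graph n i)].
Proof.
move=> cfg K2 cover cross conn n.
have := cfg_size cfg; rewrite leq_eqVlt => /orP[/eqP g4|g5].
  have [|iso] := two_vertex_square cfg (esym g4) K2 cover cross; first by left.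
  by right; constructor 1; rewrite /n -g4.
have [|[vs [d [ad [avs sz TE /andP[d1 dg] adP]]]]] := two_vertex_table R cfg g5 K2 cover conn.
  by left.
have v0 : 0 < size vs by rewrite sz addn2.
case: ad TE adP => [TE /(_ isT)[] [gE dE]|TE _].
- right; constructor 2; rewrite /n gE; split=> //; left.
  apply: (isomorphic_table avs enum_K23ss v0); first by rewrite sz gE.
  by rewrite TE gE dE table_K23ss.
- right; constructor 3; rewrite /n gE; split=> //; left.
  apply: (isomorphic_table avs enum_K23sss v0); first by rewrite sz gE.
  by rewrite TE gE dE table_K23sss.
have isoY : isomorphic G (Y_graph n d.+1).
  have nE : n - 2 = size cs by rewrite /n addnK.
  have sY : size (Y_vertices n d.+1) = size cs + 2.
    by rewrite !size_rcons size_map size_enum_ord nE addn2.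
  apply: (isomorphic_table avs (enum_Y n d.+1) v0); first by rewrite sY.
  rewrite TE table_Y ?nE ?subn1 //.
  - by rewrite /n; move: g5; move: (size cs) => m; clear; lia.
  - by move: d1 dg; move: (size cs) => m; clear; lia.
  - exact: ltnW.
have [g6|g6] := eqVneq (size cs) 6.
  have [d2|d2] := eqVneq d 2.
    left; have [uvs cvs] := avs.
    apply: (@index_le_table R G 16 (@adj G) vs 4 1) => //; try exact: adj_sym; try exact: adj_irrefl.
    by rewrite TE g6 d2; exact: cycle62_index.
  right; constructor 3; rewrite /n g6; split=> //; right.
  have d3 : d = 3 by move: dg; rewrite g6; move: d1 d2; clear; lia.
  by move: isoY; rewrite d3 /n g6.
have [g5'|g5'] := eqVneq (size cs) 5.
  right; constructor 2; rewrite /n g5'; split=> //; right.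
  have d2 : d = 2 by move: dg; rewrite g5'; move: d1; clear; lia.
  by move: isoY; rewrite d2 /n g5'.
right; constructor 4; split.
  by rewrite /n; move: g5 g5' g6; move: (size cs) => m; clear; lia.
exists d.+1 => //; rewrite /n; move: d1 dg; move: (size cs) => m; clear; lia.
Qed.

End Square.

(** * Girth of the graphs in the list *)

Definition sym_nat (r : rel nat) : rel nat := fun i j =>
  if i < j then r i j else if j < i then r j i else false.

Lemma sym_natC r : symmetric (sym_nat r).
Proof. by move=> i j; rewrite /sym_nat; case: ltngtP. Qed.

Lemma adj_index (G : sgraph) (vs : seq G) r : enumerates vs ->
  adj_table (@adj G) vs = nat_table (size vs) r ->
  forall x y, adj x y = sym_nat r (index x vs) (index y vs).
Proof.
move=> [uvs avs] TE x y; have edge := nat_table_adj x TE.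
have lt z : index z vs < size vs by rewrite index_mem.
rewrite /sym_nat; case: ltngtP => [xy|yx|xy].
- by rewrite -edge // !nth_index.
- by rewrite -edge // !nth_index // adj_sym.
by rewrite -(nth_index x (avs x)) xy nth_index // adj_irrefl.
Qed.

Lemma index_cycle (G : sgraph) (vs : seq G) r c : enumerates vs ->
    adj_table (@adj G) vs = nat_table (size vs) r -> ucycle (@adj G) c ->
  ucycle (sym_nat r) (map (index^~ vs) c) /\ all (ltn^~ (size vs)) (map (index^~ vs) c).
Proof.
move=> avs TE /andP[cc uc]; have adjE := adj_index avs TE; split.
  apply/andP; split.
    by rewrite cycle_map (eq_cycle (e' := @adj G)) // => x y; rewrite /= -adjE.
  rewrite map_inj_in_uniq // => x y _ _ xy.
  by rewrite -(nth_index x (avs.2 x)) xy nth_index ?avs.2.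
by apply/allP => _ /mapP[x _ ->]; rewrite /= index_mem avs.2.
Qed.

Lemma next_neq_prev (T : eqType) (c : seq T) i : uniq c -> 2 < size c -> i \in c ->
  next c i != prev c i.
Proof.
move=> uc c2 ic; have [k t tE] := rot_to ic.
have : uniq (i :: t) by rewrite -tE rot_uniq.
have : 2 < size (i :: t) by rewrite -tE size_rot.
move=> sz; apply: contraTneq => E; have : next c (next c i) = i by rewrite E next_prev.
rewrite -!(next_rot k uc) tE; case: t {tE} sz => [|x [|y t]] // _.
rewrite /= eqxx; case: eqVneq => [-> _|xi]; first by rewrite inE eqxx.
by rewrite eqxx => ->; rewrite !inE eqxx orbT.
Qed.

(* A vertex of a cycle has two neighbours on it, so a cycle avoids the pendant
   vertices and contains the successors of its vertices on the long cycle. *)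
Lemma cycle_table_girth (r : rel nat) g m c : 2 < g ->
    (forall i j, i < j -> j < g -> r i j -> cycle_adj g i j) ->
    (forall j, g <= j < m -> exists i, forall k, k < m -> sym_nat r j k -> k = i) ->
    ucycle (sym_nat r) c -> all (ltn^~ m) c -> 2 < size c ->
  g <= size c.
Proof.
move=> g2 on_cycle pend /andP[cc uc] cm c2.
have nc i : i \in c -> sym_nat r i (next c i) by apply: next_cycle.
have pc i : i \in c -> sym_nat r i (prev c i).
  by move=> ic; rewrite sym_natC; apply: prev_cycle.
have np i : i \in c -> next c i != prev c i by apply: next_neq_prev.
have small i : i \in c -> i < g.
  move=> ic; rewrite ltnNge; apply/negP => gi.
  have [|k uniq_k] := pend i _; first by rewrite gi; exact: (allP cm i ic).
  have := np i ic; rewrite (uniq_k _ _ (nc i ic)); last by apply: (allP cm); rewrite mem_next.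
  by rewrite (uniq_k _ _ (pc i ic)) ?eqxx //; apply: (allP cm); rewrite mem_prev.
pose s i := if i.+1 < g then i.+1 else 0.
have nbr i j : i < g -> j < g -> sym_nat r i j -> j = s i \/ i = s j.
  rewrite /sym_nat /s => ig jg; case: ltngtP => // ij.
    move=> /(on_cycle _ _ ij jg); rewrite /cycle_adj; move: ij jg; clear.
    by case: ifP; case: ifP; lia.
  move=> /(on_cycle _ _ ij ig); rewrite /cycle_adj; move: ij ig; clear.
  by case: ifP; case: ifP; lia.
have s_inj i j : i < g -> j < g -> s i = s j -> i = j.
  by rewrite /s; clear; case: ifP; case: ifP; lia.
(* The two neighbours of [i] on [c] are distinct and [s] is injective, so they cannot both be
   predecessors: one of them is [s i]. *)
have succ i : i \in c -> s i \in c.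
  move=> ic; have [nic pic] : next c i \in c /\ prev c i \in c by rewrite mem_next mem_prev.
  have [nE|nE] := nbr _ _ (small i ic) (small _ nic) (nc i ic); first by rewrite -nE.
  have [pE|pE] := nbr _ _ (small i ic) (small _ pic) (pc i ic); first by rewrite -pE.
  have := np i ic; rewrite (s_inj _ _ (small _ nic) (small _ pic)) ?eqxx //.
  by rewrite -nE -pE.
have up i d : i \in c -> i + d < g -> i + d \in c.
  move=> ic; elim: d => [|d IH]; first by rewrite addn0.
  by rewrite addnS => dg; have := succ _ (IH (ltnW dg)); rewrite /s dg.
have [i ic] : exists i, i \in c by case: (c) c2 => // i c' _; exists i; rewrite mem_head.
have c0 : 0 \in c.
  have ig := small i ic; have := up i (g.-1 - i) ic.
  rewrite subnKC; last by rewrite -ltnS prednK // ltnW // ltnW.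
  have g0 : 0 < g by apply: ltnW; apply: ltnW.
  by rewrite ltn_predL => /(_ g0)/succ; rewrite /s prednK // ltnn.
rewrite -(size_iota 0 g); apply: uniq_leq_size (iota_uniq _ _) _ => j.
by rewrite mem_iota add0n => /andP[_ jg]; rewrite -[j]add0n; apply: up.
Qed.

Fixpoint walks m (r : rel nat) l x :=
  if l is l'.+1 then flatten [seq map (cons y) (walks m r l' y) | y <- iota 0 m & r x y]
  else [:: [::]].

Lemma mem_walks m (r : rel nat) x p : path r x p -> all (ltn^~ m) p -> p \in walks m r (size p) x.
Proof.
elim: p x => [|y p IH] x //= /andP[xy yp] /andP[ym pm].
apply/flattenP; exists (map (cons y) (walks m r (size p) y)).
  by apply: map_f; rewrite mem_filter xy mem_iota.
by apply: map_f; apply: IH.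
Qed.

(** [l] counts the vertices after the starting one, so cycles of length l + 1 are excluded. *)
Definition no_cycle m (r : rel nat) l :=
  all (fun x => all (fun p => ~~ (r (last x p) x && uniq (x :: p))) (walks m r l x)) (iota 0 m).

Lemma no_cycleP m r l c : no_cycle m r l -> ucycle r c -> all (ltn^~ m) c -> size c != l.+1.
Proof.
case: c => // x p /allP no; rewrite /ucycle /cycle rcons_path => /andP[/andP[xp lx] u] /= /andP[xm pm].
apply/eqP => -[pl]; have /allP/(_ p) : all (fun p => ~~ (r (last x p) x && uniq (x :: p))) (walks m r l x).
  by apply: no; rewrite mem_iota.
by rewrite -pl mem_walks // lx => /(_ isT); rewrite negb_and /=; move: u; rewrite /= => ->.
Qed.

Lemma no_cycle_K23ss : no_cycle 7 (sym_nat (cycle2_adj 5 2 true)) 3.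
Proof. by vm_compute. Qed.

Lemma no_cycle_K23sss l : l = 3 \/ l = 4 -> no_cycle 8 (sym_nat (cycle2_adj 6 3 true)) l.
Proof. by case=> ->; vm_compute. Qed.

Section Girth.
Variables (G : sgraph) (g : nat).
Hypothesis girth_G : has_girth G g.

Lemma girth_of_table (vs : seq G) r (l m : nat) : enumerates vs -> size vs = m ->
    adj_table (@adj G) vs = nat_table m r ->
    (forall c, ucycle (sym_nat r) c -> all (ltn^~ m) c -> 2 < size c -> l <= size c) ->
  l <= g.
Proof.
move=> avs sz TE min; have [[c [c2 uc] <-] _] := girth_G; rewrite -sz in TE min.
have [uc' cm] := index_cycle avs TE uc.
by rewrite -(size_map (index^~ vs) c); apply: min; rewrite ?size_map.
Qed.

(** As g >= 4 is given, only 4-cycles have to be excluded by enumeration. *)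
Lemma girth_K23ss (vs : seq G) : 4 <= g -> enumerates vs -> size vs = 7 ->
  adj_table (@adj G) vs = cycle2_table 5 2 true -> 5 <= g.
Proof.
move=> g4 avs sz TE; rewrite ltn_neqAle g4 andbT eq_sym.
have [[c [c2 uc] <-] _] := girth_G; rewrite -(size_map (index^~ vs) c).
have [|uc' cm] := @index_cycle _ vs (cycle2_adj 5 2 true) c avs _ uc; first by rewrite sz.
by apply: no_cycleP no_cycle_K23ss uc' _; rewrite -sz.
Qed.

Lemma girth_K23sss (vs : seq G) : 4 <= g -> enumerates vs -> size vs = 8 ->
  adj_table (@adj G) vs = cycle2_table 6 3 true -> 6 <= g.
Proof.
move=> g4 avs sz TE; suff : g != 4 /\ g != 5 by move: g4; clear; case: g => [|[|[|[|[|[|]]]]]] // _ [].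
have [[c [c2 uc] <-] _] := girth_G; rewrite -(size_map (index^~ vs) c).
have [|uc' cm] := @index_cycle _ vs (cycle2_adj 6 3 true) c avs _ uc; first by rewrite sz.
rewrite sz in cm.
split; [apply: no_cycleP (no_cycle_K23sss (or_introl erefl)) uc' cm |
        apply: no_cycleP (no_cycle_K23sss (or_intror erefl)) uc' cm].
Qed.

Lemma girth_Y (vs : seq G) (l d : nat) : 2 < l -> d < l -> enumerates vs -> size vs = l + 2 ->
  adj_table (@adj G) vs = cycle2_table l d false -> l <= g.
Proof.
move=> l2 dl avs sz TE; apply: (girth_of_table avs sz TE) => c.
apply: cycle_table_girth => // [i j ij jl|j /andP[lj jm]].
  by rewrite /cycle2_adj jl.
have jE : j = l \/ j = l.+1 by move: lj jm; clear; lia.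
exists (if j == l then 0 else d) => k km.
rewrite /sym_nat /cycle2_adj [j < l]ltnNge lj /=.
case: ltngtP => // kj; last first.
  by case: ifP => kl //; case: ifP => [_ /eqP//|_ /eqP].
case: ltnP => kl //.
by move: kl; rewrite ltnNge (leq_trans lj (ltnW kj)).
Qed.

Lemma girth_U (vs : seq G) (l : nat) : 2 < l -> enumerates vs -> size vs = l + 1 ->
  adj_table (@adj G) vs = cycle1_table l -> l <= g.
Proof.
move=> l2 avs sz TE; apply: (girth_of_table avs sz TE) => c.
apply: cycle_table_girth => // [i j ij jl|j /andP[lj jm]].
  by rewrite /cycle1_adj jl.
have jE : j = l by move: lj jm; clear; lia.
exists 0 => k km; rewrite /sym_nat /cycle1_adj jE ltnn.
case: ltngtP => // kl; last by move/eqP.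
by move: km kl; clear; lia.
Qed.

End Girth.

Lemma card_enumerates (T : finType) (vs : seq T) : enumerates vs -> #|T| = size vs.
Proof. by move=> [uvs avs]; rewrite -(card_uniqP uvs); apply/esym/eq_card => v; rewrite avs. Qed.

(** * One vertex off the cycle *)

Section OneVertex.
Variables (R : rcfType) (G : sgraph).
Implicit Types (cs : seq G) (K : {set G}).

(* The test vector is 1 at a vertex of degree three and -1/3 at its neighbours. *)
Lemma count_ge1 cs K (b : R) u a : cycle_config (@adj G) cs K -> u \in K -> a \in cs ->
  adj u a -> (#|G|%:R <= b)%R -> 1 <= laplacian_count G 4%R b.
Proof.
move=> cfg uK acs ua Gb; have /andP[cc uc] := cfg_cycle cfg.
have irr := @adj_irrefl G; have sym := @adj_sym G.
pose vs := [:: a; u; next cs a; prev cs a].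
have an : adj a (next cs a) := next_cycle cc acs.
have ap : adj a (prev cs a) by rewrite sym; apply: prev_cycle.
have uvs : uniq vs.
  rewrite /= !inE !negb_or.
  have ne (x y : G) : adj x y -> x != y by apply: contraTneq => ->; rewrite irr.
  rewrite (ne _ _ an) (ne _ _ ap) [a == u]eq_sym (ne _ _ ua) /=.
  have un x : x \in cs -> u != x by move=> xcs; apply: contraTneq xcs => <-; apply: (cfg_out cfg).
  rewrite !un ?mem_next ?mem_prev //= andbT.
  by apply: next_neq_prev uc (ltnW (cfg_size cfg)) acs.
pose h (y : R) i := nth 0%R [:: y; - y / 3; - y / 3; - y / 3]%R i.
pose E := [:: (0, 1); (0, 2); (0, 3)].
apply: (@laplacian_count_ge R G 4%R b 1 (fun _ v => h 1%R (index v vs)) (fun _ => a)) => //.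
  by move=> i j; rewrite (ord1 i) (ord1 j) /= eqxx.
move=> y; have hE v : (\sum_i y i * h 1%R (index v vs))%R = h (y ord0) (index v vs).
  rewrite big_ord1 /h; move: (index v vs) => [|[|[|[|k]]]] /=; rewrite ?nth_nil; lra.
rewrite /=.
have EP i j : (i, j) \in E -> [/\ i < j, j < size vs & adj (nth a vs i) (nth a vs j)].
  by rewrite !inE !xpair_eqE => /or3P[] /andP[/eqP-> /eqP->]; split; rewrite //= sym.
have -> : energy (@adj G) (fun v => \sum_i y i * h 1 (index v vs))%R =
     energy (@adj G) (fun v => h (y ord0) (index v vs)).
  by rewrite /energy; apply: eq_bigr => v _; apply: eq_bigr => w _; rewrite !hE.
apply: le_trans (energy_ge (h (y ord0)) sym uvs (isT : uniq E) EP).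
have -> : (\sum_v (\sum_i y i * h 1 (index v vs)) ^+ 2 = \sum_(v <- vs) h (y ord0) (index v vs) ^+ 2)%R.
  rewrite [RHS]big_uniq // [RHS]big_mkcond /=; apply: eq_bigr => v _; rewrite hE; case: ifP => // nv.
  by rewrite /h nth_default ?expr0n // memNindex ?nv.
have -> : (\sum_(v <- vs) h (y ord0) (index v vs) ^+ 2 = \sum_(0 <= i < 4) h (y ord0) i ^+ 2)%R.
  rewrite (big_nth a); apply: eq_big_nat => i /andP[_ i4]; by rewrite index_uniq.
rewrite !big_cons big_nil unlock /= /h /=; lra.
Qed.

Lemma isomorphic_U cs K u a : cycle_config (@adj G) cs K -> K = [set u] -> a \in cs ->
    (forall b, b \in cs -> adj u b = (b == a)) -> (forall v, (v \in cs) || (v \in K)) ->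
  isomorphic G (U_graph (size cs).+1).
Proof.
move=> cfg KE acs foot cover; have [t [cfg' eq_cs sz]] := rot_config cfg acs.
have uK : u \in K by rewrite KE set11.
have evs : enumerates (rcons (a :: t) u).
  split; first by rewrite rcons_uniq (cfg_out cfg' uK) (ucycle_uniq (cfg_cycle cfg')).
  by move=> v; rewrite mem_rcons inE eq_cs; move: (cover v); rewrite KE inE orbC.
have U_size : size (U_vertices (size cs).+1) = (size cs).+1.
  by rewrite size_rcons size_map size_enum_ord subn1.
apply: (isomorphic_table evs (enum_U _)); rewrite ?U_size ?size_rcons ?sz //.
rewrite table_U; last by rewrite ltnS ltnW // (cfg_size cfg).
have i0 : index a (a :: t) = 0 by rewrite /= eqxx.
rewrite subn1 -sz; apply: (cycle1_config_table cfg' uK i0 (mem_head _ _)) => b.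
by rewrite eq_cs => /foot.
Qed.

(** Two feet force g = 4, and they must be opposite corners of the square since a side would give a
    triangle. *)
Lemma isomorphic_K23 cs K u a b : cycle_config (@adj G) cs K -> K = [set u] ->
    a \in cs -> b \in cs -> a != b -> adj u a -> adj u b ->
    (forall v, (v \in cs) || (v \in K)) ->
  size cs = 4 /\ isomorphic G K23.
Proof.
move=> cfg KE acs bcs ab ua ub cover; have uK : u \in K by rewrite KE set11.
have g4 : size cs = 4.
  apply/eqP; rewrite eqn_leq (cfg_size cfg) andbT leqNgt; apply/negP => g5.
  by rewrite (attach_uniq cfg g5 uK acs bcs ua ub) eqxx in ab.
split=> //; have [t [cfg' eq_cs sz]] := rot_config cfg acs.
have no (x y z : G) : adj x y -> adj y z -> adj x z = false.
  by move=> xy yz; apply/negP => xz; apply: (no_triangle cfg xy yz); rewrite adj_sym.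
have [sym irr] := (@adj_sym G, @adj_irrefl G).
rewrite g4 in sz; case: t cfg' eq_cs sz => [|x [|c [|y [|? ?]]]] // cfg' eq_cs _.
have /andP[/and5P[ax xc cy ya _] uc] := cfg_cycle cfg'.
have au : adj a u by rewrite sym.
have ux := no _ _ _ ua ax.
have uy : adj u y = false by apply: (no _ a) => //; rewrite sym.
have bc : b = c.
  move: bcs ab; rewrite -eq_cs !inE => /or4P[]/eqP bE; rewrite ?bE ?eqxx //.
  - by rewrite bE ux in ub.
  - by rewrite bE uy in ub.
have evs : enumerates (rcons [:: a; x; c; y] u).
  split; first by rewrite rcons_uniq (cfg_out cfg' uK).
  by move=> v; rewrite mem_rcons inE eq_cs; move: (cover v); rewrite KE inE orbC.
apply: (isomorphic_table evs enum_K23) => //.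
have -> : adj_table (@adj K23) K23_vertices =
  [:: [:: true; false; true; true]; [:: true; false; false]; [:: true; true]; [:: false]; [::]].
  by vm_compute.
have ca : adj c a = false by rewrite sym; apply: no ax xc.
have -> : adj_table (@adj G) (rcons [:: a; x; c; y] u) = [:: [:: adj a x; adj a c; adj a y; adj a u];
   [:: adj x c; adj x y; adj x u]; [:: adj c y; adj c u]; [:: adj y u]; [::]] by [].
rewrite ax xc cy au (sym a y) ya (sym a c) ca (no _ _ _ xc cy) (sym x u) ux (sym y u) uy.
by rewrite (sym c u) -bc ub.
Qed.

Lemma one_vertex_graph cs K : cycle_config (@adj G) cs K -> #|K| = 1 ->
    (forall v, (v \in cs) || (v \in K)) ->
    (exists u a, [/\ u \in K, a \in cs & adj u a]) ->
  isomorphic G K23 \/ isomorphic G (U_graph (size cs).+1).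
Proof.
move=> cfg /eqP/cards1P[u KE] cover [v [a [vK acs va]]].
have {v vK va} ua : adj u a by move: vK va; rewrite KE inE => /eqP->.
case: (boolP (all (fun b => adj u b == (b == a)) cs)) => [/allP foot|].
  by right; apply: (isomorphic_U cfg KE acs) => // b /foot/eqP.
move=> /allPn[b bcs]; have [->|ba] := eqVneq b a; first by rewrite ua.
rewrite eqbF_neg negbK => ub; left.
by rewrite eq_sym in ba; have [_] := isomorphic_K23 cfg KE acs bcs ba ua ub cover.
Qed.

End OneVertex.

Lemma isomorphic_enum (G H : sgraph) (ws : seq H) T : isomorphic G H -> enumerates ws ->
    adj_table (@adj H) ws = T ->
  exists vs : seq G, [/\ enumerates vs, #|G| = size ws, size vs = size ws &
    adj_table (@adj G) vs = T].
Proof.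
move=> iso aws TE; have [vs [avs sz TE']] := isomorphic_transport iso aws.
by exists vs; rewrite TE' (card_enumerates avs).
Qed.

(** * The listed graphs attain the bound *)

Section Converse.
Variables (R : rcfType) (G : sgraph) (g : nat).
Hypotheses (girth_G : has_girth G g) (g4 : 4 <= g).

Lemma isomorphic_one_girth (n : nat) : #|G| = n -> g <= n - 1 ->
  isomorphic G K23 \/ isomorphic G (U_graph n) -> g = n - 1.
Proof.
move=> nE gn iso; apply/eqP; rewrite eqn_leq gn.
case: iso => iso.
  have [vs [_ GE _ _]] := isomorphic_enum iso enum_K23 erefl.
  by rewrite -nE GE.
have n3 : 3 < n by apply: leq_trans g4 (leq_trans gn (leq_subr _ _)).
have [vs [avs _ sz TE]] := isomorphic_enum iso (enum_U n) (table_U n3).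
apply: (girth_U girth_G) avs _ TE; first by move: g4 gn; clear; lia.
by rewrite sz size_rcons size_map size_enum_ord addn1.
Qed.

(** The implication for n = 8 removes Y_{8,3}, where the arc condition 3 g <= 2 d (g - d) fails: 18
    > 16. *)
Lemma isomorphic_Y_count (n i : nat) (b : R) : 6 < n -> 2 < i -> i <= uphalf (n - 1) ->
    (n == 8) ==> (i == 4) -> (#|G|%:R <= b)%R -> isomorphic G (Y_graph n i) ->
  n - 2 <= g /\ 2 <= laplacian_count G 4%R b.
Proof.
move=> n6 i2 iu n8 Gb iso.
have [n4 i0 ig i1] : [/\ 4 < n, 0 < i, i <= n - 2 & 1 < i].
  by move: n6 i2 iu; clear; split; lia.
have [vs [avs _ sz TE]] := isomorphic_enum iso (enum_Y n i) (table_Y n4 i0 ig i1).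
have {}sz : size vs = n - 2 + 2 by rewrite sz !size_rcons size_map size_enum_ord addn2.
split.
  by apply: (girth_Y girth_G) avs sz TE; move: n6 ig i0; clear; lia.
apply: (count_cycle2 avs sz TE) => //.
- by move: i2; clear; lia.
- by move: iu n6; clear; lia.
move: n6 i2 iu n8; clear => n6 i2 iu n8.
have [n8'|n8'] := eqVneq n 8; first by move: n8; rewrite n8' => /eqP->.
have [odd_n|even_n] := boolP (odd (n - 2)); first by [].
(* For even n >= 10 the substitution clears the subtractions: with arcs d + 2 and k + 2 the
   condition becomes 4 <= 2 d k + d + k, and d + k >= 4. *)
have [m [d [mE dE]]] : exists m d, n = m + m + 10 /\ i = d + 3.
  by exists ((n - 10)./2), (i - 3); move: n6 i2 even_n n8'; clear; lia.
have dm : d <= m + 2 by move: iu; rewrite mE dE; clear; lia.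
rewrite mE dE.
have -> : m + m + 10 - 2 - (d + 3 - 1) = m + m + 6 - d by clear; lia.
have -> : m + m + 10 - 2 = m + m + 8 by clear; lia.
have -> : d + 3 - 1 = d + 2 by clear; lia.
have [k kE] : exists k, m + m + 6 = d + k + 2 by exists (m + m + 4 - d); move: dm; clear; lia.
have -> : m + m + 6 - d = k + 2 by move: kE; clear; lia.
have -> : m + m + 8 = d + k + 4 by move: kE; clear; lia.
have : 4 <= d + k by move: kE; clear; lia.
clear; nia.
Qed.

Lemma isomorphic_two_count (n : nat) (b : R) : #|G| = n -> g <= n - 2 -> (n%:R <= b)%R ->
    [\/ n = 6 /\ (isomorphic G (complete_bipartite 2 4) \/ isomorphic G K23s),
        n = 7 /\ (isomorphic G K23ss \/ isomorphic G (Y_graph 7 3)),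
        n = 8 /\ (isomorphic G K23sss \/ isomorphic G (Y_graph 8 4)) |
        (9 <= n) /\ exists2 i : nat, (3 <= i <= uphalf (n - 1)) & isomorphic G (Y_graph n i)] ->
  g = n - 2 /\ 2 <= laplacian_count G 4%R b.
Proof.
move=> nE gn; rewrite -nE => Gb; rewrite nE => iso.
suff [ge_g cnt] : n - 2 <= g /\ 2 <= laplacian_count G 4%R b.
  by split=> //; apply/eqP; rewrite eqn_leq gn.
case: iso => -[n_].
- case=> iso; rewrite n_; split => //.
    have [vs [avs _ sz TE]] := isomorphic_enum iso enum_K24 erefl.
    exact: (count_K24 avs sz TE).
  have [vs [avs _ sz TE]] := isomorphic_enum iso enum_K23s erefl.
  exact: (count_K23s avs sz TE).
- case=> iso; rewrite n_; last by apply: isomorphic_Y_count iso.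
  have [vs [avs _ sz TE]] := isomorphic_enum iso enum_K23ss table_K23ss.
  by split; [exact: girth_K23ss TE | exact: (count_K23ss avs sz TE)].
- case=> iso; rewrite n_; last by apply: isomorphic_Y_count iso.
  have [vs [avs _ sz TE]] := isomorphic_enum iso enum_K23sss table_K23sss.
  by split; [exact: girth_K23sss TE | exact: (count_K23sss avs sz TE)].
move=> [i /andP[i3 iu] iso]; apply: isomorphic_Y_count iso => //; first by move: n_; clear; lia.
by move: n_; clear; case: eqP => // ->.
Qed.

End Converse.

Local Open Scope ring_scope.

Theorem theorem1p2 (R : rcfType) (G : sgraph) (n g k : nat)
    (order_G : #|G| = n) (conn_G : connected_graph G)
    (girth_G : has_girth G g) (g_ge4 : (4 <= g)%N)
    (k_ge1 : (1 <= k)%N) (k_le : (k <= minn (g - 1) (n - g))%N) :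
  let m := laplacian_count G (n%:R - g%:R - k%:R + 4%:R : R) n%:R in
  [/\ (m <= n - g)%N,
      k = 1%N ->
        (m = (n - g)%N <-> g = (n - 1)%N) /\
        (g = (n - 1)%N <-> isomorphic G K23 \/ isomorphic G (U_graph n)) &
      k = 2%N ->
        (m = (n - g)%N <->
          [\/ n = 6%N /\
                (isomorphic G (complete_bipartite 2 4) \/ isomorphic G K23s),
              n = 7%N /\ (isomorphic G K23ss \/ isomorphic G (Y_graph 7 3)),
              n = 8%N /\ (isomorphic G K23sss \/ isomorphic G (Y_graph 8 4)) |
              (9 <= n)%N /\
                exists2 i : nat, (3 <= i <= uphalf (n - 1))%N &
                  isomorphic G (Y_graph n i)])].
Proof.
have [cs szE cfg] := girth_config girth_G g_ge4.
set K := ~: [set x in cs] in cfg; move=> m.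
have [_ conn] := conn_G; have uc := ucycle_uniq (cfg_cycle cfg).
have K_card : #|K| = (n - g)%N by rewrite card_complement // szE order_G.
have [kg kn] : (k < g)%N /\ (k <= n - g)%N.
  by move: k_le k_ge1 g_ge4; rewrite leq_min => /andP[]; clear; lia.
have gn : (g < n)%N by rewrite -subn_gt0 (leq_trans k_ge1).
have cover v : (v \in cs) || (v \in K) by rewrite !inE orbN.
have cross : exists u a, [/\ u \in K, a \in cs & adj u a].
  have [u] : exists u, u \in K by apply/set0Pn; rewrite -card_gt0 K_card subn_gt0.
  rewrite !inE => ucs; have [a acs] : exists a, a \in cs.
    by case: (cs) szE g_ge4 => [<-//|a t _ _]; exists a; rewrite mem_head.
  exact: (@connected_crossing G cs a u conn acs ucs).
have tE : n%:R - g%:R - k%:R + 4%:R = (n - g - k + 4)%N%:R :> R.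
  by rewrite natrD !natrB // ltnW.
have upper s : index_le (@adj G) ((n - g - k + 4)%N%:R : R) s -> (m <= s)%N.
  by move=> bound; apply: (laplacian_count_le _ bound); rewrite tE.
have Gb : #|G|%:R <= n%:R :> R by rewrite order_G.
have m_le : (m <= n - g)%N.
  by apply: upper; rewrite -K_card; apply: (index_le_threshold R cfg) => //; rewrite ?k_ge1 ?szE ?K_card.
split=> // kE.
  have m1 : m = (n - g)%N <-> g = (n - 1)%N.
    split=> [mE|gE].
      (* With at least two vertices off the cycle, the level 5 bound for a pair saves one condition
         at exactly this threshold. *)
      suff : (n - g <= 1)%N by move: gn; clear; lia.
      rewrite leqNgt; apply/negP => K1; have : (m <= n - g - 1)%N.
        apply: upper; rewrite kE; have -> : (n - g - 1 + 4 = n - g + 3)%N by move: K1; clear; lia.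
        by rewrite -K_card; apply: (index_le_threshold1 R cfg); rewrite K_card.
      by rewrite mE; move: K1; clear; lia.
    have s1 : (n - g = 1)%N by rewrite gE; move: gn; clear; lia.
    (* For n - g = k = 1 the threshold is 4, and a cycle vertex with a neighbour off the cycle has
       degree at least three. *)
    apply/eqP; rewrite eqn_leq m_le s1; have [u [a [uK acs ua]]] := cross.
    by rewrite /m tE s1 kE; apply: (count_ge1 cfg uK acs ua Gb).
  split=> //; split=> [gE|].
    have nE : n = (size cs).+1 by rewrite szE gE; move: gn; clear; lia.
    rewrite nE; apply: (one_vertex_graph cfg) => //.
    by rewrite K_card gE; move: gn; clear; lia.
  by apply: (isomorphic_one_girth girth_G g_ge4) => //; move: gn; clear; lia.
have kn2 : (2 <= n - g)%N by rewrite -kE.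
split=> [mE|iso].
  (* With three or more vertices off the cycle, the level 5 bound for a triple saves one condition
     at the threshold for k = 2. *)
  have s2 : (n - g = 2)%N.
    apply/eqP; rewrite eqn_leq kn2 andbT leqNgt; apply/negP => K2.
    have : (m <= n - g - 1)%N.
      apply: upper; rewrite kE; have -> : (n - g - 2 + 4 = n - g + 2)%N by move: kn2; clear; lia.
      by rewrite -K_card; apply: (index_le_threshold2 R cfg); rewrite K_card.
    by rewrite mE; move: K2; clear; lia.
  have nE : n = (size cs + 2)%N by rewrite szE -s2 subnKC // ltnW.
  have [bound|iso] := two_vertex_graph R cfg (etrans K_card s2) cover cross conn; last by rewrite nE.
  have : (m <= 1)%N by apply: upper; rewrite s2 kE.
  by rewrite mE s2.
have gn2 : (g <= n - 2)%N by move: kn2; clear; lia.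
(* A priori only g <= n - 2 is known; the listed graphs give equality, so that the threshold is
   4. *)
have [gE cnt] := isomorphic_two_count girth_G g_ge4 order_G gn2 (lexx (n%:R : R)) iso.
have s2 : (n - g = 2)%N by rewrite gE; move: kn2 gn; clear; lia.
by apply/eqP; rewrite eqn_leq m_le s2 /m tE s2 kE.
Qed.
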